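(* Let $P$ be an infinitely divisible shift-invariant Borel probability measure on $\mathbb{R}^{\mathbb{Z}}$ such that the system $(\mathbb{R}^{\mathbb{Z}},\mathcal{B}(\mathbb{R})^{\otimes\mathbb{Z}},P,S)$, $S$ being the shift, is ergodic. Then this system is a factor of an ergodically infinitely divisible automorphism.
   Context: All systems are automorphisms (invertible measure-preserving transformations) of standard Borel probability spaces. Factors are identified with invariant sub-$\sigma$-algebras. Infinite divisibility: a shift-invariant probability measure $P$ on $\mathbb{R}^{\mathbb{Z}}$ (the law of a stationary process) is infinitely divisible if for every integer $k\ge1$ there is a probability measure $P_k$ on $\mathbb{R}^{\mathbb{Z}}$ with $P=P_k*\cdots*P_k$ ($k$ terms), convolution being taken with respect to coordinatewise addition on $\mathbb{R}^{\mathbb{Z}}$. Ergodically infinitely divisible: let $\{0,1\}^*$ be the set of finite words over $\{0,1\}$, $\varepsilon$ being the empty word. An ergodic automorphism $T$ of $(X,\mathcal{B},\mu)$ is ergodically infinitely divisible if there is a family $\{\mathcal{B}_\omega:\omega\in\{0,1\}^*\}$ of factors of $\mathcal{B}$ such that $\mathcal{B}_\varepsilon=\mathcal{B}$, $\mathcal{B}_\omega=\mathcal{B}_{\omega0}\otimes\mathcal{B}_{\omega1}$ for all $\omega$ (i.e. $\mathcal{B}_{\omega0}$ and $\mathcal{B}_{\omega1}$ are independent and generate $\mathcal{B}_\omega$), and for each $f\in L^2_0(X,\mathcal{B},\mu)$ (zero mean) and each $\eta\in\{0,1\}^{\mathbb{N}}$, $\lim_{n\to\infty}E(f\mid\mathcal{B}_{\eta[0,n)})=0$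 in $L^2$, where $\eta[0,n)$ is the prefix of $\eta$ of length $n$. *)

(* Defs.v *)
From HB Require Import structures.
From mathcomp Require Import all_boot all_order all_algebra.
From mathcomp Require Import all_classical all_reals all_analysis.

Set Implicit Arguments.
Unset Strict Implicit.
Unset Printing Implicit Defensive.

Import Order.TTheory GRing.Theory Num.Theory.
Import numFieldNormedType.Exports.

Local Open Scope classical_set_scope.
Local Open Scope ring_scope.

Definition cylinders (R : realType) : set (set (int -> R)) :=
  \bigcup_(n in [set: int])
    preimage_set_system [set: int -> R] (fun x => x n) measurable.

(* R^Z with the product sigma-algebra *)
Notation RZ R := (g_sigma_algebraType (@cylinders R)).

Definition shiftZ (R : realType) (x : RZ R) : RZ R := fun n : int => x (n + 1).

Definition addZ (R : realType) (xy : RZ R * RZ R) : RZ R :=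
  fun n : int => xy.1 n + xy.2 n.

Definition convolution (R : realType) (P Q : set (RZ R) -> \bar R) :
    set (RZ R) -> \bar R :=
  pushforward (P \x Q)%E (@addZ R).

(* [iterop k] gives Q * (... * Q) with exactly k copies of Q when 0 < k; its
   last argument, the convolution unit, is only the value at k = 0. *)
Definition conv_pow (R : realType) (k : nat) (Q : set (RZ R) -> \bar R) :
    set (RZ R) -> \bar R :=
  iterop k (@convolution R) Q (dirac ((fun=> 0) : RZ R)).

Definition infinitely_divisible (R : realType) (P : probability (RZ R) R) :=
  forall k : nat, (0 < k)%N ->
    exists Q : probability (RZ R) R,
      forall A, measurable A -> P A = conv_pow k Q A.

(* A second countable Hausdorff complete pseudometric space is a Polish space:
   being Hausdorff makes its (complete, countably generated) uniformity
   metrizable. *)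
Definition standard_borel (R : realType) d (X : measurableType d) : Prop :=
  exists U : completePseudoMetricType R,
    [/\ hausdorff_space U, @second_countable U &
        exists2 phi : X -> U, bijective phi &
          (measurable : set (set X)) =
            preimage_set_system setT phi <<s [set V : set U | open V] >>].

Section systems.
Context {R : realType} {d : measure_display} {X : measurableType d}.
Variables (mu : probability X R) (T : X -> X).

Definition measure_preserving : Prop :=
  measurable_fun setT T /\
  forall A, measurable A -> mu (T @^-1` A) = mu A.

Definition automorphism : Prop :=
  measure_preserving /\
  exists T' : X -> X,
    [/\ cancel T T', cancel T' T & measurable_fun setT T'].

Definition ergodic : Prop :=
  forall A, measurable A -> T @^-1` A = A -> mu A = 0%E \/ mu A = 1%E.

Definition invariant_factor (F : set (set X)) : Prop :=
  [/\ sigma_algebra setT F, F `<=` measurable &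
      preimage_set_system setT T F = F].

Definition independent_algebras (F G : set (set X)) : Prop :=
  forall A B, F A -> G B -> mu (A `&` B) = (mu A * mu B)%E.

(* g is a version of E(f | F) *)
Definition is_cond_exp (F : set (set X)) (f g : X -> R) : Prop :=
  [/\ preimage_set_system setT g measurable `<=` F,
      mu.-integrable setT (EFin \o g) &
      forall A, F A ->
        (\int[mu]_(x in A) (g x)%:E = \int[mu]_(x in A) (f x)%:E)%E].

(* Words over {0,1} are [seq bool], with 0 = false and 1 = true.  Equalities of
   sub-sigma-algebras are literal.  Reading them modulo mu-null sets instead
   gives the same notion: replace each B w by the sigma-algebra of all
   measurable sets that are mu-a.e. equal to a member of B w.
   Versions of a conditional expectation agree mu-a.e., so the existential over
   the versions g n does not depend on their choice. *)
Definition ergodically_infinitely_divisible : Prop :=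
  [/\ automorphism, ergodic &
  exists B : seq bool -> set (set X),
    [/\ forall w, invariant_factor (B w),
        B [::] = measurable,
        forall w,
          independent_algebras (B (rcons w false)) (B (rcons w true)) /\
          B w = <<s B (rcons w false) `|` B (rcons w true) >> &
        forall (f : X -> R) (eta : nat -> bool),
          f \in Lfun mu 2%:E -> ('E_mu[f] = 0)%E ->
          exists2 g : nat -> X -> R,
            forall n, is_cond_exp (B (mkseq eta n)) f (g n) &
            Lnorm mu 2%:E (EFin \o g n) @[n --> \oo] --> 0%E]].

End systems.

(* (Y, nu, S) is a factor of (X, mu, T) *)
Definition is_factor_of (R : realType) d d' (Y : measurableType d)
    (nu : probability Y R) (S : Y -> Y) (X : measurableType d')
    (mu : probability X R) (T : X -> X) : Prop :=
  exists pi : X -> Y,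
    [/\ measurable_fun setT pi,
        forall A, measurable A -> mu (pi @^-1` A) = nu A &
        {ae mu, forall x, pi (T x) = S (pi x)}].

(* Main.v *)
Require Import Defs.
From HB Require Import structures.
From mathcomp Require Import all_boot all_order all_algebra.
From mathcomp Require Import all_classical all_reals all_analysis.
From mathcomp Require Import measurable_realfun complex ring lra.

Import Order.TTheory GRing.Theory Num.Theory.
Import numFieldNormedType.Exports.

Set Implicit Arguments.
Unset Strict Implicit.
Unset Printing Implicit Defensive.

Local Open Scope classical_set_scope.
Local Open Scope ring_scope.

(** An infinitely divisible law has a characteristic function without zeros, so its
    continuous roots are unique: the roots Q_n of P of order 2^n are stationary and
    Q_n is the convolution square of Q_(n+1) [root_sequence]. Attach a real process to
    every node of the infinite binary tree, so that the process at a node is the sum of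
    the processes at its two children and the processes at depth n are independent of
    law Q_n. These laws are consistent and define a probability on the labelled trees
    [tree_measures]. Shifting all processes at once is an automorphism, and the process
    at the root is a factor map onto the system of P. The factors B_w are generated by
    the subtrees at the words w, completed by the null sets: the two subtrees below a
    node are independent, and almost surely they rebuild the subtree at this node
    [subtree_factor_independent, subtree_factor_generated].

    Ergodicity of the tree. For a linear functional l, consider the stationary family
    1 + v_a = exp(i l(S^a x)) / E exp(i l) under Q_n and its correlations
    c_n(a, b) = E[v_a conj(v_b)]. Since the characters of Q_n are the squares of those
    of Q_(n+1), one has 1 + c_n = (1 + c_(n+1))^2. The Cesaro means over squares of c_0
    tend to 0 by the mean ergodic theorem for P; by Schur's product theorem those of
    c_n and of Re(c_n^2) are nonnegative, so the recursion makes them tend to 0 for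
    every n. It remains to control Im(c_n). At a deep level the variance r_n of v is
    small and |v|^2 = r_n - 2 Re(v), so that the real part of v is of smaller order
    than v itself, and the mixed correlations of its real and imaginary parts are
    small compared with r_n. As |c_n| / r_n increases with n, the Cesaro means of
    |c_m|^2 tend to 0 at every level m [nsq_cvg]: all roots of P are weakly mixing
    [roots_wmix]. Weak mixing passes to products, hence to the trees [tree_wmix], and an
    invariant set is then uncorrelated with all trigonometric functions [tree_ergodic].

    Conditional expectations along a branch. A functional of finite height, restricted
    to a subtree at a depth of at least this height, is a fixed functional of the
    process at the root of that subtree. The modulus of its characteristic function is
    a root of order 2^n of a positive number and tends to 1, so the functional tends to
    a constant and the trigonometric functions become uncorrelated with the subtree
    [trig_decorrelation]. This extends to bounded functions by linearity and bounded
    limits [fourier_ind, decorrelates_bmf] and to square integrable ones by truncation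
    [decorrelates_L2]. Testing a conditional expectation against its own truncations
    then shows that it tends to 0 in the second norm [cond_exp_sqr]. *)

(** * Expectations of bounded measurable functions *)

Lemma measurable_preimage {d d'} {T : measurableType d} {T' : measurableType d'}
    (f : T -> T') (A : set T') :
  measurable_fun setT f -> measurable A -> measurable (f @^-1` A).
Proof. by move=> mf mA; rewrite -[X in measurable X]setTI; exact: mf. Qed.

Section bounded_measurable.
Context {R : realType}.

Definition bmf {d} {T : measurableType d} (f : T -> R) : Prop :=
  measurable_fun setT f /\ exists C : R, forall x, `|f x| <= C.

Context {d} {T : measurableType d}.
Implicit Types f g : T -> R.

Lemma bmf_cst (r : R) : bmf (fun _ : T => r).
Proof. by split; [exact: measurable_cst | exists `|r|]. Qed.

Lemma bmfD f g : bmf f -> bmf g -> bmf (fun x => f x + g x).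
Proof.
move=> [mf [C hC]] [mg [D hD]]; split; first exact: measurable_funD.
by exists (C + D) => x; rewrite (le_trans (ler_normD _ _))// lerD.
Qed.

Lemma bmfM f g : bmf f -> bmf g -> bmf (fun x => f x * g x).
Proof.
move=> [mf [C hC]] [mg [D hD]]; split; first exact: measurable_funM.
by exists (C * D) => x; rewrite normrM ler_pM.
Qed.

Lemma bmfZ r f : bmf f -> bmf (fun x => r * f x).
Proof. by apply: bmfM; exact: bmf_cst. Qed.

Lemma bmfN f : bmf f -> bmf (fun x => - f x).
Proof.
by move=> /(bmfZ (-1)); under eq_fun do rewrite mulN1r.
Qed.

Lemma bmfB f g : bmf f -> bmf g -> bmf (fun x => f x - g x).
Proof. by move=> hf hg; apply: bmfD => //; exact: bmfN. Qed.

Lemma bmfX f n : bmf f -> bmf (fun x => f x ^+ n).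
Proof.
move=> bf; elim: n => [|n IH]; first by under eq_fun do rewrite expr0; exact: bmf_cst.
by under eq_fun do rewrite exprS; exact: bmfM.
Qed.

Lemma bmf_sum (I : Type) (s : seq I) (p : pred I) (F : I -> T -> R) :
  (forall i, bmf (F i)) -> bmf (fun x => \sum_(i <- s | p i) F i x).
Proof.
move=> h; elim: s => [|i s IH].
  by under eq_fun do rewrite big_nil; exact: bmf_cst.
under eq_fun do rewrite big_cons.
by case: (p i) => //; exact: bmfD.
Qed.

Lemma bmf_indic (A : set T) : measurable A -> bmf (\1_A : T -> R).
Proof.
move=> mA; split; first exact: measurable_indic.
by exists 1 => x; rewrite indicE; case: (_ \in _); rewrite ?normr1 ?normr0.
Qed.

Lemma bmf_comp {d'} {T' : measurableType d'} (h : T' -> T) f :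
  measurable_fun setT h -> bmf f -> bmf (fun x => f (h x)).
Proof.
move=> mh [mf [C hC]]; split; last by exists C.
exact: (measurableT_comp mf mh).
Qed.

Lemma bmf_cos (h : T -> R) : measurable_fun setT h -> bmf (fun x => cos (h x)).
Proof.
move=> mh; split; last by exists 1 => x; rewrite ler_norml cos_geN1 cos_le1.
by apply: (measurableT_comp _ mh); apply: continuous_measurable_fun; exact: continuous_cos.
Qed.

Lemma bmf_sin (h : T -> R) : measurable_fun setT h -> bmf (fun x => sin (h x)).
Proof.
move=> mh; split; last by exists 1 => x; rewrite ler_norml sin_geN1 sin_le1.
by apply: (measurableT_comp _ mh); apply: continuous_measurable_fun; exact: continuous_sin.
Qed.

Lemma bmf_lim (f_ : nat -> T -> R) f (C : R) :
  (forall n, bmf (f_ n)) -> (forall n x, `|f_ n x| <= C) ->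
  (forall x, f_ ^~ x @ \oo --> f x) -> bmf f.
Proof.
move=> bf hC cf; split.
  apply: (measurable_fun_cvg (h := f_)) => [n|x _]; [exact: (bf n).1|exact: cf].
exists C => x; have := cvg_norm (cf x).
move=> /(_ _) h; have /cvg_lim <- // := h.
by apply: limr_le; [apply: cvgP h | exact: nearW].
Qed.

End bounded_measurable.

(* proves bmf along the shape of a function, from the hypotheses *)
Ltac bmt := repeat first
  [ assumption | exact: bmf_cst | apply: bmfB | apply: bmfD | apply: bmfN
  | apply: bmfX | apply: bmfM | apply: bmf_sum => ?
  | exact: measurable_fst | exact: measurable_snd ].

Section expectation.
Context {R : realType} {d} {T : measurableType d} (P : probability T R).
Implicit Types f g : T -> R.

Definition Ex f : R := Rintegral P setT f.

Lemma bmf_integrable f : bmf f -> P.-integrable setT (EFin \o f).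
Proof.
move=> [mf [C hC]]; apply: measurable_bounded_integrable => //.
  by rewrite ltey_eq fin_num_measure.
exists C; split; first by rewrite num_real.
by move=> y Cy x _ /=; apply: le_trans (ltW Cy).
Qed.

Lemma Ex_EFin f : bmf f -> (\int[P]_x (f x)%:E)%E = (Ex f)%:E.
Proof.
by move=> bf; rewrite /Ex /Rintegral fineK//; apply: integrable_fin_num => //; exact: bmf_integrable.
Qed.

Lemma eq_Ex f g : f =1 g -> Ex f = Ex g.
Proof. by move=> fg; apply: eq_Rintegral => x _; exact: fg. Qed.

Lemma ExD f g : bmf f -> bmf g -> Ex (fun x => f x + g x) = Ex f + Ex g.
Proof. by move=> bf bg; apply: RintegralD => //; exact: bmf_integrable. Qed.

Lemma ExB f g : bmf f -> bmf g -> Ex (fun x => f x - g x) = Ex f - Ex g.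
Proof. by move=> bf bg; apply: RintegralB => //; exact: bmf_integrable. Qed.

Lemma ExZ r f : bmf f -> Ex (fun x => r * f x) = r * Ex f.
Proof. by move=> bf; apply: RintegralZl => //; exact: bmf_integrable. Qed.

Lemma ExZr r f : bmf f -> Ex (fun x => f x * r) = Ex f * r.
Proof. by move=> bf; apply: RintegralZr => //; exact: bmf_integrable. Qed.

Lemma ExN f : bmf f -> Ex (fun x => - f x) = - Ex f.
Proof. by move=> bf; rewrite -mulN1r -ExZ//; apply: eq_Ex => x; rewrite mulN1r. Qed.

Lemma Ex_cst r : Ex (fun _ => r) = r.
Proof. rewrite /Ex Rintegral_cst//.
by have /(congr1 fine) /= -> := @probability_setT _ _ _ P; rewrite mulr1. Qed.

Lemma Ex_sum (I : Type) (s : seq I) (p : pred I) (F : I -> T -> R) :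
  (forall i, bmf (F i)) ->
  Ex (fun x => \sum_(i <- s | p i) F i x) = \sum_(i <- s | p i) Ex (F i).
Proof.
move=> h; elim: s => [|i s IH].
  by under eq_Ex do rewrite big_nil; rewrite big_nil Ex_cst.
under eq_Ex do rewrite big_cons.
rewrite big_cons; case: (p i) => //.
by rewrite ExD ?IH//; exact: bmf_sum.
Qed.

Lemma Ex_ge0 f : (forall x, 0 <= f x) -> 0 <= Ex f.
Proof. by move=> f0; exact: Rintegral_ge0. Qed.

Lemma le_Ex f g : bmf f -> bmf g -> (forall x, f x <= g x) -> Ex f <= Ex g.
Proof. by move=> bf bg fg; apply: le_Rintegral => //; exact: bmf_integrable. Qed.

Lemma Ex_indic (A : set T) : measurable A -> Ex \1_A = fine (P A).
Proof. by move=> mA; rewrite /Ex /Rintegral integral_indic// setIT. Qed.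

Lemma Ex_cvg (f_ : nat -> T -> R) f (C : R) :
  (forall n, bmf (f_ n)) -> (forall n x, `|f_ n x| <= C) ->
  (forall x, f_ ^~ x @ \oo --> f x) -> (fun n => Ex (f_ n)) @ \oo --> Ex f.
Proof.
move=> bf hC cf; have bff := bmf_lim bf hC cf.
have [] := @dominated_convergence _ _ _ P setT measurableT
  (fun n x => (f_ n x)%:E) (fun x => (f x)%:E) (fun=> C%:E).
- by move=> n; apply/measurable_EFinP; exact: (bf n).1.
- by apply/measurable_EFinP; exact: bff.1.
- by apply: aeW => x _; apply: cvg_EFin; [exact: nearW | exact: cf].
- exact: (@bmf_integrable (fun _ => C) (bmf_cst C)).
- by apply: aeW => x n _ /=; rewrite lee_fin.
by move=> _ _; rewrite Ex_EFin// => /fine_cvgP[].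
Qed.

(** The discriminant argument, run with the real number c = E[fg]. *)
Lemma Ex_CS f g : bmf f -> bmf g ->
  Ex (fun x => f x * g x) ^+ 2 <= Ex (fun x => f x ^+ 2) * Ex (fun x => g x ^+ 2).
Proof.
move=> bf bg; set c := Ex _; set a := Ex _; set b := Ex _.
have quad (s t : R) : 0 <= s ^+ 2 * a + t ^+ 2 * b + 2 * (s * t) * c.
  have -> : s ^+ 2 * a + t ^+ 2 * b + 2 * (s * t) * c =
      Ex (fun x => (s * f x + t * g x) ^+ 2).
    rewrite -!ExZ; [|by bmt..].
    rewrite -!ExD; [|by bmt..].
    by apply: eq_Ex => x; ring.
  by apply: Ex_ge0 => x; exact: sqr_ge0.
have a0 : 0 <= a by apply: Ex_ge0 => x; exact: sqr_ge0.
have b0 : 0 <= b by apply: Ex_ge0 => x; exact: sqr_ge0.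
have [b00|bn0] := eqVneq b 0.
  have [->|cn0] := eqVneq c 0; first by rewrite expr0n/= mulr_ge0.
  have := quad c (- (a + 1)); rewrite b00 => h.
  have c2 : 0 < c ^+ 2 by rewrite exprn_even_gt0.
  exfalso; have h2 : 0 <= c ^+ 2 * (- a - 2) by move: h; lra.
  by move: h2; rewrite pmulr_rge0//; lra.
have bp : 0 < b by rewrite lt_neqAle eq_sym bn0.
have := quad b (- c); rewrite (_ : _ + _ = b * (a * b - c ^+ 2)); last by ring.
by rewrite pmulr_rge0// subr_ge0.
Qed.

End expectation.

(** * Image measures and products *)

Section law.
Context {R : realType} {d d'} {T : measurableType d} {T' : measurableType d'}.

Definition mfun_of (f : T -> T') (mf : measurable_fun setT f) : {mfun T >-> T'} :=
  MeasurableFun.Pack (MeasurableFun.Class (isMeasurableFun.Build _ _ _ _ _ mf)).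

Definition law (P : probability T R) (f : T -> T') (mf : measurable_fun setT f) :
    probability T' R := distribution P (mfun_of mf).

Lemma lawE (P : probability T R) (f : T -> T') (mf : measurable_fun setT f) A :
  law P mf A = P (f @^-1` A).
Proof. by []. Qed.

Lemma Ex_law (P : probability T R) (f : T -> T') (mf : measurable_fun setT f)
  (g : T' -> R) : bmf g -> Ex (law P mf) g = Ex P (fun x => g (f x)).
Proof.
move=> bg; rewrite /Ex /Rintegral; congr fine.
rewrite -[LHS]/(\int[pushforward P f]_(y in setT) (EFin \o g) y)%E.
rewrite integral_pushforward//.
- by apply/measurable_EFinP; exact: bg.1.
- exact: (bmf_integrable P (bmf_comp mf bg)).
Qed.

End law.

Lemma eq_Ex_measure {R : realType} {d} {T : measurableType d}
    (P Q : probability T R) (f : T -> R) :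
  (forall A, measurable A -> P A = Q A) -> Ex P f = Ex Q f.
Proof.
by move=> PQ; rewrite /Ex /Rintegral; congr fine; apply: eq_measure_integral => A mA _; exact: PQ.
Qed.

Section product.
Context {R : realType} {d1 d2} {T1 : measurableType d1} {T2 : measurableType d2}.

Definition prodp (P : probability T1 R) (Q : probability T2 R) :
  probability (T1 * T2)%type R := (P \x Q)%E.

Variables (P : probability T1 R) (Q : probability T2 R).

Lemma prodpE A B : measurable A -> measurable B ->
  prodp P Q (A `*` B) = (P A * Q B)%E.
Proof. by move=> mA mB; rewrite /prodp/= product_measure1E. Qed.

Lemma Ex_prod (f : T1 * T2 -> R) : bmf f ->
  Ex (prodp P Q) f = Ex P (fun x => Ex Q (fun y => f (x, y))).
Proof.
move=> bf; rewrite /Ex [LHS]/Rintegral /prodp/=.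
rewrite -(integral12_prod_meas1 (bmf_integrable (prodp P Q) bf)) /fubini_F.
congr fine; apply: eq_integral => x _ /=.
by apply: (@Ex_EFin _ _ _ Q (fun y => f (x, y))); apply: (bmf_comp _ bf); exact: measurable_pair1.
Qed.

Lemma bmf_fst (f : T1 -> R) : bmf f -> bmf (fun z : T1 * T2 => f z.1).
Proof. by apply: bmf_comp; exact: measurable_fst. Qed.

Lemma bmf_snd (f : T2 -> R) : bmf f -> bmf (fun z : T1 * T2 => f z.2).
Proof. by apply: bmf_comp; exact: measurable_snd. Qed.

Lemma Ex_prodM (f : T1 -> R) (g : T2 -> R) : bmf f -> bmf g ->
  Ex (prodp P Q) (fun z => f z.1 * g z.2) = Ex P f * Ex Q g.
Proof.
move=> bf bg; rewrite Ex_prod/=; last by apply: bmfM; [exact: bmf_fst|exact: bmf_snd].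
by under eq_Ex => x do rewrite ExZ//; rewrite ExZr.
Qed.

End product.

Lemma prodp_eq {R : realType} {d1 d2} {T1 : measurableType d1} {T2 : measurableType d2}
    (P : probability T1 R) (Q : probability T2 R) (M : probability (T1 * T2)%type R) :
  (forall A B, measurable A -> measurable B -> M (A `*` B) = (P A * Q B)%E) ->
  forall A, measurable A -> prodp P Q A = M A.
Proof. by move=> h A mA; rewrite /prodp/=; apply: product_measure_unique. Qed.

Section product_trigonometry.
Context {R : realType} {d1 d2} {T1 : measurableType d1} {T2 : measurableType d2}.
Variables (P : probability T1 R) (Q : probability T2 R).

Lemma Ex_prod_swap (F : T1 * T2 -> R) : bmf F ->
  Ex (prodp P Q) F = Ex (prodp Q P) (fun z => F (z.2, z.1)).
Proof.
move=> bF; have ms : measurable_fun setT (fun z : T2 * T1 => (z.2, z.1)).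
  by apply: measurable_fun_pair; [exact: measurable_snd|exact: measurable_fst].
rewrite -[RHS](Ex_law (prodp Q P) ms bF); apply: eq_Ex_measure; apply: prodp_eq => A B mA mB.
rewrite lawE (_ : _ @^-1` _ = B `*` A); first by rewrite prodpE// muleC.
by apply/seteqP; split => z [].
Qed.

(** The addition formulas, under independence and weighted by a function of the
    first variable. *)
Lemma Ex_trigD (f h : T1 -> R) (g : T2 -> R) :
  measurable_fun setT f -> measurable_fun setT g -> bmf h ->
  Ex (prodp P Q) (fun z => cos (f z.1 + g z.2) * h z.1) =
    Ex P (fun x => cos (f x) * h x) * Ex Q (fun y => cos (g y)) -
    Ex P (fun x => sin (f x) * h x) * Ex Q (fun y => sin (g y)) /\
  Ex (prodp P Q) (fun z => sin (f z.1 + g z.2) * h z.1) =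
    Ex P (fun x => sin (f x) * h x) * Ex Q (fun y => cos (g y)) +
    Ex P (fun x => cos (f x) * h x) * Ex Q (fun y => sin (g y)).
Proof.
move=> mf mg bh; have cf := bmfM (bmf_cos mf) bh; have sf := bmfM (bmf_sin mf) bh.
have cg := bmf_cos mg; have sg := bmf_sin mg.
have cf1 := bmf_fst cf : bmf (fun z : T1 * T2 => cos (f z.1) * h z.1).
have sf1 := bmf_fst sf : bmf (fun z : T1 * T2 => sin (f z.1) * h z.1).
have cg2 := bmf_snd cg : bmf (fun z : T1 * T2 => cos (g z.2)).
have sg2 := bmf_snd sg : bmf (fun z : T1 * T2 => sin (g z.2)).
rewrite -(Ex_prodM P Q cf cg) -(Ex_prodM P Q sf sg) -(Ex_prodM P Q sf cg) -(Ex_prodM P Q cf sg).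
split.
- rewrite -ExB; [|exact: bmfM cf1 cg2|exact: bmfM sf1 sg2].
  by apply: eq_Ex => z; rewrite cosD; ring.
- rewrite -ExD; [|exact: bmfM sf1 cg2|exact: bmfM cf1 sg2].
  by apply: eq_Ex => z; rewrite sinD; ring.
Qed.

Lemma Ex_trigD1 (f : T1 -> R) (g : T2 -> R) :
  measurable_fun setT f -> measurable_fun setT g ->
  Ex (prodp P Q) (fun z => cos (f z.1 + g z.2)) =
    Ex P (fun x => cos (f x)) * Ex Q (fun y => cos (g y)) -
    Ex P (fun x => sin (f x)) * Ex Q (fun y => sin (g y)) /\
  Ex (prodp P Q) (fun z => sin (f z.1 + g z.2)) =
    Ex P (fun x => sin (f x)) * Ex Q (fun y => cos (g y)) +
    Ex P (fun x => cos (f x)) * Ex Q (fun y => sin (g y)).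
Proof.
move=> mf mg; have := Ex_trigD mf mg (bmf_cst 1).
have e d (T : measurableType d) (M : probability T R) (F : T -> R) :
  Ex M (fun x => F x * 1) = Ex M F by apply: eq_Ex => x; rewrite mulr1.
by rewrite !e.
Qed.

End product_trigonometry.

(** * Sequences of real numbers *)

Section real_sequences.
Context {R : realType}.
Implicit Types u v : nat -> R.

Lemma seq_cvgP u (l : R) : u @ \oo --> l <->
  forall e : R, 0 < e -> exists N, forall n, (N <= n)%N -> `|u n - l| <= e.
Proof.
split=> [/cvgrPdist_le h e e0|h].
  have [N _ hN] := h _ e0; exists N => n Nn.
  by rewrite distrC; apply: hN.
apply/cvgrPdist_le => e e0; have [N hN] := h _ e0.
by exists N => // n /= Nn; rewrite distrC; apply: hN.
Qed.

Lemma seq_squeeze u v (l : R) :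
  (forall n, `|u n - l| <= v n) -> v @ \oo --> (0 : R) -> u @ \oo --> l.
Proof.
move=> uv /seq_cvgP hv; apply/seq_cvgP => e e0; have [N hN] := hv _ e0.
exists N => n /hN; rewrite subr0; apply: le_trans.
by apply: le_trans (ler_norm _); apply: uv.
Qed.

Lemma seq_cvg_eventually u (l : R) N : (forall n, (N <= n)%N -> u n = l) ->
  u @ \oo --> l.
Proof.
move=> h; apply/seq_cvgP => e e0; exists N => n /h ->.
by rewrite subrr normr0 ltW.
Qed.

Lemma seq_cvg_geo (a z : R) : 0 <= z < 1 -> (fun n => a * z ^+ n) @ \oo --> (0 : R).
Proof.
by move=> /andP[z0 z1]; apply: cvg_geometric; rewrite ger0_norm.
Qed.

End real_sequences.

(** * Induction on bounded measurable functions *)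

Section bounded_induction.
Context {R : realType} {d} {T : measurableType d}.

(** The remainder of a function with values in the unit interval after n binary
    digits; each digit is the indicator of a measurable set. *)
Fixpoint bin_rem (f : T -> R) n : T -> R :=
  if n is n'.+1 then
    fun x => bin_rem f n' x -
      2^-1 ^+ n * \1_[set y | 2^-1 ^+ n <= bin_rem f n' y] x
  else f.

(** After rescaling to values in [0, 1], the binary expansion of a function is a
    uniform limit of linear combinations of indicators. *)
Lemma bmf_ind (H : (T -> R) -> Prop) :
  (forall A, measurable A -> H \1_A) ->
  (forall f g, H f -> H g -> H (fun x => f x + g x)) ->
  (forall r f, H f -> H (fun x => r * f x)) ->
  (forall (f_ : nat -> T -> R) f (C : R), (forall n, H (f_ n)) ->
    (forall n x, `|f_ n x| <= C) -> (forall x, f_ ^~ x @ \oo --> f x) -> H f) ->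
  forall f, bmf f -> H f.
Proof.
move=> Hi HD HZ Hl f.
have Hc r : H (fun=> r).
  have := HZ r _ (Hi setT measurableT); congr H; apply/funext => x.
  by rewrite indicE in_setT mulr1.
have HB g h : H g -> H h -> H (fun x => g x - h x).
  move=> hg hh; have := HD _ _ hg (HZ (-1) _ hh); congr H; apply/funext => x.
  by rewrite mulN1r.
suff key (g : T -> R) : measurable_fun setT g -> (forall x, 0 <= g x <= 1) -> H g.
  move=> [mf [C hC]]; pose D := `|C| + 1.
  have D0 : 0 < D by rewrite /D ltr_wpDl.
  have hD x : `|f x| <= D by rewrite (le_trans (hC x))// (le_trans (ler_norm C))// lerDl.
  have hm : measurable_fun setT (fun x => (f x / D + 1) / 2).
    apply: measurable_funM; last exact: measurable_cst.
    apply: measurable_funD; last exact: measurable_cst.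
    by apply: measurable_funM => //; exact: measurable_cst.
  have hb x : 0 <= (f x / D + 1) / 2 <= 1.
    have := hD x; rewrite ler_norml => /andP[h1 h2].
    have : -1 <= f x / D by rewrite ler_pdivlMr// mulN1r.
    have : f x / D <= 1 by rewrite ler_pdivrMr// mul1r.
    by move=> *; apply/andP; split; lra.
  have := HB _ _ (HZ (2 * D) _ (key _ hm hb)) (Hc D).
  congr H; apply/funext => x; field.
  by rewrite gt_eqF.
move=> mg g01.
have mr n : measurable_fun setT (bin_rem g n).
  elim: n => [//|n IH] /=; apply: measurable_funB => //.
  apply: measurable_funM; first exact: measurable_cst.
  apply: measurable_indic.
  by rewrite -[X in measurable X]setTI; apply: measurable_fun_ler => //; exact: measurable_cst.
have rb n x : 0 <= bin_rem g n x <= 2^-1 ^+ n.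
  elim: n => [|n /andP[h0 h1]] /=; first by rewrite expr0.
  have e : 2^-1 ^+ n = 2 * 2^-1 ^+ n.+1 :> R by rewrite exprS; field.
  rewrite indicE; have [h|h] := leP (2^-1 ^+ n.+1) (bin_rem g n x).
    rewrite mem_set//= mulr1 subr_ge0 h/= lerBlDr; lra.
  rewrite memNset/= ?mulr0 ?subr0 ?h0 ?(ltW h)//.
    by apply/negP; rewrite -ltNge.
apply: (Hl (fun n x => g x - bin_rem g n x) g 2).
- elim=> [|n IH] /=; first by under eq_fun do rewrite subrr; exact: Hc.
  under eq_fun do rewrite opprB addrCA addrC.
  apply: HD => //; apply: HZ; apply: Hi.
  by rewrite -[X in measurable X]setTI; apply: measurable_fun_ler => //; exact: measurable_cst.
- move=> n x; have := g01 x; have /andP[] := rb n x.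
  have : 2^-1 ^+ n <= 1 :> R by apply: exprn_ile1; lra.
  by move=> *; rewrite ler_norml; apply/andP; split; lra.
- move=> x; apply: (seq_squeeze (v := fun n => 1 * 2^-1 ^+ n)); last by apply: seq_cvg_geo; lra.
  move=> n; rewrite addrAC subrr add0r normrN mul1r.
  by have /andP[h0 h1] := rb n x; rewrite ger0_norm.
Qed.

End bounded_induction.

(** * Real product spaces and their trigonometric functions *)

(** The cylinders of R^J; for J = int the space RJ J R is the process space. *)
Definition cyl (J : Type) (R : realType) : set (set (J -> R)) :=
  \bigcup_(j in [set: J])
    preimage_set_system [set: J -> R] (fun x => x j) measurable.
Arguments cyl : clear implicits.

Notation RJ J R := (g_sigma_algebraType (cyl J R)).

Section product_space.
Context {R : realType} {J : Type}.

Lemma measurable_coord (j : J) : measurable_fun setT (fun x : RJ J R => x j).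
Proof.
move=> _ B mB; apply: sub_sigma_algebra; exists j => //.
by exists B.
Qed.

Lemma measurable_RJ {d} {T : measurableType d} (f : T -> RJ J R) :
  (forall j, measurable_fun setT (fun t => f t j)) -> measurable_fun setT f.
Proof.
move=> h; apply: (@measurability _ _ T (RJ J R) setT f (cyl J R)) => //.
by move=> A [_ [j _ [B mB <-]] <-]; rewrite [X in measurable X]setTI setTI; have := h j measurableT B mB; rewrite setTI.
Qed.

(* A finitely supported linear functional on R^J is a list of weighted
   coordinates. *)
Definition lform := seq (J * R).

Definition ev (l : lform) (x : J -> R) : R := \sum_(p <- l) p.2 * x p.1.
Definition lformZ (t : R) (l : lform) : lform := [seq (p.1, t * p.2) | p <- l].

Lemma ev_nil x : ev [::] x = 0. Proof. by rewrite /ev big_nil. Qed.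

Lemma ev_cons p l x : ev (p :: l) x = p.2 * x p.1 + ev l x.
Proof. by rewrite /ev big_cons. Qed.

Lemma ev_cat l l' x : ev (l ++ l') x = ev l x + ev l' x.
Proof. by rewrite /ev big_cat. Qed.

Lemma evZ t l x : ev (lformZ t l) x = t * ev l x.
Proof.
rewrite /ev big_map mulr_sumr; apply: eq_bigr => p _ /=; by rewrite mulrA.
Qed.

Lemma measurable_ev l : measurable_fun setT (ev l : RJ J R -> R).
Proof.
elim: l => [|p l IH].
  rewrite (_ : ev [::] = fun _ : RJ J R => 0); first exact: measurable_cst.
  by apply/funext => x; exact: ev_nil.
rewrite (_ : ev _ = fun x : RJ J R => p.2 * x p.1 + ev l x); last first.
  by apply/funext => x; exact: ev_cons.
apply: measurable_funD => //.
by apply: measurable_funM; [exact: measurable_cst | exact: measurable_coord].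
Qed.

Lemma bmf_cosev l : bmf (fun x : RJ J R => cos (ev l x)).
Proof. by apply: bmf_cos; exact: measurable_ev. Qed.

Lemma bmf_sinev l : bmf (fun x : RJ J R => sin (ev l x)).
Proof. by apply: bmf_sin; exact: measurable_ev. Qed.

(** The induction hypotheses for bounded measurable functions on R^J: it suffices to
    treat the trigonometric functions, linear combinations and bounded limits. *)
Record fourier_closed (H : (RJ J R -> R) -> Prop) : Prop := FourierClosed {
  fc_cos : forall l, H (fun x => cos (ev l x));
  fc_sin : forall l, H (fun x => sin (ev l x));
  fc_add : forall f g, H f -> H g -> H (fun x => f x + g x);
  fc_scale : forall r f, H f -> H (fun x => r * f x);
  fc_lim : forall (f_ : nat -> RJ J R -> R) f (C : R), (forall n, H (f_ n)) ->
    (forall n x, `|f_ n x| <= C) -> (forall x, f_ ^~ x @ \oo --> f x) -> H f }.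

(* the least class closed in this sense *)
Definition tclass (f : RJ J R -> R) : Prop := forall H, fourier_closed H -> H f.

Lemma tclass_closed : fourier_closed tclass.
Proof.
split=> [l H hH|l H hH|f g hf hg H hH|r f hf H hH|f_ f C hf hC cf H hH].
- exact: fc_cos.
- exact: fc_sin.
- by apply: fc_add => //; [exact: hf|exact: hg].
- by apply: fc_scale => //; exact: hf.
- by apply: (fc_lim hH (f_ := f_) (C := C)) => // n; exact: hf.
Qed.

Lemma bmf_closed : fourier_closed bmf.
Proof.
split; [exact: bmf_cosev|exact: bmf_sinev|move=> f g; exact: bmfD|move=> r f; exact: bmfZ|].
by move=> f_ f C; exact: bmf_lim.
Qed.

Lemma tclass_bmf f : tclass f -> bmf f.
Proof. by apply; exact: bmf_closed. Qed.

Lemma tclassD f g : tclass f -> tclass g -> tclass (fun x => f x + g x).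
Proof. exact: (fc_add tclass_closed). Qed.

Lemma tclassZ r f : tclass f -> tclass (fun x => r * f x).
Proof. exact: (fc_scale tclass_closed). Qed.

Lemma tclass_lim (f_ : nat -> RJ J R -> R) f (C : R) : (forall n, tclass (f_ n)) ->
  (forall n x, `|f_ n x| <= C) -> (forall x, f_ ^~ x @ \oo --> f x) -> tclass f.
Proof. exact: (fc_lim tclass_closed). Qed.

Lemma tclass_cst r : tclass (fun _ => r).
Proof.
have := fc_scale tclass_closed r (fc_cos tclass_closed [::]).
by under eq_fun do rewrite ev_nil cos0 mulr1.
Qed.

Lemma tclassB f g : tclass f -> tclass g -> tclass (fun x => f x - g x).
Proof.
move=> hf hg; have := tclassD hf (tclassZ (-1) hg).
by under eq_fun do rewrite mulN1r.
Qed.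

(** Linearity and bounded limits propagate the product formulas of
    trigonometry from one factor to the other. *)
Lemma tclass_mul_closed (f : RJ J R -> R) : bmf f ->
  (forall l, tclass (fun x => f x * cos (ev l x))) ->
  (forall l, tclass (fun x => f x * sin (ev l x))) ->
  fourier_closed (fun g => tclass (fun x => f x * g x)).
Proof.
move=> [mf [D hD]] hc hs; split => //.
- move=> g h hg hh; have := tclassD hg hh.
  by under eq_fun do rewrite -mulrDr.
- move=> r g hg; have := tclassZ r hg.
  by under eq_fun do rewrite mulrCA.
- move=> g_ g C hg hC cg.
  apply: (tclass_lim (f_ := fun n x => f x * g_ n x) (C := D * C)) => //.
    by move=> n x; rewrite normrM ler_pM.
  by move=> x; apply: cvgM; [exact: cvg_cst|exact: cg].
Qed.

Lemma tclass_cosM l g : tclass g -> tclass (fun x => cos (ev l x) * g x).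
Proof.
move=> hg; apply: (hg (fun g => tclass (fun x => cos (ev l x) * g x))).
apply: tclass_mul_closed; first exact: bmf_cosev.
- move=> k; have := tclassZ 2^-1 (tclassD (fc_cos tclass_closed (l ++ k))
    (fc_cos tclass_closed (l ++ lformZ (-1) k))).
  congr tclass; apply/funext => x.
  by rewrite !ev_cat evZ mulN1r cosB cosD; field.
- move=> k; have := tclassZ 2^-1 (tclassB (fc_sin tclass_closed (l ++ k))
    (fc_sin tclass_closed (l ++ lformZ (-1) k))).
  congr tclass; apply/funext => x.
  by rewrite !ev_cat evZ mulN1r sinB sinD; field.
Qed.

Lemma tclass_sinM l g : tclass g -> tclass (fun x => sin (ev l x) * g x).
Proof.
move=> hg; apply: (hg (fun g => tclass (fun x => sin (ev l x) * g x))).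
apply: tclass_mul_closed; first exact: bmf_sinev.
- move=> k; have := tclass_cosM k (fc_sin tclass_closed l).
  by under eq_fun do rewrite mulrC.
- move=> k; have := tclassZ 2^-1 (tclassB
    (fc_cos tclass_closed (l ++ lformZ (-1) k)) (fc_cos tclass_closed (l ++ k))).
  congr tclass; apply/funext => x.
  by rewrite !ev_cat evZ mulN1r cosB cosD; field.
Qed.

Lemma tclassM f g : tclass f -> tclass g -> tclass (fun x => f x * g x).
Proof.
move=> hf hg; suff : tclass (fun x => g x * f x).
  by under eq_fun do rewrite mulrC.
apply: (hf (fun f => tclass (fun x => g x * f x))).
apply: tclass_mul_closed; first exact: tclass_bmf.
- by move=> l; under eq_fun do rewrite mulrC; exact: tclass_cosM.
- by move=> l; under eq_fun do rewrite mulrC; exact: tclass_sinM.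
Qed.

Lemma tclassX f n : tclass f -> tclass (fun x => f x ^+ n).
Proof.
move=> hf; elim: n => [|n IH]; first exact: tclass_cst.
by under eq_fun do rewrite exprS; exact: tclassM.
Qed.

(** For |v| <= 1 the iteration w + (v^2 - w^2)/2, started at 0, increases to |v|
    through polynomials in v. *)
Fixpoint abs_approx (v : R) n : R :=
  if n is n'.+1 then abs_approx v n' + (v ^+ 2 - abs_approx v n' ^+ 2) / 2 else 0.

Lemma abs_approx_bound (v : R) n : `|v| <= 1 ->
  0 <= abs_approx v n <= `|v| /\ `|v| - abs_approx v n <= `|v| * (1 - `|v| / 2) ^+ n.
Proof.
move=> v1; have v0 := normr_ge0 v; elim: n => [|n [/andP[w0 wv] IH]] /=.
  by rewrite lexx v0 subr0 expr0 mulr1.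
have -> : v ^+ 2 = `|v| ^+ 2 by rewrite real_normK// num_real.
move: (abs_approx v n) w0 wv IH => w w0 wv IH; set a := `|v| in v1 v0 wv IH *.
have e : a - (w + (a ^+ 2 - w ^+ 2) / 2) = (a - w) * (1 - (a + w) / 2) by field.
have q0 : 0 <= 1 - (a + w) / 2 by lra.
split.
  rewrite -[_ <= a]subr_ge0 e; apply/andP; split; last by rewrite mulr_ge0// subr_ge0.
  by rewrite addr_ge0// divr_ge0// subr_ge0 !expr2 ler_pM.
rewrite e exprSr mulrA; apply: ler_pM => //; first by rewrite subr_ge0.
by lra.
Qed.

Lemma tclass_abs f : tclass f -> (forall x, `|f x| <= 1) ->
  tclass (fun x => `|f x|).
Proof.
move=> hf f1; apply: (tclass_lim (f_ := fun n x => abs_approx (f x) n) (C := 1)).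
- elim=> [|n IH] /=; first exact: tclass_cst.
  have := tclassD IH (tclassZ 2^-1 (tclassB (tclassX 2 hf) (tclassX 2 IH))).
  by under eq_fun do rewrite [_^-1 * _]mulrC.
- move=> n x; have [/andP[w0 wv] _] := abs_approx_bound n (f1 x).
  by rewrite ger0_norm// (le_trans wv).
- move=> x; have [f0|fn0] := eqVneq (f x) 0.
    apply: (seq_cvg_eventually (N := 0)) => n _.
    have [/andP[w0 wv] _] := abs_approx_bound n (f1 x).
    by move: w0 wv; rewrite f0 normr0 => w0 wv; apply/eqP; rewrite eq_le wv.
  apply: (seq_squeeze (v := fun n => `|f x| * (1 - `|f x| / 2) ^+ n)).
    move=> n; have [/andP[w0 wv] h] := abs_approx_bound n (f1 x).
    by rewrite distrC ger0_norm ?subr_ge0.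
  apply: seq_cvg_geo; have := f1 x.
  have : 0 < `|f x| by rewrite normr_gt0.
  by move=> ? ?; apply/andP; split; lra.
Qed.

(** With u the positive part of f, the functions 1 - (1 - u)^n increase to the
    indicator of f > 0. *)
Lemma tclass_pos f : tclass f -> (forall x, `|f x| <= 1) ->
  tclass (\1_[set x | 0 < f x]).
Proof.
move=> hf f1; pose u x := (f x + `|f x|) / 2.
have u01 x : 0 <= u x <= 1.
  have := f1 x; have := ler_norm (f x); have := ler_norm (- f x).
  rewrite normrN /u => *; apply/andP; split; lra.
have hu : tclass u.
  have := tclassZ 2^-1 (tclassD hf (tclass_abs hf f1)).
  by under eq_fun do rewrite mulrC.
apply: (tclass_lim (f_ := fun n x => 1 - (1 - u x) ^+ n) (C := 1)).
- move=> n; apply: tclassB; first exact: tclass_cst.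
  by apply: (tclassX n); apply: tclassB => //; exact: tclass_cst.
- move=> n x; have /andP[u0 u1] := u01 x.
  rewrite ger0_norm ?subr_ge0; last by apply: exprn_ile1; lra.
  by rewrite gerBl exprn_ge0// subr_ge0.
- move=> x; rewrite indicE; have [fx|fx] := ltP 0 (f x).
    rewrite mem_set//=; have ux : 0 < u x by rewrite /u gtr0_norm//; lra.
    apply: (seq_squeeze (v := fun n => 1 * (1 - u x) ^+ n)).
      move=> n; rewrite mul1r addrAC subrr add0r normrN ger0_norm// exprn_ge0//.
      by have := u01 x; lra.
    by apply: seq_cvg_geo; have := u01 x; lra.
  rewrite memNset/=; last by apply/negP; rewrite -leNgt.
  apply: (seq_cvg_eventually (N := 0)) => n _.
  by rewrite /u ler0_norm// subrr mul0r subr0 expr1n subrr.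
Qed.

Lemma small_angle (s : R) n : `|s| < n%:R -> (0 < s -> 0 < sin (s / n%:R)) /\
  (s <= 0 -> sin (s / n%:R) <= 0).
Proof.
move=> sn; have n0 : 0 < n%:R :> R by apply: le_lt_trans sn.
have pi1 := pi_ge2 R.
have key (t : R) : 0 < t -> t < n%:R -> 0 < sin (t / n%:R).
  move=> t0 tn; apply: sin_gt0_pi; rewrite divr_gt0//= (@lt_trans _ _ 1)//.
    by rewrite ltr_pdivrMr// mul1r.
  by lra.
split=> [s0|]; first by apply: key => //; rewrite -(gtr0_norm s0).
rewrite le_eqVlt => /orP[/eqP->|s0]; first by rewrite mul0r sin0.
rewrite -oppr_ge0 -sinN -mulNr ltW// key ?oppr_gt0//.
by rewrite -(ltr0_norm s0).
Qed.

(** The sign of x_j - b is the limit of the signs of sin((x_j - b)/n). *)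
Lemma tclass_ray (j : J) (b : R) : tclass (\1_[set x | b < x j]).
Proof.
apply: (tclass_lim (f_ := fun n => \1_[set x | 0 < sin ((x j - b) / n%:R)]) (C := 1)).
- move=> n; apply: tclass_pos => [|x]; last by rewrite ler_norml sin_geN1 sin_le1.
  pose l := [:: (j, n%:R^-1 : R)].
  have := tclassB (tclassZ (cos (b / n%:R)) (fc_sin tclass_closed l))
    (tclassZ (sin (b / n%:R)) (fc_cos tclass_closed l)).
  congr tclass; apply/funext => x.
  have -> : ev l x = x j / n%:R by rewrite ev_cons ev_nil/= addr0 mulrC.
  by rewrite mulrBl sinB; ring.
- by move=> n x; rewrite indicE; case: (_ \in _); rewrite ?normr1 ?normr0.
- move=> x; pose N := (Num.truncn `|x j - b|).+1.
  apply: (seq_cvg_eventually (N := N)) => n Nn.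
  have sn : `|x j - b| < n%:R.
    by apply: (lt_le_trans (truncnS_gt _)); rewrite ler_nat.
  have [hp hn] := small_angle sn.
  rewrite !indicE; congr (_ %:R); congr nat_of_bool.
  have [xb|xb] := ltP b (x j).
    by rewrite !mem_set//=; apply: hp; rewrite subr_gt0.
  by rewrite !memNset//=; apply/negP; rewrite -leNgt// hn// subr_le0.
Qed.

Lemma tclass_indicC (A : set (RJ J R)) : tclass \1_A -> tclass \1_(~` A).
Proof.
move=> hA; have := tclassB (tclass_cst 1) hA.
congr tclass; apply/funext => x; rewrite !indicE in_setC.
by case: (_ \in _); rewrite ?subrr ?subr0.
Qed.

Lemma tclass_indicU (A : nat -> set (RJ J R)) :
  (forall n, tclass \1_(A n)) -> tclass \1_(\bigcup_n A n).
Proof.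
move=> hA; pose g n x := \prod_(i < n) (1 - \1_(A i) x : R).
have hg n : tclass (g n).
  rewrite /g; elim: n => [|n IH].
    by under eq_fun do rewrite big_ord0; exact: tclass_cst.
  under eq_fun do rewrite big_ord_recr/=.
  by apply: tclassM => //; apply: tclassB => //; exact: tclass_cst.
have g1 n x : g n x = (\1_(\bigcap_(i in `I_n) ~` A i) x : R).
  rewrite /g indicE; have [h|h] := boolP (x \in _).
    rewrite big1// => i _; rewrite indicE memNset ?subr0//.
    by move: h; rewrite inE => /(_ i); apply => /=.
  have [i [ni Ai]] : exists i, (i < n)%N /\ A i x.
    apply: contrapT => hx; move/negP: h; apply; rewrite inE => i /= ni Ai.
    by apply: hx; exists i.
  by rewrite (bigD1 (Ordinal ni))//= indicE mem_set// subrr mul0r.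
apply: (tclass_lim (f_ := fun n x => 1 - g n x) (C := 1)).
- by move=> n; apply: tclassB => //; exact: tclass_cst.
- by move=> n x; rewrite g1 indicE; case: (_ \in _); rewrite ?subrr ?subr0 ?normr0 ?normr1.
- move=> x; have [[i _ Ai]|hx] := pselect ((\bigcup_n A n) x).
    apply: (seq_cvg_eventually (N := i.+1)) => n ni.
    rewrite g1 !indicE memNset ?subr0 ?mem_set//; first by exists i.
    by move=> /(_ i); apply.
  apply: (seq_cvg_eventually (N := 0)) => n _.
  rewrite g1 !indicE mem_set ?memNset ?subrr// => i _ Ai.
  by apply: hx; exists i.
Qed.

Lemma tclass_indic (A : set (RJ J R)) : measurable A -> tclass \1_A.
Proof.
move: A; apply: smallest_sub.
  split=> [|A hA|A hA]; first by rewrite indic0; exact: (tclass_cst 0).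
  - by rewrite setTD; exact: tclass_indicC.
  - exact: tclass_indicU.
move=> _ [j _ [B mB <-]]; rewrite setTI.
rewrite -[measurable B]/((@ocitv R).-sigma.-measurable B) RGenOInfty.measurableE in mB.
move: B mB; apply: smallest_sub => /=.
  split=> [|A hA|A hA] /=; first by rewrite preimage_set0 indic0; exact: (tclass_cst 0).
  - by rewrite setTD preimage_setC; exact: tclass_indicC.
  - by rewrite preimage_bigcup; exact: tclass_indicU.
move=> _ [b ->]; have := tclass_ray j b; congr (tclass \1_ _).
by apply/seteqP; split => x /=; rewrite in_itv/= andbT.
Qed.

(** The rays x_j > b generate the sigma-algebra, and indicators generate the
    bounded measurable functions. *)
Theorem tclassP f : bmf f -> tclass f.
Proof. by apply: bmf_ind; [exact: tclass_indic|exact: tclassD|exact: tclassZ|exact: tclass_lim]. Qed.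

Lemma fourier_ind (H : (RJ J R -> R) -> Prop) : fourier_closed H ->
  forall f, bmf f -> H f.
Proof. by move=> hH f bf; apply: (tclassP bf). Qed.

End product_space.
Arguments lform : clear implicits.

(** By induction, probabilities that agree on the trigonometric functions agree on all
    bounded measurable functions. *)
Lemma char_unique {R : realType} {J : Type} (P Q : probability (RJ J R) R) :
  (forall l, Ex P (fun x => cos (ev l x)) = Ex Q (fun x => cos (ev l x))) ->
  (forall l, Ex P (fun x => sin (ev l x)) = Ex Q (fun x => sin (ev l x))) ->
  forall A, measurable A -> P A = Q A.
Proof.
move=> hc hs A mA.
have : bmf (\1_A : RJ J R -> R) /\ Ex P \1_A = Ex Q \1_A.
  apply: (@fourier_ind R J (fun f => bmf f /\ Ex P f = Ex Q f)); last exact: bmf_indic.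
  split=> [l|l|f g [bf ef] [bg eg]|r f [bf ef]|f_ f C hf hC cf].
  - by split; [exact: bmf_cosev|].
  - by split; [exact: bmf_sinev|].
  - by split; [exact: bmfD|rewrite !ExD// ef eg].
  - by split; [exact: bmfZ|rewrite !ExZ// ef].
  - have bf := bmf_lim (fun n => (hf n).1) hC cf; split => //.
    have cP := Ex_cvg (P := P) (fun n => (hf n).1) hC cf.
    have cQ := Ex_cvg (P := Q) (fun n => (hf n).1) hC cf.
    have e : (fun n => Ex P (f_ n)) = (fun n => Ex Q (f_ n)).
      by apply/funext => n; exact: (hf n).2.
    by rewrite e in cP; exact: (cvg_unique _ cP cQ).
move=> [_]; rewrite !Ex_indic// => e.
by rewrite -[LHS]fineK ?fin_num_measure// -[RHS]fineK ?fin_num_measure// e.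
Qed.

(** * The mean ergodic theorem *)

Section ergodic_theorem.
Context {R : realType} {d} {T : measurableType d} (P : probability T R).
Variables (S : T -> T) (P_pres : measure_preserving P S) (P_erg : ergodic P S).
Implicit Types f : T -> R.

Lemma Ex_full f (A : set T) : bmf f -> measurable A -> P A = 1%E ->
  Ex P (fun x => f x * \1_A x) = Ex P f.
Proof.
move=> bf mA PA; have b1 := @bmf_indic R _ _ _ mA.
have [mf [C hC]] := bf.
have -> : Ex P f = Ex P (fun x => f x * \1_A x) + Ex P (fun x => f x * (1 - \1_A x)).
  rewrite -ExD; [|by bmt..]; by apply: eq_Ex => x; ring.
suff -> : Ex P (fun x => f x * (1 - \1_A x)) = 0 by rewrite addr0.
apply/eqP; rewrite -normr_le0.
have e : Ex P (fun x => 1 - \1_A x) = 0.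
  by rewrite ExB ?Ex_cst ?Ex_indic ?PA ?subrr//; bmt.
have c1 x : 0 <= 1 - \1_A x :> R.
  by rewrite indicE; case: (_ \in _); rewrite ?subrr ?subr0.
rewrite -[X in _ <= X](mulr0 C) -e -ExZ; last by bmt.
rewrite ler_norml -ExN; last by bmt.
by apply/andP; split; apply: le_Ex; bmt => //; move=> x; have := hC x;
  rewrite ler_norml -?mulNr => /andP[h1 h2]; rewrite ler_wpM2r.
Qed.

Lemma measurable_S : measurable_fun setT S.
Proof. by case: P_pres. Qed.

Lemma measurable_iterS n : measurable_fun setT (iter n S).
Proof.
elim: n => [|n IH]; first exact: measurable_id.
exact: (measurableT_comp measurable_S IH).
Qed.

Lemma bmf_iterS f n : bmf f -> bmf (fun x => f (iter n S x)).
Proof. by apply: bmf_comp; exact: measurable_iterS. Qed.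

Lemma Ex_S f : bmf f -> Ex P (fun x => f (S x)) = Ex P f.
Proof.
move=> bf; rewrite -(Ex_law P measurable_S bf); apply: eq_Ex_measure => A mA.
by rewrite lawE P_pres.2.
Qed.

Lemma Ex_iterS f n : bmf f -> Ex P (fun x => f (iter n S x)) = Ex P f.
Proof.
move=> bf; elim: n => [//|n IH].
by rewrite -[RHS]IH -[RHS]Ex_S; [apply: eq_Ex => x; rewrite iterSr|exact: bmf_iterS].
Qed.

Definition bsum f n x : R := \sum_(k < n) f (iter k S x).
Definition avg f n x : R := bsum f n.+1 x / n.+1%:R.

Lemma bsumS f n x : bsum f n.+1 x = f x + bsum f n (S x).
Proof.
rewrite /bsum big_ord_recl; congr (_ + _); apply: eq_bigr => i _.
by rewrite /bump/= -iterSr.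
Qed.

(* the largest of the sums [bsum f k x] with k <= n *)
Fixpoint maxsum f n : T -> R :=
  if n is n'.+1 then fun x => Num.max 0 (f x + maxsum f n' (S x)) else fun=> 0.

Lemma bmf_max f g : bmf f -> bmf g -> bmf (fun x => Num.max (f x) (g x)).
Proof.
move=> [mf [C hC]] [mg [D hD]]; split; first exact: measurable_maxr.
exists (Num.max C D) => x; case: (leP (f x) (g x)) => _.
  by rewrite le_max hD orbT.
by rewrite le_max hC.
Qed.

Lemma bmf_maxsum f n : bmf f -> bmf (maxsum f n).
Proof.
move=> bf; elim: n => [|n IH] /=; first exact: bmf_cst.
apply: bmf_max; first exact: bmf_cst.
by apply: bmfD => //; apply: (bmf_comp measurable_S IH).
Qed.

Lemma maxsum_ge0 f n x : 0 <= maxsum f n x.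
Proof. by case: n => [|n] //=; rewrite le_max lexx. Qed.

Lemma maxsum_homo f n x : maxsum f n x <= maxsum f n.+1 x.
Proof.
elim: n x => [|n IH] x; first exact: maxsum_ge0.
rewrite [X in X <= _]/= [X in _ <= X]/= ge_max !le_max lexx/=.
by apply/orP; right; rewrite lerD2l.
Qed.

Lemma maxsum_homo_le f m n x : (m <= n)%N -> maxsum f m x <= maxsum f n x.
Proof.
move=> /subnK <-; elim: (n - m)%N => [|k IH]; first by [].
by rewrite addSn; apply: le_trans IH (maxsum_homo _ _ _).
Qed.

Lemma bsum_le_maxsum f n x : bsum f n x <= maxsum f n x.
Proof.
elim: n x => [|n IH] x; first by rewrite /bsum big_ord0.
by rewrite bsumS /= le_max lerD2l IH orbT.
Qed.

(** Garsia's inequality: where the maximum M' over n+1 sums is positive it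
    equals f + M o S, with M the maximum over n sums; hence
    f 1_(M' > 0) >= M' - M o S, whose mean is E[M'] - E[M] >= 0. *)
Lemma maximal_ergodic f n : bmf f ->
  0 <= Ex P (fun x => f x * \1_[set y | 0 < maxsum f n.+1 y] x).
Proof.
move=> bf; have bm k := bmf_maxsum k bf.
have mD : measurable [set y | 0 < maxsum f n.+1 y].
  rewrite -[X in measurable X]setTI; apply: measurable_fun_ltr => //.
  exact: (bm n.+1).1.
have bMS : bmf (fun x => maxsum f n (S x)) by exact: (bmf_comp measurable_S (bm n)).
apply: (@le_trans _ _ (Ex P (fun x => maxsum f n.+1 x - maxsum f n (S x)))).
  rewrite ExB// Ex_S// subr_ge0; apply: le_Ex => // x; exact: maxsum_homo.
apply: le_Ex; [exact: bmfB|by apply: bmfM => //; exact: bmf_indic|move=> x].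
rewrite indicE; have [h|h] := ltP 0 (maxsum f n.+1 x).
  rewrite mem_set//= mulr1 lerBlDr; move: h => /=.
  by rewrite lt_max ltxx/= => h; rewrite max_r// ltW.
rewrite memNset ?mulr0; last by apply/negP; rewrite -leNgt.
rewrite subr_le0; apply: le_trans h _; exact: maxsum_ge0.
Qed.

Lemma avg_S f (C : R) n x : (forall y, `|f y| <= C) ->
  `|avg f n (S x) - avg f n x| <= 2 * C / n.+1%:R.
Proof.
move=> hC; have n0 : 0 < n.+1%:R :> R by [].
rewrite /avg -mulrBl normrM [X in _ * X]gtr0_norm ?invr_gt0//.
rewrite ler_pM2r ?invr_gt0//.
have -> : bsum f n.+1 (S x) - bsum f n.+1 x = f (iter n.+1 S x) - f x.
  rewrite [in X in _ - X]bsumS {1}/bsum big_ord_recr/= -iterSr /= -/(bsum f n (S x)); ring.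
rewrite (le_trans (ler_normB _ _))// mulr_natl mulr2n lerD//.
Qed.

Lemma bmf_avg f n : bmf f -> bmf (avg f n).
Proof.
move=> bf; apply: bmfM; last exact: bmf_cst.
by rewrite /bsum; apply: bmf_sum => k; exact: bmf_iterS.
Qed.

Lemma avg_bound f (C : R) n x : (forall y, `|f y| <= C) -> `|avg f n x| <= C.
Proof.
move=> hC; rewrite /avg normrM [X in _ * X]gtr0_norm ?invr_gt0// ler_pdivrMr//.
rewrite (le_trans (ler_norm_sum _ _ _))//.
rewrite (@le_trans _ _ (\sum_(k < n.+1) C))//; first by apply: ler_sum.
by rewrite sumr_const card_ord mulr_natr.
Qed.

(* the points where the limsup of the averages exceeds e *)
Definition io_set f (e : R) : set T :=
  [set x | exists k, forall N, exists2 L, (N <= L)%N & e + k.+1%:R^-1 < avg f L x].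

Lemma measurable_io f e : bmf f -> measurable (io_set f e).
Proof.
move=> bf.
have -> : io_set f e =
    \bigcup_k \bigcap_N \bigcup_(L in [set L | (N <= L)%N]) [set x | e + k.+1%:R^-1 < avg f L x].
  apply/seteqP; split => x /=.
    by move=> [k h]; exists k => // N _; have [L NL hL] := h N; exists L.
  by move=> [k _ h]; exists k => N; have [L NL hL] := h N I; exists L.
apply: bigcupT_measurable => k; apply: bigcapT_measurable => N.
apply: bigcup_measurable => L _.
rewrite -[X in measurable X]setTI; apply: measurable_fun_ltr => //.
exact: (bmf_avg L bf).1.
Qed.

(** The averages at x and at S x differ by a multiple of 1/n; the margin 1/(k+1) in
    the definition absorbs this difference when k is replaced by 2k+1. *)
Lemma io_inv f e : bmf f -> S @^-1` io_set f e = io_set f e.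
Proof.
move=> [_ [C hC]].
suff key x y : (forall L, `|avg f L y - avg f L x| <= 2 * C / L.+1%:R) ->
    io_set f e x -> io_set f e y.
  apply/seteqP; split => x; last by apply: key => L; exact: avg_S.
  by apply: key => L; rewrite distrC; exact: avg_S.
move=> hxy [k hk]; exists (2 * k).+1 => N.
pose M := (Num.truncn (4 * C * k.+1%:R)).+1.
have [L NL hL] := hk (maxn N M); exists L; first by apply: leq_trans NL; exact: leq_maxl.
have ML : (M <= L)%N by apply: leq_trans NL; exact: leq_maxr.
have hM : 4 * C * k.+1%:R < L.+1%:R.
  by apply: (lt_trans (truncnS_gt _)); rewrite ltr_nat ltnS.
have k0 : 0 < k.+1%:R :> R by [].
have L0 : 0 < L.+1%:R :> R by [].
have h2 : 2 * C / L.+1%:R <= k.+1%:R^-1 / 2.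
  rewrite ler_pdivrMr// -(ler_pM2r k0).
  have -> : k.+1%:R^-1 / 2 * L.+1%:R * k.+1%:R = L.+1%:R / 2 :> R by field; rewrite nat1r gt_eqF.
  lra.
have e2 : (2 * k).+2%:R^-1 = k.+1%:R^-1 / 2 :> R.
  by rewrite -[(2 * k).+2]/(2 + 2 * k)%N -mulnS natrM invfM mulrC.
have := hxy L; rewrite ler_norml e2 => /andP[h3 _].
by move: hL h2 h3; move: (k.+1%:R^-1) (2 * C / L.+1%:R) => a b; lra.
Qed.

(** If the set had full measure, the maximal inequality for f - e would give
    E[f] >= e. *)
Lemma io_null f e : bmf f -> Ex P f = 0 -> 0 < e -> P (io_set f e) = 0%E.
Proof.
move=> bf Ef e0; have [//|P1] := P_erg (measurable_io e bf) (io_inv e bf).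
exfalso; pose g x := f x - e.
have bg : bmf g by rewrite /g; bmt.
pose U n := [set y | 0 < maxsum g n.+1 y].
have mU n : measurable (U n).
  rewrite -[X in measurable X]setTI; apply: measurable_fun_ltr => //.
  exact: (bmf_maxsum n.+1 bg).1.
have mUU : measurable (\bigcup_n U n) by exact: bigcupT_measurable.
have DU : io_set f e `<=` \bigcup_n U n.
  move=> x [k /(_ 0%N)[L _ hL]]; exists L => //=.
  rewrite /U/=; apply: lt_le_trans (bsum_le_maxsum g L.+1 x).
  have -> : bsum g L.+1 x = bsum f L.+1 x - e * L.+1%:R.
    by rewrite /bsum /g sumrB sumr_const card_ord mulr_natr.
  rewrite subr_gt0 -ltr_pdivlMr//; apply: le_lt_trans hL.
  by rewrite lerDl invr_ge0.
have PU : P (\bigcup_n U n) = 1%E.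
  apply/eqP; rewrite eq_le probability_le1//= -P1; apply: le_measure DU.
  - by rewrite inE; exact: measurable_io.
  - by rewrite inE.
have cv : (fun n => Ex P (fun x => g x * \1_(U n) x)) @ \oo --> Ex P (fun x => g x * \1_(\bigcup_n U n) x).
  have [_ [C hC]] := bg.
  apply: (@Ex_cvg _ _ _ _ (fun n x => g x * \1_(U n) x) _ C).
  - by move=> n; apply: bmfM => //; exact: bmf_indic.
  - move=> n x; rewrite indicE; case: (_ \in _); rewrite ?mulr1// mulr0 normr0.
    exact: le_trans (hC x).
  - move=> x; have [[n _ Un]|h] := pselect ((\bigcup_n U n) x).
      apply: (seq_cvg_eventually (N := n)) => m nm; rewrite !indicE !mem_set//.
        by exists n.
      by apply: lt_le_trans Un _; apply: maxsum_homo_le.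
    apply: (seq_cvg_eventually (N := 0)) => m _.
    by rewrite !indicE !memNset// => Um; apply: h; exists m.
have : 0 <= Ex P (fun x => g x * \1_(\bigcup_n U n) x).
  move/cvg_lim : (cv) => <- //; apply: limr_ge; first by apply: cvgP cv.
  by apply: nearW => n; exact: maximal_ergodic.
rewrite Ex_full// /g ExB//; last exact: bmf_cst.
by rewrite Ef Ex_cst sub0r oppr_ge0 leNgt e0.
Qed.

(** The averages of f tend to 0 off the null sets where the limsup of the averages of
    f or of - f is positive; they are bounded, hence converge in mean square. *)
Theorem mean_ergodic f : bmf f -> Ex P f = 0 ->
  (fun n => Ex P (fun x => avg f n x ^+ 2)) @ \oo --> (0 : R).
Proof.
move=> bf Ef.
have bNf : bmf (fun x => - f x) by bmt.
have ENf : Ex P (fun x => - f x) = 0 by rewrite ExN// Ef oppr0.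
pose D k := io_set f k.+1%:R^-1 `|` io_set (fun x => - f x) k.+1%:R^-1.
have mD k : measurable (D k) by apply: measurableU; exact: measurable_io.
have mDD : measurable (\bigcup_k D k) by exact: bigcupT_measurable.
have PD : P (\bigcup_k D k) = 0%E.
  apply/negligibleP => //; apply: negligible_bigcup => k; apply/negligibleP => //.
  apply: null_set_setU; [exact: measurable_io|exact: measurable_io| |]; exact: io_null.
pose Z := ~` \bigcup_k D k.
have mZ : measurable Z by exact: measurableC.
have PZ : P Z = 1%E by rewrite probability_setC// PD sube0.
have [_ [C hC]] := bf.
have C0 : 0 <= C by apply: le_trans (hC point).
suff : (fun n => Ex P (fun x => avg f n x ^+ 2 * \1_Z x)) @ \oo --> Ex P (fun=> 0 : R).
  rewrite Ex_cst (_ : (fun n => _) = (fun n => Ex P (fun x => avg f n x ^+ 2)))//.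
  apply/funext => n; apply: (Ex_full (f := fun x => avg f n x ^+ 2)) => //.
  by apply: bmfX; exact: bmf_avg.
apply: (@Ex_cvg _ _ _ _ (fun n x => avg f n x ^+ 2 * \1_Z x) _ (C ^+ 2)).
- by move=> n; apply: bmfM; [apply: bmfX; exact: bmf_avg|exact: bmf_indic].
- move=> n x; rewrite normrM normrX -[X in _ <= X]mulr1; apply: ler_pM => //.
    by rewrite !expr2 ler_pM// avg_bound.
  by rewrite indicE; case: (_ \in _); rewrite ?normr1 ?normr0.
- move=> x; have [h|Zx] := pselect ((\bigcup_k D k) x).
    apply: (seq_cvg_eventually (N := 0)) => n _.
    by rewrite indicE memNset ?mulr0//; apply.
  have side g : (forall k, ~ io_set g k.+1%:R^-1 x) -> forall e : R, 0 < e ->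
      exists N, forall n, (N <= n)%N -> avg g n x <= e.
    move=> hg e e0; apply: contrapT => hN.
    pose k := (Num.truncn (2 / e)).+1.
    have hk : k.+1%:R^-1 <= e / 2.
      rewrite -[e / 2]invrK lef_pV2 ?posrE ?invr_gt0 ?divr_gt0//.
      rewrite invf_div ltW// (lt_trans (truncnS_gt _))// ltr_nat//.
    apply: (hg k); exists k => N; apply: contrapT => hL; apply: hN; exists N => n Nn.
    rewrite leNgt; apply/negP => he; apply: hL; exists n => //.
    by apply: le_lt_trans he; move: hk; move: (k.+1%:R^-1) => a; lra.
  apply/seq_cvgP => e e0.
  pose e' := Num.min 1 e.
  have e'0 : 0 < e' by rewrite lt_min ltr01.
  have [N1 h1] := side f (fun k hk => Zx (ex_intro2 _ _ k I (or_introl hk))) e' e'0.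
  have [N2 h2] := side _ (fun k hk => Zx (ex_intro2 _ _ k I (or_intror hk))) e' e'0.
  exists (maxn N1 N2) => n; rewrite geq_max => /andP[/h1 a1 /h2 a2].
  have eN : avg (fun x => - f x) n x = - avg f n x.
    by rewrite /avg /bsum sumrN mulNr.
  rewrite subr0 indicE mem_set//= mulr1 ger0_norm ?sqr_ge0//.
  have h3 : `|avg f n x| <= e' by rewrite ler_norml a1 andbT lerNl -eN.
  rewrite -(real_normK (num_real _)).
  have m1 : e' <= 1 by rewrite ge_min lexx.
  have m2 : e' <= e by rewrite ge_min lexx orbT.
  have := normr_ge0 (avg f n x); move: h3; set a := `|_| => h3 a0.
  rewrite expr2; apply: (@le_trans _ _ (e' * 1)); last by rewrite mulr1.
  by apply: ler_pM => //; lra.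
Qed.

End ergodic_theorem.

(** * Autocorrelations of convolution roots *)

Section cesaro.
Context {R : realType}.
Implicit Types K : nat -> nat -> R.

(* Cesaro mean of a kernel over a square *)
Definition ces K n : R := (\sum_(a < n.+1) \sum_(b < n.+1) K a b) / (n.+1%:R ^+ 2).

Lemma ces_den_gt0 n : 0 < n.+1%:R ^+ 2 :> R. Proof. by rewrite exprn_gt0. Qed.

Lemma eq_ces K K' n : (forall a b, K a b = K' a b) -> ces K n = ces K' n.
Proof. by move=> h; congr (_ / _); do 2 (apply: eq_bigr => ? _). Qed.

Lemma cesD K K' n : ces (fun a b => K a b + K' a b) n = ces K n + ces K' n.
Proof.
rewrite /ces -mulrDl -big_split/=; congr (_ / _); apply: eq_bigr => a _.
by rewrite big_split.
Qed.

Lemma cesZ r K n : ces (fun a b => r * K a b) n = r * ces K n.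
Proof.
rewrite /ces mulrA; congr (_ / _); rewrite mulr_sumr; apply: eq_bigr => a _.
by rewrite mulr_sumr.
Qed.

Lemma ces_cst r n : ces (fun _ _ => r) n = r.
Proof.
rewrite /ces (eq_bigr (fun=> r * n.+1%:R)); last first.
  by move=> a _; rewrite sumr_const card_ord mulr_natr.
rewrite sumr_const card_ord -[r * _ *+ _]mulr_natr.
rewrite -[r * _ * _]mulrA -[_%:R * _]expr2 mulfK//.
Qed.

Lemma ces_swap K n : ces (fun a b => K b a) n = ces K n.
Proof. by rewrite /ces exchange_big. Qed.

Lemma le_ces K K' n : (forall a b, K a b <= K' a b) -> ces K n <= ces K' n.
Proof.
move=> h; rewrite ler_pM2r ?invr_gt0 ?ces_den_gt0//.
by apply: ler_sum => a _; apply: ler_sum => b _.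
Qed.

Lemma ces_ge0 K n : (forall a b, 0 <= K a b) -> 0 <= ces K n.
Proof. by move=> h; rewrite -(ces_cst 0 n); apply: le_ces. Qed.

Lemma sqr_sum n (u : nat -> R) :
  (\sum_(a < n) u a) ^+ 2 = \sum_(a < n) \sum_(b < n) u a * u b.
Proof.
by rewrite expr2 mulr_suml; apply: eq_bigr => a _; rewrite mulr_sumr.
Qed.

Lemma sqr_le_le (x y : R) : 0 <= y -> x ^+ 2 <= y ^+ 2 -> x <= y.
Proof.
move=> y0 h; rewrite leNgt; apply/negP => yx.
by move: h; rewrite leNgt !expr2 ltr_pM.
Qed.

End cesaro.

Section kernels.
Context {R : realType} {d} {T : measurableType d} (P : probability T R).

Definition xcorr (f g : nat -> T -> R) a b := Ex P (fun w => f a w * g b w).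

Lemma Ex_sum2 n (F : nat -> nat -> T -> R) : (forall a b, bmf (F a b)) ->
  Ex P (fun w => \sum_(a < n) \sum_(b < n) F a b w) =
  \sum_(a < n) \sum_(b < n) Ex P (F a b).
Proof.
move=> bF.
rewrite (@Ex_sum _ _ _ P _ _ _ (fun (a : 'I_n) w => \sum_(b < n) F a b w)); last first.
  by move=> a; bmt.
by apply: eq_bigr => a _; rewrite (@Ex_sum _ _ _ P _ _ _ (fun b : 'I_n => F a b)).
Qed.

Lemma ces_xcorrE (f : nat -> T -> R) n : (forall a, bmf (f a)) ->
  ces (xcorr f f) n = Ex P (fun w => ((\sum_(a < n.+1) f a w) / n.+1%:R) ^+ 2).
Proof.
move=> bf; rewrite /ces -(@Ex_sum2 _ (fun a b w => f a w * f b w)); last by move=> a b; bmt.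
rewrite -ExZr; last by bmt.
by apply: eq_Ex => w; rewrite expr_div_n (sqr_sum _ (fun a => f a w)).
Qed.

Lemma ces_xcorr_ge0 (f : nat -> T -> R) n : (forall a, bmf (f a)) ->
  0 <= ces (xcorr f f) n.
Proof. by move=> bf; rewrite ces_xcorrE//; apply: Ex_ge0 => w; exact: sqr_ge0. Qed.

Variables (p q : nat -> T -> R).
Hypotheses (bp : forall a, bmf (p a)) (bq : forall a, bmf (q a)).

Notation kpp := (xcorr p p).
Notation kqq := (xcorr q q).
Notation kpq := (xcorr p q).

(* real and imaginary parts of E[v_a conj(v_b)], for v = p + i q *)
Definition cre a b := kpp a b + kqq a b.
Definition cim a b := kpq b a - kpq a b.

(** Schur's product theorem for the kernel E[v_a conj(v_b)]: the sum of its
    squares is the double expectation, over (w, w'), of the square of the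
    modulus of sum_a v_a(w) v_a(w'). *)
Lemma ces_sqr_ge0 n : 0 <= ces (fun a b => cre a b ^+ 2 - cim a b ^+ 2) n.
Proof.
pose F a b w := p a w * p b w + q a w * q b w.
pose G a b w := q a w * p b w - p a w * q b w.
have bF a b : bmf (F a b) by rewrite /F; bmt.
have bG a b : bmf (G a b) by rewrite /G; bmt.
have eF a b : cre a b = Ex P (F a b) by rewrite ExD//; bmt.
have eG a b : cim a b = Ex P (G a b).
  rewrite /cim ExB//; [|by bmt..]; congr (_ - _).
  by apply: eq_Ex => w; rewrite mulrC.
apply: divr_ge0; last exact/ltW/ces_den_gt0.
rewrite (eq_bigr (fun a : 'I_n.+1 => \sum_(b < n.+1)
    Ex P (fun w => F a b w * cre a b - G a b w * cim a b))); last first.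
  move=> a _; apply: eq_bigr => b _.
  by rewrite ExB ?ExZr -?eF -?eG -?expr2//; bmt.
rewrite -(@Ex_sum2 _ (fun a b w => F a b w * cre a b - G a b w * cim a b)); last first.
  by move=> a b; bmt.
apply: Ex_ge0 => w.
rewrite (eq_bigr (fun a : 'I_n.+1 => \sum_(b < n.+1)
    Ex P (fun w' => F a b w * F a b w' - G a b w * G a b w'))); last first.
  move=> a _; apply: eq_bigr => b _.
  by rewrite ExB ?ExZ ?eF ?eG//; bmt.
rewrite -(@Ex_sum2 _ (fun a b w' => F a b w * F a b w' - G a b w * G a b w')); last first.
  by move=> a b; bmt.
apply: Ex_ge0 => w'.
pose u a := p a w * p a w' - q a w * q a w'.
pose v a := p a w * q a w' + q a w * p a w'.
rewrite (eq_bigr (fun a : 'I_n.+1 => \sum_(b < n.+1) u a * u b + \sum_(b < n.+1) v a * v b)).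
  by rewrite big_split/= -!sqr_sum addr_ge0// sqr_ge0.
move=> a _; rewrite -big_split/=; apply: eq_bigr => b _.
by rewrite /F /G /u /v; ring.
Qed.

(** The same argument for the real kernel of the family (s p_a, - q_a / s). *)
Lemma ces_cross n (s : R) : s != 0 ->
  2 * ces (fun a b => kpq a b ^+ 2) n <=
  s ^+ 2 * ces (fun a b => kpp a b ^+ 2) n + ces (fun a b => kqq a b ^+ 2) n / s ^+ 2.
Proof.
move=> s0; rewrite -subr_ge0.
have -> : s ^+ 2 * ces (fun a b => kpp a b ^+ 2) n + ces (fun a b => kqq a b ^+ 2) n / s ^+ 2 -
    2 * ces (fun a b => kpq a b ^+ 2) n =
  ces (fun a b => s ^+ 2 * kpp a b ^+ 2 + (s ^- 2 * kqq a b ^+ 2 +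
    (-1 * kpq a b ^+ 2 + -1 * kpq b a ^+ 2))) n.
  rewrite !cesD !cesZ (ces_swap (fun a b => kpq a b ^+ 2)); ring.
apply: divr_ge0; last exact/ltW/ces_den_gt0.
pose H (w : T) a b (x y z t : R) := s ^+ 2 * (p a w * p b w * x) +
   (s ^- 2 * (q a w * q b w * y) + (-1 * (p a w * q b w * z) + -1 * (p b w * q a w * t))).
rewrite (eq_bigr (fun a : 'I_n.+1 => \sum_(b < n.+1)
    Ex P (fun w => H w a b (kpp a b) (kqq a b) (kpq a b) (kpq b a)))); last first.
  move=> a _; apply: eq_bigr => b _; rewrite /H.
  rewrite !ExD; [|by bmt..]; rewrite !ExZ; [|by bmt..]; rewrite !ExZr; [|by bmt..].
  by rewrite -/(kpp a b) -/(kqq a b) -/(kpq a b) -/(kpq b a) -!expr2.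
rewrite -(@Ex_sum2 _ (fun a b w => H w a b (kpp a b) (kqq a b) (kpq a b) (kpq b a))); last first.
  by move=> a b; rewrite /H; bmt.
apply: Ex_ge0 => w.
rewrite (eq_bigr (fun a : 'I_n.+1 => \sum_(b < n.+1)
    Ex P (fun w' => H w a b (p a w' * p b w') (q a w' * q b w') (p a w' * q b w') (p b w' * q a w')))); last first.
  move=> a _; apply: eq_bigr => b _; rewrite /H.
  rewrite !ExD; [|by bmt..]; rewrite !ExZ//; by bmt.
rewrite -(@Ex_sum2 _ (fun a b w' => H w a b (p a w' * p b w') (q a w' * q b w') (p a w' * q b w') (p b w' * q a w'))); last first.
  by move=> a b; rewrite /H; bmt.
apply: Ex_ge0 => w'.
pose u a := s * (p a w * p a w') - s^-1 * (q a w * q a w').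
rewrite (eq_bigr (fun a : 'I_n.+1 => \sum_(b < n.+1) u a * u b)).
  by rewrite -sqr_sum sqr_ge0.
by move=> a _; apply: eq_bigr => b _; rewrite /H /u; field.
Qed.

(* 1 + v_a has constant squared modulus 1 + r, and a real part of mean 1 *)
Variable r : R.
Hypotheses (r0 : 0 <= r)
  (pqr : forall a w, p a w ^+ 2 + q a w ^+ 2 = r - 2 * p a w)
  (Ep : forall a, Ex P (p a) = 0).

Lemma Ex_sqr a : Ex P (fun w => p a w ^+ 2 + q a w ^+ 2) = r.
Proof.
under eq_Ex do rewrite pqr.
by rewrite ExB ?Ex_cst ?ExZ ?Ep ?mulr0 ?subr0//; bmt.
Qed.

(** Cauchy-Schwarz for complex functions, by the discriminant argument. *)
Lemma c_bound a b : cre a b ^+ 2 + cim a b ^+ 2 <= r ^+ 2.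
Proof.
set x := cre a b; set y := cim a b.
(* the mean of |c v_b - z v_a|^2, for the real number z *)
have key (z : R) : 0 <= (x ^+ 2 + y ^+ 2) * r + z ^+ 2 * r - 2 * z * (x ^+ 2 + y ^+ 2).
  pose f w := (x * p b w - y * q b w - z * p a w) ^+ 2 +
              (x * q b w + y * p b w - z * q a w) ^+ 2.
  suff -> : (x ^+ 2 + y ^+ 2) * r + z ^+ 2 * r - 2 * z * (x ^+ 2 + y ^+ 2) = Ex P f.
    by apply: Ex_ge0 => w; rewrite addr_ge0// sqr_ge0.
  have -> : (x ^+ 2 + y ^+ 2) * r + z ^+ 2 * r - 2 * z * (x ^+ 2 + y ^+ 2) =
      (x ^+ 2 + y ^+ 2) * Ex P (fun w => p b w ^+ 2 + q b w ^+ 2) +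
      z ^+ 2 * Ex P (fun w => p a w ^+ 2 + q a w ^+ 2) +
      - (2 * z * x) * (kpp a b + kqq a b) + - (2 * z * y) * (kpq b a - kpq a b).
    by rewrite !Ex_sqr -/(cre a b) -/(cim a b) -/x -/y; ring.
  rewrite /xcorr -ExD; [|by bmt..]; rewrite -ExB; [|by bmt..].
  rewrite -!ExZ; [|by bmt..]; rewrite -!ExD; [|by bmt..].
  by apply: eq_Ex => w; rewrite /f; ring.
have := key r; rewrite (_ : _ - _ = r * (r ^+ 2 - (x ^+ 2 + y ^+ 2))); last by ring.
have [r00|rn0] := eqVneq r 0.
  move=> _; have := key 1; rewrite r00 !mulr0 add0r mulr1 expr0n/= => h.
  by move: h; lra.
by rewrite pmulr_rge0 ?subr_ge0// lt_neqAle eq_sym rn0.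
Qed.

Lemma kqq_bound a b : kqq a b ^+ 2 <= r ^+ 2.
Proof.
have h c : Ex P (fun w => q c w ^+ 2) <= r.
  rewrite -(Ex_sqr c); apply: le_Ex => [||w]; [by bmt|by bmt|by rewrite lerDr sqr_ge0].
apply: le_trans (Ex_CS _ (bq a) (bq b)) _; rewrite expr2.
by apply: ler_pM; rewrite ?h//; apply: Ex_ge0 => w; exact: sqr_ge0.
Qed.

(** With alpha = |v|^2 = r - 2p, a nonnegative function of mean r bounded by
    K = 3r + 4, one has 4 E[p_a p_b] = E[alpha_a alpha_b] - r^2, and
    E[alpha_a alpha_b]^2 <= K r E[alpha_a alpha_b]. *)
Lemma kpp_sqr a b : 16 * kpp a b ^+ 2 <=
  (3 * r + 4) * r ^+ 3 + r ^+ 4 + 4 * (3 * r + 4) * r * kpp a b.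
Proof.
pose al c w := r - 2 * p c w.
have bal c : bmf (al c) by rewrite /al; bmt.
have al0 c w : 0 <= al c w by rewrite /al -pqr addr_ge0// sqr_ge0.
have alK c w : al c w <= 3 * r + 4.
  (* (p + 1)^2 <= |1 + v|^2 = 1 + r bounds p from below *)
  suff : - (r + 2) <= p c w by rewrite /al; lra.
  have h : (p c w + 1) ^+ 2 <= 1 + r.
    have := pqr c w; have := sqr_ge0 (q c w); rewrite sqrrD mulr1 expr1n -mulr_natl; lra.
  rewrite leNgt; apply/negP => hp.
  have h2 : (1 + r) ^+ 2 < (p c w + 1) ^+ 2.
    have r1 : 0 <= 1 + r by rewrite addr_ge0.
    have hz : 1 + r < - (p c w + 1) by lra.
    by rewrite -[(p c w + 1) ^+ 2]sqrrN !expr2 ltr_pM.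
  have h3 : 0 <= r * r by rewrite mulr_ge0.
  by move: (r0) h h2; rewrite [(1 + r) ^+ 2]expr2; lra.
have Eal c : Ex P (al c) = r by rewrite ExB ?Ex_cst ?ExZ ?Ep ?mulr0 ?subr0//; bmt.
pose m := Ex P (fun w => al a w * al b w).
have m0 : 0 <= m by apply: Ex_ge0 => w; rewrite mulr_ge0.
have mK : m <= (3 * r + 4) * r.
  rewrite -[X in _ * X](Eal b) -ExZ//; apply: le_Ex => [||w]; [by bmt|by bmt|].
  by rewrite ler_wpM2r.
have mE : m = r ^+ 2 + 4 * kpp a b.
  have -> : r ^+ 2 + 4 * kpp a b =
      r ^+ 2 + 4 * kpp a b + - (2 * r) * Ex P (p a) + - (2 * r) * Ex P (p b).
    by rewrite !Ep !mulr0 !addr0.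
  rewrite -(Ex_cst P (r ^+ 2)) /xcorr -!ExZ; [|by bmt..]; rewrite -!ExD; [|by bmt..].
  by apply: eq_Ex => w; rewrite /al; ring.
have h1 : m * m <= (3 * r + 4) * r * m by rewrite ler_wpM2r.
have h2 : 0 <= r ^+ 2 * m by rewrite mulr_ge0// sqr_ge0.
have -> : 16 * kpp a b ^+ 2 = m * m - 2 * (r ^+ 2 * m) + r ^+ 4 by rewrite mE; ring.
have -> : (3 * r + 4) * r ^+ 3 + r ^+ 4 + 4 * (3 * r + 4) * r * kpp a b =
  (3 * r + 4) * r * m + r ^+ 4 by rewrite mE; ring.
lra.
Qed.

(** The part with factor s^2 is of order r^3, the last term is of order r^2/s^2;
    the remaining ones vanish along the ergodic averages. *)
Lemma ces_c_bound n (s : R) : s != 0 ->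
  ces (fun a b => cre a b ^+ 2 + cim a b ^+ 2) n <=
  ces (fun a b => cre a b ^+ 2 - cim a b ^+ 2) n +
  s ^+ 2 / 4 * ((3 * r + 4) * r ^+ 3 + r ^+ 4 + 4 * (3 * r + 4) * r * ces cre n)
  + 4 * r ^+ 2 / s ^+ 2.
Proof.
move=> s0.
have e : ces (fun a b => cre a b ^+ 2 + cim a b ^+ 2) n =
  ces (fun a b => cre a b ^+ 2 - cim a b ^+ 2) n + 2 * ces (fun a b => cim a b ^+ 2) n.
  by rewrite -cesZ -cesD; apply: eq_ces => a b; ring.
rewrite e -addrA lerD2l.
have h1 : ces (fun a b => cim a b ^+ 2) n <= 4 * ces (fun a b => kpq a b ^+ 2) n.
  have -> : 4 * ces (fun a b => kpq a b ^+ 2) n =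
     ces (fun a b => 2 * kpq b a ^+ 2 + 2 * kpq a b ^+ 2) n.
    by rewrite cesD !cesZ (ces_swap (fun a b => kpq a b ^+ 2)); ring.
  apply: le_ces => a b; rewrite /cim -subr_ge0.
  rewrite (_ : _ - _ = (kpq b a + kpq a b) ^+ 2) ?sqr_ge0//; ring.
have h2 := ces_cross n s0.
have h3 : ces (fun a b => kqq a b ^+ 2) n <= r ^+ 2.
  by rewrite -[X in _ <= X](ces_cst _ n); apply: le_ces => a b; exact: kqq_bound.
have s2 : 0 < s ^+ 2 by rewrite exprn_even_gt0.
have h4 : ces (fun a b => kqq a b ^+ 2) n / s ^+ 2 <= r ^+ 2 / s ^+ 2.
  by rewrite ler_pM2r ?invr_gt0.
have h5 : 16 * ces (fun a b => kpp a b ^+ 2) n <=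
    (3 * r + 4) * r ^+ 3 + r ^+ 4 + 4 * (3 * r + 4) * r * ces kpp n.
  rewrite -cesZ -[in X in _ <= X]cesZ -[X in _ <= X + _](ces_cst _ n) -cesD.
  by apply: le_ces => a b; exact: kpp_sqr.
have h6 : ces kpp n <= ces cre n.
  rewrite -subr_ge0.
  have -> : ces cre n - ces kpp n = ces kqq n.
    by rewrite /cre cesD addrAC subrr add0r.
  exact: ces_xcorr_ge0.
have h7 : 4 * (3 * r + 4) * r * ces kpp n <= 4 * (3 * r + 4) * r * ces cre n.
  have K0 : 0 <= 3 * r + 4 by rewrite addr_ge0// mulr_ge0.
  by rewrite ler_wpM2l// !mulr_ge0.
have h8 : s ^+ 2 * (16 * ces (fun a b => kpp a b ^+ 2) n) <=
   s ^+ 2 * ((3 * r + 4) * r ^+ 3 + r ^+ 4 + 4 * (3 * r + 4) * r * ces cre n).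
  rewrite ler_pM2l//; lra.
have -> : 4 * r ^+ 2 / s ^+ 2 = 4 * (r ^+ 2 / s ^+ 2) by rewrite mulrA.
move: h1 h2 h4 h8; rewrite (mulrCA (s ^+ 2) 16) (mulrAC (s ^+ 2)).
move: (_ + _ * ces cre n) => M.
move: (ces (fun a b => cim a b ^+ 2) n) (ces (fun a b => kqq a b ^+ 2) n / _) => x1 x2.
move: (ces (fun a b => kpq a b ^+ 2) n) (s ^+ 2 * ces _ n) => x3 x4.
move: (s ^+ 2 * M) (r ^+ 2 / _) => x5 x6; lra.
Qed.

End kernels.

Section weak_mixing.
Context {R : realType} {d} {T : measurableType d} (P : nat -> probability T R).
Variables (p q : nat -> nat -> T -> R) (r : nat -> R).
Hypotheses (bp : forall m a, bmf (p m a)) (bq : forall m a, bmf (q m a))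
  (r0 : forall m, 0 <= r m)
  (pqr : forall m a w, p m a w ^+ 2 + q m a w ^+ 2 = r m - 2 * p m a w)
  (Ep : forall m a, Ex (P m) (p m a) = 0).
Notation cre m := (cre (P m) (p m) (q m)).
Notation cim m := (cim (P m) (p m) (q m)).
(* 1 + r_m = (1 + r_(m+1))^2 and 1 + c_m = (1 + c_(m+1))^2 *)
Hypotheses
  (rS : forall m, r m = 2 * r m.+1 + r m.+1 ^+ 2)
  (creS : forall m a b, cre m a b =
     2 * cre m.+1 a b + cre m.+1 a b ^+ 2 - cim m.+1 a b ^+ 2)
  (cimS : forall m a b, cim m a b = 2 * cim m.+1 a b * (1 + cre m.+1 a b))
  (cre0 : ces (cre 0%N) @ \oo --> (0 : R)).

Let nsq m a b := cre m a b ^+ 2 + cim m a b ^+ 2.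
Let rsq m a b := cre m a b ^+ 2 - cim m a b ^+ 2.

Lemma ces_cre_ge0 m n : 0 <= ces (cre m) n.
Proof. by rewrite cesD addr_ge0//; apply: ces_xcorr_ge0. Qed.

Lemma ces_creS m n : ces (cre m) n = 2 * ces (cre m.+1) n + ces (rsq m.+1) n.
Proof.
by rewrite -cesZ -cesD; apply: eq_ces => a b; rewrite creS addrA.
Qed.

Lemma ces_rsq_ge0 m n : 0 <= ces (rsq m) n.
Proof. exact: ces_sqr_ge0. Qed.

(** Both terms of the recursion for the Cesaro means are nonnegative. *)
Lemma ces_cre_cvg m : ces (cre m) @ \oo --> (0 : R).
Proof.
elim: m => [//|m IH]; apply: (seq_squeeze _ IH) => n.
rewrite subr0 ger0_norm ?ces_cre_ge0// [X in _ <= X]ces_creS.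
by have := ces_cre_ge0 m.+1 n; have := ces_rsq_ge0 m.+1 n; lra.
Qed.

Lemma ces_rsq_cvg m : ces (rsq m.+1) @ \oo --> (0 : R).
Proof.
apply: (seq_squeeze _ (ces_cre_cvg m)) => n.
rewrite subr0 ger0_norm ?ces_rsq_ge0// [X in _ <= X]ces_creS.
by have := ces_cre_ge0 m.+1 n; lra.
Qed.

Lemma r_geo m : r m * 2 ^+ m <= r 0%N.
Proof.
elim: m => [|m IH]; first by rewrite expr0 mulr1.
apply: le_trans IH; rewrite exprS mulrA ler_pM2r ?exprn_gt0// [r m]rS mulrC.
by have := sqr_ge0 (r m.+1); lra.
Qed.

Lemma r_le0 m : r m <= r 0%N.
Proof.
apply: le_trans (r_geo m); rewrite -[X in X <= _]mulr1 ler_wpM2l//.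
by apply: exprn_ege1; lra.
Qed.

Lemma nsq_bound m a b : nsq m a b <= r m ^+ 2.
Proof. exact: (c_bound (bp m) (bq m) (r0 m) (pqr m) (Ep m)). Qed.

(** |c_m| / r_m increases with m, since |c_m| = |c_(m+1)| |2 + c_(m+1)| and
    r_m = r_(m+1) (2 + r_(m+1)). *)
Lemma nsq_transfer m k a b : 0 < r m ->
  0 < r (m + k)%N /\ nsq m a b * r (m + k)%N ^+ 2 <= nsq (m + k)%N a b * r m ^+ 2.
Proof.
move=> rm; elim: k => [|k [rk IH]]; first by rewrite addn0; split.
rewrite addnS; move: (m + k)%N rk IH => j rj IH.
have rj1 : 0 < r j.+1.
  rewrite lt_neqAle r0 andbT eq_sym; apply/eqP => e.
  by move: rj; rewrite rS e expr0n/= mulr0 addr0 ltxx.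
split => //.
have nn i : 0 <= nsq i a b by rewrite addr_ge0// sqr_ge0.
have step : nsq j a b * r j.+1 ^+ 2 <= nsq j.+1 a b * r j ^+ 2.
  have -> : nsq j a b = nsq j.+1 a b * ((2 + cre j.+1 a b) ^+ 2 + cim j.+1 a b ^+ 2).
    by rewrite /nsq [cre j a b]creS [cim j a b]cimS; ring.
  have -> : r j ^+ 2 = (2 + r j.+1) ^+ 2 * r j.+1 ^+ 2 by rewrite [r j]rS; ring.
  rewrite -mulrA ler_wpM2l// ler_wpM2r ?sqr_ge0//.
  have h := nsq_bound j.+1 a b.
  have h2 : cre j.+1 a b <= r j.+1.
    apply: sqr_le_le => //; apply: le_trans h; rewrite /nsq lerDl sqr_ge0//.
  have -> : (2 + cre j.+1 a b) ^+ 2 + cim j.+1 a b ^+ 2 =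
      4 + 4 * cre j.+1 a b + nsq j.+1 a b by rewrite /nsq; ring.
  have -> : (2 + r j.+1) ^+ 2 = 4 + 4 * r j.+1 + r j.+1 ^+ 2 by ring.
  by rewrite !lerD// ler_wpM2l.
rewrite -(ler_pM2r (_ : 0 < r j ^+ 2)) ?exprn_gt0// mulrAC.
apply: (@le_trans _ _ (nsq j a b * r m ^+ 2 * r j.+1 ^+ 2)).
  by rewrite ler_wpM2r// sqr_ge0.
by rewrite mulrAC [X in _ <= X]mulrAC ler_wpM2r// sqr_ge0.
Qed.

Lemma r_cvg : r @ \oo --> (0 : R).
Proof.
apply: (seq_squeeze (v := fun m => r 0%N * 2^-1 ^+ m)); last by apply: seq_cvg_geo; lra.
move=> m; rewrite subr0 ger0_norm// exprVn ler_pdivlMr ?exprn_gt0//; exact: r_geo.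
Qed.

(** At level n = m + N with N large the bound on the Cesaro mean of |c_n|^2 is
    small compared with r_n^2, and it controls the one at level m. *)
Theorem nsq_cvg m : ces (fun a b => cre m a b ^+ 2 + cim m a b ^+ 2) @ \oo --> (0 : R).
Proof.
have n0 i a b : 0 <= nsq i a b by rewrite addr_ge0// sqr_ge0.
have [rm|rm] := ltP 0 (r m); last first.
  have rm0 : r m = 0 by apply/eqP; rewrite eq_le rm r0.
  apply: (seq_cvg_eventually (N := 0)) => n _.
  apply/eqP; rewrite eq_le ces_ge0 ?andbT; last exact: n0.
  rewrite -[X in _ <= X](ces_cst 0 n); apply: le_ces => a b.
  by have := nsq_bound m a b; rewrite rm0 expr0n.
apply/seq_cvgP => e e0.
have rm2 : 0 < r m ^+ 2 by rewrite exprn_gt0.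
(* s is large, to make r^2/s^2 small; then r_n is small compared with 1/s^2, through D;
   eta bounds the Cesaro means that vanish along the averages *)
pose s := 1 + 12 * r m ^+ 2 / e.
have s1 : 1 <= s by rewrite lerDl divr_ge0// ?mulr_ge0// ltW.
have s2 : 1 <= s ^+ 2 by exact: exprn_ege1.
have hs : 12 * r m ^+ 2 <= e * s ^+ 2.
  apply: (@le_trans _ _ (e * s)).
    have -> : e * s = e + 12 * r m ^+ 2 by rewrite /s; field; rewrite gt_eqF.
    by rewrite lerDr ltW.
  by rewrite ler_pM2l// expr2 ler_peMl//; lra.
have r00 := r0 0%N.
pose D := r m ^+ 2 * s ^+ 2 * (r 0%N + 1).
have D0 : 0 < D by rewrite !mulr_gt0//; lra.
have eD : 0 < e / 3 / D by rewrite !divr_gt0.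
have /seq_cvgP /(_ _ eD) [N hN] := r_cvg.
pose n := (m + N.+1)%N.
have rn : 0 < r n by have [] := nsq_transfer N.+1 0 0 rm.
have rn2 : 0 < r n ^+ 2 by rewrite exprn_gt0.
have hrn : r n * D <= e / 3.
  rewrite -ler_pdivlMr//; have := hN n; rewrite subr0 ger0_norm//; apply.
  by rewrite /n addnS leqW// leq_addl.
pose eta := e / 3 * r n ^+ 2 / (r m ^+ 2 * (1 + s ^+ 2 * (3 * r n + 4) * r n)).
have B0 : 0 < 1 + s ^+ 2 * (3 * r n + 4) * r n.
  by rewrite addr_gt0// !mulr_gt0//; lra.
have eta0 : 0 < eta by rewrite /eta !(divr_gt0, mulr_gt0)//; lra.
have /seq_cvgP /(_ _ eta0) [L1 hL1] := ces_cre_cvg n.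
have /seq_cvgP /(_ _ eta0) [L2 hL2] := ces_rsq_cvg (m + N)%N.
exists (maxn L1 L2) => L; rewrite geq_max => /andP[/hL1 + /hL2].
rewrite -addnS -/n !subr0 => h1 h2.
have {}h1 : ces (cre n) L <= eta by apply: le_trans h1; exact: ler_norm.
have {}h2 : ces (rsq n) L <= eta by apply: le_trans h2; exact: ler_norm.
rewrite ger0_norm; last by apply: ces_ge0 => a b; exact: n0.
rewrite -(ler_pM2r rn2).
have t1 : ces (nsq m) L * r n ^+ 2 <= ces (nsq n) L * r m ^+ 2.
  rewrite mulrC [X in _ <= X]mulrC -!cesZ; apply: le_ces => a b.
  by rewrite mulrC [X in _ <= X]mulrC; have [] := nsq_transfer N.+1 a b rm.
apply: le_trans t1 _.
have sn0 : s != 0 by rewrite gt_eqF//; lra.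
have t2 : ces (nsq n) L <= ces (rsq n) L + s ^+ 2 / 4 *
    ((3 * r n + 4) * r n ^+ 3 + r n ^+ 4 + 4 * (3 * r n + 4) * r n * ces (cre n) L) +
    4 * r n ^+ 2 / s ^+ 2.
  exact: (ces_c_bound (bp n) (bq n) (r0 n) (pqr n) (Ep n) L sn0).
apply: (@le_trans _ _ ((eta * (1 + s ^+ 2 * (3 * r n + 4) * r n) +
   r n * (s ^+ 2 * (r 0%N + 1)) * r n ^+ 2 + 4 * r n ^+ 2 / s ^+ 2) * r m ^+ 2)).
  rewrite ler_pM2r//; apply: le_trans t2 _; rewrite lerD2r.
  have t3 : s ^+ 2 * (3 * r n + 4) * r n * ces (cre n) L <=
      s ^+ 2 * (3 * r n + 4) * r n * eta.
    by rewrite ler_wpM2l// !mulr_ge0//; lra.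
  have t4 : s ^+ 2 / 4 * ((3 * r n + 4) * r n ^+ 3 + r n ^+ 4) <=
      r n * (s ^+ 2 * (r 0%N + 1)) * r n ^+ 2.
    have -> : s ^+ 2 / 4 * ((3 * r n + 4) * r n ^+ 3 + r n ^+ 4) =
      s ^+ 2 * r n ^+ 3 * (r n + 1) by field.
    have -> : r n * (s ^+ 2 * (r 0%N + 1)) * r n ^+ 2 = s ^+ 2 * r n ^+ 3 * (r 0%N + 1) by ring.
    rewrite ler_wpM2l ?lerD2r ?r_le0// mulr_ge0 ?exprn_ge0//; lra.
  have -> : s ^+ 2 / 4 * ((3 * r n + 4) * r n ^+ 3 + r n ^+ 4 +
      4 * (3 * r n + 4) * r n * ces (cre n) L) =
    s ^+ 2 / 4 * ((3 * r n + 4) * r n ^+ 3 + r n ^+ 4) +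
      s ^+ 2 * (3 * r n + 4) * r n * ces (cre n) L by field.
  have -> : eta * (1 + s ^+ 2 * (3 * r n + 4) * r n) =
    eta + s ^+ 2 * (3 * r n + 4) * r n * eta by ring.
  apply: (le_trans (lerD h2 (lerD t4 t3))); rewrite le_eqVlt; apply/orP; left.
  by apply/eqP; ring.
have e1 : eta * (1 + s ^+ 2 * (3 * r n + 4) * r n) * r m ^+ 2 = e / 3 * r n ^+ 2.
  by rewrite /eta; field; rewrite !gt_eqF.
have e2 : r n * (s ^+ 2 * (r 0%N + 1)) * r n ^+ 2 * r m ^+ 2 <= e / 3 * r n ^+ 2.
  rewrite mulrAC ler_pM2r//; apply: le_trans hrn.
  by rewrite le_eqVlt; apply/orP; left; apply/eqP; rewrite /D; ring.
have e3 : 4 * r n ^+ 2 / s ^+ 2 * r m ^+ 2 <= e / 3 * r n ^+ 2.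
  rewrite mulrAC ler_pdivrMr; last by lra.
  rewrite [X in X <= _](_ : _ = 4 * r m ^+ 2 * r n ^+ 2); last by ring.
  rewrite [X in _ <= X]mulrAC ler_pM2r//; lra.
by rewrite [X in X <= _]mulrDl [X in X + _ <= _]mulrDl e1; lra.
Qed.

End weak_mixing.

(** * Characteristic functions and convolution roots *)

Section characteristic_function.
Local Open Scope complex_scope.
Context {R : realType} {J : Type}.
Implicit Types (Q : probability (RJ J R) R) (l : lform R J).

(* real and imaginary parts of the characteristic function *)
Definition chc Q l : R := Ex Q (fun x => cos (ev l x)).
Definition chs Q l : R := Ex Q (fun x => sin (ev l x)).
Definition chf Q l : R[i] := chc Q l +i* chs Q l.
(* squared modulus *)
Definition ch2 Q l : R := chc Q l ^+ 2 + chs Q l ^+ 2.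

Lemma ch2_ge0 Q l : 0 <= ch2 Q l.
Proof. by rewrite addr_ge0// sqr_ge0. Qed.

Lemma ch2_eq0 Q l : (ch2 Q l == 0) = (chf Q l == 0).
Proof.
rewrite /ch2 paddr_eq0 ?sqr_ge0// !sqrf_eq0 /chf.
by apply/andP/eqP => [[/eqP-> /eqP->]//|[-> ->]].
Qed.

Lemma ch2_le1 Q l : ch2 Q l <= 1.
Proof.
have h (a b : R) : chc Q l * a + chs Q l * b <= (a ^+ 2 + b ^+ 2 + 1) / 2.
  rewrite /chc /chs -!ExZr; [|exact: bmf_sinev|exact: bmf_cosev].
  have bc := bmf_cosev l; have bs := bmf_sinev l.
  rewrite -ExD; [|by bmt..].
  rewrite -(Ex_cst Q ((a ^+ 2 + b ^+ 2 + 1) / 2)).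
  apply: le_Ex; [by bmt|by bmt|move=> x].
  have e := cos2Dsin2 (ev l x).
  have := sqr_ge0 (cos (ev l x) - a); have := sqr_ge0 (sin (ev l x) - b).
  by rewrite !sqrrB; lra.
by have := h (chc Q l) (chs Q l); rewrite -!expr2 -/(ch2 Q l); lra.
Qed.

(** Integrating 1 - cos(2z) <= 4 (1 - cos z) for z = l(x) - l(x'). *)
Lemma ch2_double Q l : 1 - ch2 Q (lformZ 2 l) <= 4 * (1 - ch2 Q l).
Proof.
have key k : ch2 Q k = Ex Q (fun x => Ex Q (fun y => cos (ev k x - ev k y))).
  have bc := bmf_cosev k; have bs := bmf_sinev k.
  under eq_Ex => x.
    under eq_Ex do rewrite cosB.
    rewrite ExD; [|by bmt..].
    rewrite !ExZ; [|by bmt..].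
    over.
  by rewrite ExD; [|by bmt..]; rewrite !ExZr; [|by bmt..].
have bd k x : bmf (fun y : RJ J R => cos (ev k x - ev k y)).
  by apply: bmf_cos; apply: measurable_funB; [exact: measurable_cst|exact: measurable_ev].
have bE k : bmf (fun x : RJ J R => Ex Q (fun y => cos (ev k x - ev k y))).
  have bc := bmf_cosev k; have bs := bmf_sinev k.
  rewrite (_ : (fun x : RJ J R => _) = (fun x => cos (ev k x) * chc Q k + sin (ev k x) * chs Q k)).
    by bmt.
  apply/funext => x; under eq_Ex do rewrite cosB.
  by rewrite ExD; [|by bmt..]; rewrite !ExZ; [|by bmt..].
rewrite !key -subr_ge0.
have -> : 4 * (1 - Ex Q (fun x => Ex Q (fun y => cos (ev l x - ev l y)))) -
   (1 - Ex Q (fun x => Ex Q (fun y => cos (ev (lformZ 2 l) x - ev (lformZ 2 l) y)))) =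
  Ex Q (fun x => 3 + -4 * Ex Q (fun y => cos (ev l x - ev l y)) +
     Ex Q (fun y => cos (ev (lformZ 2 l) x - ev (lformZ 2 l) y))).
  have b1 := bE l; have b2 := bE (lformZ 2 l).
  rewrite ExD; [|by bmt..]; rewrite ExD; [|by bmt..]; rewrite Ex_cst ExZ; [|by bmt].
  by move: (Ex _ _) (Ex _ _) => a b; ring.
apply: Ex_ge0 => x.
have -> : 3 + -4 * Ex Q (fun y => cos (ev l x - ev l y)) +
     Ex Q (fun y => cos (ev (lformZ 2 l) x - ev (lformZ 2 l) y)) =
   Ex Q (fun y => 3 + -4 * cos (ev l x - ev l y) +
     cos (ev (lformZ 2 l) x - ev (lformZ 2 l) y)).
  have b1 := bd l x; have b2 := bd (lformZ 2 l) x.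
  by rewrite ExD; [|by bmt..]; rewrite ExD; [|by bmt..]; rewrite Ex_cst ExZ.
apply: Ex_ge0 => y; rewrite !evZ -mulrBr mulr_natl mulr2n.
set z := ev l x - ev l y; rewrite (cosD z z).
have -> : sin z * sin z = 1 - cos z * cos z by rewrite -(cos2Dsin2 z); ring.
by have := sqr_ge0 (1 - cos z); rewrite expr2; lra.
Qed.

Lemma ch2_dyadic Q l j : 1 - ch2 Q l <= 4 ^+ j * (1 - ch2 Q (lformZ (2^-1 ^+ j) l)).
Proof.
have formZZ s t k : lformZ s (lformZ t k) = lformZ (s * t) k :> lform R J.
  by rewrite /lformZ -map_comp; apply: eq_map => -[i a] /=; rewrite mulrA.
elim: j => [|j IH].
  rewrite !expr0 mul1r (_ : lformZ 1 l = l)// /lformZ -[RHS]map_id.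
  by apply: eq_map => -[i a] /=; rewrite mul1r.
apply: le_trans IH _; rewrite exprSr -mulrA ler_wpM2l ?exprn_ge0//.
have -> : lformZ (2^-1 ^+ j) l = lformZ 2 (lformZ (2^-1 ^+ j.+1) l).
  by rewrite formZZ exprS mulrA divff// mul1r.
exact: ch2_double.
Qed.

Lemma ch_cvg Q l (u : nat -> R) (t : R) : u @ \oo --> t ->
  (fun n => chc Q (lformZ (u n) l)) @ \oo --> chc Q (lformZ t l) /\
  (fun n => chs Q (lformZ (u n) l)) @ \oo --> chs Q (lformZ t l).
Proof.
move=> ut; split.
- apply: (@Ex_cvg _ _ _ Q (fun n x => cos (ev (lformZ (u n) l) x)) _ 1).
  + by move=> n; exact: bmf_cosev.
  + by move=> n x; rewrite ler_norml cos_geN1 cos_le1.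
  + move=> x; rewrite evZ; under eq_fun do rewrite evZ.
    have cu : (fun n => u n * ev l x) @ \oo --> t * ev l x by exact: cvgMr_tmp.
    exact: (cvg_comp _ _ cu (@continuous_cos R _)).
- apply: (@Ex_cvg _ _ _ Q (fun n x => sin (ev (lformZ (u n) l) x)) _ 1).
  + by move=> n; exact: bmf_sinev.
  + by move=> n x; rewrite ler_norml sin_geN1 sin_le1.
  + move=> x; rewrite evZ; under eq_fun do rewrite evZ.
    have cu : (fun n => u n * ev l x) @ \oo --> t * ev l x by exact: cvgMr_tmp.
    exact: (cvg_comp _ _ cu (@continuous_sin R _)).
Qed.

Lemma ch_continuous Q l : continuous (fun t => chc Q (lformZ t l)) /\
  continuous (fun t => chs Q (lformZ t l)).
Proof.
by split=> t; apply/(@cvg_nbhsP _ R^o) => u ut; have [] := ch_cvg Q l ut.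
Qed.

Lemma ch_at0 Q l : chc Q (lformZ 0 l) = 1 /\ chs Q (lformZ 0 l) = 0.
Proof.
rewrite /chc /chs; split.
  by under eq_Ex do rewrite evZ mul0r cos0; rewrite Ex_cst.
by under eq_Ex do rewrite evZ mul0r sin0; rewrite Ex_cst.
Qed.

(** The two square roots differ by a sign, and the sign cannot jump along the
    segment from 0 to l, where both characteristic functions are nonzero. *)
Lemma chf_sqrt_unique Q Q' : (forall l, chf Q l ^+ 2 = chf Q' l ^+ 2) ->
  (forall l, chf Q l != 0) -> forall l, chf Q l = chf Q' l.
Proof.
move=> h hn l.
pose g t := chc Q (lformZ t l) * chc Q' (lformZ t l) + chs Q (lformZ t l) * chs Q' (lformZ t l).
have gE t : g t = ch2 Q (lformZ t l) \/ g t = - ch2 Q (lformZ t l).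
  have /eqP := h (lformZ t l); rewrite eqf_sqr => /orP[] /eqP [e1 e2]; rewrite /g /ch2.
    by left; rewrite -e1 -e2 !expr2.
  right; rewrite e1 e2; ring.
have gn0 t : g t != 0.
  have := hn (lformZ t l); rewrite -ch2_eq0.
  by case: (gE t) => ->; rewrite ?oppr_eq0.
have e1 : lformZ 1 l = l.
  by rewrite /lformZ -[RHS]map_id; apply: eq_map => -[i a] /=; rewrite mul1r.
have cg : continuous g.
  move=> t; have [c1 s1] := ch_continuous Q l; have [c2 s2] := ch_continuous Q' l.
  apply: cvgD; apply: cvgM; [exact: c1|exact: c2|exact: s1|exact: s2].
have g0 : g 0 = 1.
  by rewrite /g (ch_at0 Q l).1 (ch_at0 Q l).2 (ch_at0 Q' l).1 mulr1 mul0r addr0.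
have g1 : 0 < g 1.
  rewrite ltNge; apply/negP => g1.
  have [t _ gt0] : exists2 c, c \in `[0, 1]%R & g c = 0.
    apply: IVT => //; first by apply: continuous_subspaceT.
    by rewrite g0 ge_min g1 orbT le_max ler01.
  by have := gn0 t; rewrite gt0 eqxx.
have /eqP := h l; rewrite eqf_sqr => /orP[/eqP//|/eqP e].
exfalso; move: g1; rewrite /g e1.
have [-> ->] : chc Q l = - chc Q' l /\ chs Q l = - chs Q' l by case: e => -> ->.
have := sqr_ge0 (chc Q' l); have := sqr_ge0 (chs Q' l); rewrite !expr2; lra.
Qed.

Lemma chf_unique Q Q' : (forall l, chf Q l = chf Q' l) ->
  forall A, measurable A -> Q A = Q' A.
Proof. by move=> h; apply: char_unique => l; have [] := h l. Qed.

Lemma eq_chf Q Q' : (forall A, measurable A -> Q A = Q' A) -> chf Q = chf Q'.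
Proof.
by move=> h; apply/funext => l; rewrite /chf /chc /chs !(eq_Ex_measure _ h).
Qed.

End characteristic_function.

Section convolution_roots.
Local Open Scope complex_scope.
Context {R : realType}.
Implicit Types (P Q : probability (RZ R) R) (l : lform R int).

Lemma measurable_addZ : measurable_fun setT (@addZ R).
Proof.
apply: (@measurable_RJ R int) => j; apply: measurable_funD.
- apply: (measurableT_comp (f := fun x : RJ int R => x j)); first exact: measurable_coord.
  exact: measurable_fst.
- apply: (measurableT_comp (f := fun x : RJ int R => x j)); first exact: measurable_coord.
  exact: measurable_snd.
Qed.

Definition convp P Q : probability (RZ R) R := law (prodp P Q) measurable_addZ.

Lemma convpE P Q A : convp P Q A = convolution P Q A.
Proof. by []. Qed.

Lemma chf_convp P Q l : chf (convp P Q) l = chf P l * chf Q l.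
Proof.
have e (z : RZ R * RZ R) : ev l (addZ z) = ev l z.1 + ev l z.2.
  by rewrite /ev -big_split/=; apply: eq_bigr => p _; rewrite /addZ mulrDr.
have [ec es] := Ex_trigD1 P Q (@measurable_ev R int l) (@measurable_ev R int l).
rewrite {1}/chf /chc /chs !Ex_law; [|exact: bmf_sinev|exact: bmf_cosev].
under eq_Ex do rewrite e.
under [X in _ +i* X]eq_Ex do rewrite e.
by rewrite ec es [X in _ +i* X]addrC.
Qed.

Definition powp k Q : probability (RZ R) R := iter k (convp Q) Q.

Lemma chf_powp k Q l : chf (powp k Q) l = chf Q l ^+ k.+1.
Proof.
by elim: k => [|k IH]; rewrite ?expr1//= chf_convp IH -exprS.
Qed.

Lemma conv_powE k Q A : conv_pow k.+1 Q A = powp k Q A.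
Proof.
rewrite /conv_pow iteropS; congr (_ A); rewrite /powp.
elim: k => [//|k IH]; by rewrite !iterS IH.
Qed.

(** Uniqueness of square roots, applied to the convolution powers of order 2^n. *)
Lemma pow2_unique n Q Q' : (forall l, chf Q l ^+ (2 ^ n) = chf Q' l ^+ (2 ^ n)) ->
  (forall l, chf Q l != 0) -> forall l, chf Q l = chf Q' l.
Proof.
elim: n => [|n IH] h hn l; first by have := h l; rewrite expn0 !expr1.
apply: IH => // k.
have e M j : chf M j ^+ (2 ^ n) = chf (powp (2 ^ n).-1 M) j.
  by rewrite chf_powp prednK// expn_gt0.
rewrite !e; apply: chf_sqrt_unique => j.
  by rewrite -!e -!exprM -expnSr; exact: h.
by rewrite -e expf_neq0.
Qed.

Lemma ch2_pow Q Q' n l : chf Q l = chf Q' l ^+ n -> ch2 Q l = ch2 Q' l ^+ n.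
Proof.
pose N (z : R[i]) := complex.Re z ^+ 2 + complex.Im z ^+ 2.
have NM z w : N (z * w) = N z * N w by case: z w => [a b] [c d]; rewrite /N/=; ring.
have e M : ch2 M l = N (chf M l) by [].
move=> h; rewrite !e h; elim: n {h} => [|n IH].
  by rewrite !expr0 /N/= expr1n expr0n/= addr0.
by rewrite !exprS NM IH.
Qed.

(** Were phi(l) = 0, all the roots would vanish at l. Since |phi| is close to 1
    at l / 2^j, so are the roots of high order, and the doubling inequality
    keeps them away from 0 at l. *)
Lemma chf_neq0 P (A : nat -> probability (RZ R) R) :
  (forall n l, chf P l = chf (A n) l ^+ (2 ^ n)) -> forall l, chf P l != 0.
Proof.
move=> h l; apply/negP => /eqP Pl0.
have [j hj] : exists j, 2^-1 <= ch2 P (lformZ (2^-1 ^+ j) l).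
  have c0 : (fun j => 1 * 2^-1 ^+ j : R) @ \oo --> (0 : R) by apply: seq_cvg_geo; lra.
  have [c1 c2] := ch_cvg P l c0.
  have : (fun j => ch2 P (lformZ (1 * 2^-1 ^+ j) l)) @ \oo --> ch2 P (lformZ 0 l).
    by rewrite /ch2 expr2 [X in _ + X]expr2; under eq_fun do rewrite !expr2; apply: cvgD; apply: cvgM.
  have -> : ch2 P (lformZ 0 l) = 1.
    by rewrite /ch2 (ch_at0 P l).1 (ch_at0 P l).2 expr1n expr0n/= addr0.
  move=> /seq_cvgP /(_ 2^-1) [|N hN]; first by rewrite invr_gt0.
  exists N; have := hN N (leqnn _); rewrite mul1r ler_norml => /andP[h1 _].
  by move: h1; lra.
have hA n : ch2 (A n) (lformZ (2^-1 ^+ j) l) <= 1 - 4^-1 ^+ j.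
  have := ch2_dyadic (A n) l j.
  have -> : ch2 (A n) l = 0.
    apply/eqP; rewrite ch2_eq0; have /eqP := h n l; rewrite Pl0 eq_sym expf_eq0.
    by move=> /andP[].
  rewrite subr0 -ler_pdivrMl ?exprn_gt0// mulr1 -exprVn; lra.
have z1 : 0 <= (1 - 4^-1 ^+ j : R) < 1.
  have : 0 < 4^-1 ^+ j :> R by rewrite exprn_gt0.
  have : 4^-1 ^+ j <= 1 :> R by apply: exprn_ile1; lra.
  lra.
have /seq_cvgP /(_ 4^-1) [|N hN] := seq_cvg_geo 1 z1; first by rewrite invr_gt0.
have := hN (2 ^ N)%N (ltnW (ltn_expl N (leqnn 2))); rewrite subr0 mul1r ger0_norm; last first.
  by rewrite exprn_ge0//; have /andP[] := z1.
apply/negP; rewrite -ltNge; apply: (@lt_le_trans _ _ 2^-1); first by lra.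
apply: (le_trans hj); rewrite (ch2_pow (h N _)).
by rewrite ler_pXn2r ?expn_gt0// nnegrE ?ch2_ge0//; have /andP[] := z1.
Qed.

Lemma measurable_shiftZ : measurable_fun setT (@shiftZ R).
Proof.
by apply: (@measurable_RJ R int) => j; exact: (@measurable_coord R int).
Qed.

Definition shift_form l : lform R int := [seq (p.1 + 1, p.2) | p <- l].

Lemma ev_shift l (x : RZ R) : ev l (shiftZ x) = ev (shift_form l) x.
Proof. by rewrite /ev big_map. Qed.

Lemma chf_shift Q l : chf (law Q measurable_shiftZ) l = chf Q (shift_form l).
Proof.
rewrite /chf /chc /chs !Ex_law; [|exact: bmf_sinev|exact: bmf_cosev].
by congr (_ +i* _); apply: eq_Ex => x; rewrite ev_shift.
Qed.

(** Roots of order 2^n are unique, hence they are convolution powers of each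
    other and inherit stationarity. *)
Theorem root_sequence P : measure_preserving P (@shiftZ R) -> infinitely_divisible P ->
  exists Q : nat -> probability (RZ R) R,
    [/\ forall A, measurable A -> Q 0%N A = P A,
        forall n A, measurable A -> Q n A = convolution (Q n.+1) (Q n.+1) A,
        forall n, measure_preserving (Q n) (@shiftZ R) &
        forall n l, 0 < ch2 (Q n) l].
Proof.
move=> P_stat P_id.
have [Q hQ] : exists Q : nat -> probability (RZ R) R,
    forall n A, measurable A -> P A = conv_pow (2 ^ n) (Q n) A.
  suff /choice [Q hQ] : forall n, exists Q : probability (RZ R) R,
     forall A, measurable A -> P A = conv_pow (2 ^ n) Q A by exists Q.
  by move=> n; apply: P_id; rewrite expn_gt0.
have cQ n l : chf P l = chf (Q n) l ^+ (2 ^ n).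
  have -> : chf P = chf (powp (2 ^ n).-1 (Q n)).
    apply: eq_chf => A mA; rewrite (hQ n)// -[in LHS](prednK (_ : 0 < 2 ^ n)%N) ?expn_gt0//.
    exact: conv_powE.
  by rewrite chf_powp prednK// expn_gt0.
have P0 := chf_neq0 cQ.
have Q0 n l : chf (Q n) l != 0.
  by have := P0 l; rewrite (cQ n); apply: contraNN => /eqP->; rewrite expf_eq0 eqxx expn_gt0.
exists Q; split.
- by move=> A mA; rewrite (hQ 0%N)// expn0.
- move=> n A mA; rewrite -convpE; apply: chf_unique mA; apply: (@pow2_unique n) => //.
  by move=> l; rewrite -cQ chf_convp -expr2 -exprM -expnS -cQ.
- move=> n; split; first exact: measurable_shiftZ.
  move=> A mA; rewrite -[LHS](lawE _ measurable_shiftZ).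
  apply: chf_unique mA => l; apply/esym; move: l; apply: (@pow2_unique n) => // l.
  rewrite chf_shift -!cQ -chf_shift; congr (_ l); apply: eq_chf => B mB.
  exact: (esym (P_stat.2 B mB)).
- move=> n l; rewrite lt_neqAle ch2_ge0 andbT eq_sym ch2_eq0; exact: Q0.
Qed.

End convolution_roots.

(** * Weak mixing of the roots *)

Section wmix_def.
Context {R : realType} {J : Type}.

(* l o S^a - l o S^b, for a shift [sh] of functionals *)
Definition dform (sh : lform R J -> lform R J) (l : lform R J) (a b : nat) : lform R J :=
  iter a sh l ++ lformZ (-1) (iter b sh l).

Lemma ev_dform sh l a b x : ev (dform sh l a b) x = ev (iter a sh l) x - ev (iter b sh l) x.
Proof. by rewrite ev_cat evZ mulN1r. Qed.

(* correlation defect: phi(l o S^a - l o S^b) / |phi(l)|^2 - 1 *)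
Definition defre (Q : probability (RJ J R) R) sh l a b : R :=
  chc Q (dform sh l a b) / ch2 Q l - 1.
Definition defim (Q : probability (RJ J R) R) sh l a b : R :=
  chs Q (dform sh l a b) / ch2 Q l.

(** The correlation defects tend to 0 in density. *)
Definition wmix Q sh l : Prop :=
  ces (fun a b => defre Q sh l a b ^+ 2 + defim Q sh l a b ^+ 2) @ \oo --> (0 : R).

End wmix_def.

Section roots_weak_mixing.
Context {R : realType} (Q : nat -> probability (RZ R) R).
Hypotheses
  (Q_root : forall n A, measurable A -> Q n A = convolution (Q n.+1) (Q n.+1) A)
  (Q_stat : forall n, measure_preserving (Q n) (@shiftZ R))
  (Q_pos : forall n l, 0 < ch2 (Q n) l)
  (Q_erg : ergodic (Q 0%N) (@shiftZ R)).
Variable l : lform R int.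

Notation sh := (@shift_form R).
Notation la a := (iter a sh l).
Notation c n := (chc (Q n) l).
Notation s n := (chs (Q n) l).
Notation m n := (ch2 (Q n) l).

Lemma chf_root n k : chf (Q n) k = chf (Q n.+1) k ^+ 2.
Proof.
by rewrite expr2 -chf_convp; congr (_ k); apply: eq_chf => A mA; exact: Q_root.
Qed.

Lemma chf_stat n k a : chf (Q n) (iter a sh k) = chf (Q n) k.
Proof.
elim: a => [//|a IH]; rewrite iterS -chf_shift -IH; congr (_ _).
by apply: eq_chf => A mA; rewrite lawE (Q_stat n).2.
Qed.

Lemma ev_iter a x : ev (la a) x = ev l (iter a (@shiftZ R) x).
Proof. by elim: a x => [//|a IH] x; rewrite iterS -ev_shift IH -iterSr. Qed.

(* real and imaginary parts of exp(i l(S^a x)) / phi(l) - 1 *)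
Definition vre n a (x : RZ R) : R := (c n * cos (ev (la a) x) + s n * sin (ev (la a) x)) / m n - 1.
Definition vim n a (x : RZ R) : R := (c n * sin (ev (la a) x) - s n * cos (ev (la a) x)) / m n.

Lemma bmf_vre n a : bmf (vre n a).
Proof.
have bc := @bmf_cosev R int (la a); have bs := @bmf_sinev R int (la a).
by rewrite /vre; bmt.
Qed.

Lemma bmf_vim n a : bmf (vim n a).
Proof.
have bc := @bmf_cosev R int (la a); have bs := @bmf_sinev R int (la a).
by rewrite /vim; bmt.
Qed.

Lemma m_neq0 n : c n ^+ 2 + s n ^+ 2 != 0.
Proof. by rewrite -/(m n) gt_eqF. Qed.

Lemma Ex_vre n a : Ex (Q n) (vre n a) = 0.
Proof.
have bc := @bmf_cosev R int (la a); have bs := @bmf_sinev R int (la a).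
rewrite /vre ExB; [|by bmt..]; rewrite ExZr; [|by bmt..]; rewrite ExD; [|by bmt..].
rewrite !ExZ// Ex_cst -/(chc (Q n) (la a)) -/(chs (Q n) (la a)).
have [-> ->] := chf_stat n l a.
by rewrite -!expr2 divff ?subrr// m_neq0.
Qed.

Lemma Ex_vim n a : Ex (Q n) (vim n a) = 0.
Proof.
have bc := @bmf_cosev R int (la a); have bs := @bmf_sinev R int (la a).
rewrite /vim ExZr; [|by bmt..]; rewrite ExB; [|by bmt..].
rewrite !ExZ// -/(chc (Q n) (la a)) -/(chs (Q n) (la a)).
have [-> ->] := chf_stat n l a.
by rewrite [X in _ - X]mulrC subrr mul0r.
Qed.

Lemma v_sqr n a x : vre n a x ^+ 2 + vim n a x ^+ 2 = ((m n)^-1 - 1) - 2 * vre n a x.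
Proof.
have m0 := m_neq0 n; have e := cos2Dsin2 (ev (la a) x).
rewrite /vre /vim /ch2; set C := cos _ in e *; set S := sin _ in e *.
set u := c n in m0 *; set w := s n in m0 *.
have -> : ((u * C + w * S) / (u ^+ 2 + w ^+ 2) - 1) ^+ 2 +
   ((u * S - w * C) / (u ^+ 2 + w ^+ 2)) ^+ 2 =
   (C ^+ 2 + S ^+ 2) / (u ^+ 2 + w ^+ 2) - 2 * ((u * C + w * S) / (u ^+ 2 + w ^+ 2)) + 1.
  by field.
by rewrite e div1r; move: (_^-1) (_ / _) => y z; ring.
Qed.

Lemma cre_v n a b : cre (Q n) (vre n) (vim n) a b = defre (Q n) sh l a b.
Proof.
have b1 := bmf_vre n a; have b2 := bmf_vre n b.
have b3 := bmf_vim n a; have b4 := bmf_vim n b.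
have bd := @bmf_cosev R int (dform sh l a b).
rewrite /cre /xcorr -ExD; [|by bmt..].
rewrite (_ : Ex _ _ = Ex (Q n) (fun x => cos (ev (dform sh l a b) x) * (m n)^-1 - vre n a x - vre n b x - 1)).
  rewrite ExB; [|by bmt..]; rewrite ExB; [|by bmt..]; rewrite ExB; [|by bmt..].
  by rewrite ExZr// !Ex_vre Ex_cst !subr0.
apply: eq_Ex => x; rewrite ev_dform cosB /vre /vim /ch2.
by have m0 := m_neq0 n; field.
Qed.

Lemma cim_v n a b : cim (Q n) (vre n) (vim n) a b = defim (Q n) sh l a b.
Proof.
have b1 := bmf_vre n a; have b2 := bmf_vre n b.
have b3 := bmf_vim n a; have b4 := bmf_vim n b.
have bd := @bmf_sinev R int (dform sh l a b).
rewrite /cim /xcorr -ExB; [|by bmt..].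
rewrite (_ : Ex _ _ = Ex (Q n) (fun x => sin (ev (dform sh l a b) x) * (m n)^-1 - vim n a x + vim n b x)).
  rewrite ExD; [|by bmt..]; rewrite ExB; [|by bmt..].
  by rewrite ExZr// !Ex_vim subr0 addr0.
apply: eq_Ex => x; rewrite ev_dform sinB /vre /vim /ch2.
by have m0 := m_neq0 n; field.
Qed.

Lemma m_root n : m n = m n.+1 ^+ 2.
Proof. by apply: ch2_pow; exact: chf_root. Qed.

Lemma ch_root n k : chc (Q n) k = chc (Q n.+1) k ^+ 2 - chs (Q n.+1) k ^+ 2 /\
  chs (Q n) k = 2 * chc (Q n.+1) k * chs (Q n.+1) k.
Proof.
have := chf_root n k; rewrite expr2 => -[-> ->]; rewrite !expr2; split => //.
by rewrite -/(chc (Q n.+1) k) -/(chs (Q n.+1) k); ring.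
Qed.

(** At level 0 the Cesaro means of the real defects are second moments of ergodic
    averages; convolution roots satisfy the recursion between levels. *)
Theorem roots_wmix n : wmix (Q n) sh l.
Proof.
have := @nsq_cvg _ _ _ Q vre vim (fun n => (m n)^-1 - 1) bmf_vre bmf_vim.
have avgE (f : nat -> RZ R -> R) : (forall a, bmf (f a)) ->
    (forall a x, f a x = f 0%N (iter a (@shiftZ R) x)) -> Ex (Q 0%N) (f 0%N) = 0 ->
    ces (xcorr (Q 0%N) f f) @ \oo --> (0 : R).
  move=> bf fE Ef; have := mean_ergodic (Q_stat 0%N) Q_erg (bf 0%N) Ef.
  apply: cvg_trans; apply: near_eq_cvg; apply: nearW => L.
  rewrite ces_xcorrE//; apply: eq_Ex => x; rewrite /avg /bsum; congr ((_ / _) ^+ 2).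
  by apply: eq_bigr => a _.
move=> /(_ _ v_sqr Ex_vre) h.
have : ces (fun a b => cre (Q n) (vre n) (vim n) a b ^+ 2 +
    cim (Q n) (vre n) (vim n) a b ^+ 2) @ \oo --> (0 : R).
  apply: h.
  - by move=> k; rewrite subr_ge0 invf_ge1// ch2_le1.
  - move=> k; rewrite m_root; have m0 : m k.+1 != 0 by rewrite gt_eqF.
    by field.
  - move=> k a b; rewrite !cre_v cim_v /defre /defim m_root (ch_root k _).1.
    have m0 : m k.+1 != 0 by rewrite gt_eqF.
    by field.
  - move=> k a b; rewrite cre_v !cim_v /defre /defim m_root (ch_root k _).2.
    have m0 : m k.+1 != 0 by rewrite gt_eqF.
    by field.
  - rewrite (_ : ces _ = fun L => ces (xcorr (Q 0%N) (vre 0%N) (vre 0%N)) L +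
        ces (xcorr (Q 0%N) (vim 0%N) (vim 0%N)) L); last by apply/funext => L; rewrite cesD.
    rewrite -[X in _ --> X](addr0 0).
    apply: cvgD; apply: avgE; [exact: bmf_vre| |exact: Ex_vre|exact: bmf_vim| |exact: Ex_vim].
      by move=> a x; rewrite /vre ev_iter.
    by move=> a x; rewrite /vim ev_iter.
rewrite /wmix (_ : (fun a b => defre (Q n) sh l a b ^+ 2 + _) = (fun a b =>
  cre (Q n) (vre n) (vim n) a b ^+ 2 + cim (Q n) (vre n) (vim n) a b ^+ 2))//.
by apply/funext => a; apply/funext => b; rewrite cre_v cim_v.
Qed.

End roots_weak_mixing.

(** * Projective limits *)

Lemma probI1 {R : realType} {d} {T : measurableType d} (P : probability T R) (A D : set T) :
  measurable A -> measurable D -> P D = 1%E -> P A = P (A `&` D).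
Proof.
move=> mA mD PD; suff PD0 : P (A `\` D) = 0%E.
  by transitivity (P (A `\` D) + P (A `&` D))%E; [exact: measureDI|rewrite PD0 add0e].
apply: subset_measure0 (_ : A `\` D `<=` ~` D) _ => //.
- exact: measurableD.
- exact: measurableC.
- by have hC := probability_setC P mD; rewrite PD subee// in hC; exact: hC.
Qed.

Section interval_splitting.
Context {R : realType}.

Definition unif : probability (measurableTypeR R) R := uniform_prob (@ltr01 R).

Lemma unif_itv (c e : R) : 0 <= c -> c <= e -> e <= 1 -> unif `[c, e[%classic = (e - c)%:E.
Proof.
move=> c0 ce e1; rewrite /unif/= /uniform_prob.
rewrite (eq_integral (fun=> 1%:E)); last first.
  move=> x; rewrite inE/= in_itv/= /uniform_pdf => /andP[cx xe].
  rewrite ifT ?subr0 ?invr1//; apply/andP; split; first exact: le_trans cx.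
  exact: ltW (lt_le_trans xe e1).
rewrite integral_cst//= mul1e lebesgue_measure_itv/= lte_fin EFinB.
case: ltP => [//|ec]; have -> : e = c by apply/eqP; rewrite eq_le ce ec.
by rewrite subee.
Qed.

(* Bit strings are read from the most recent bit. *)
Variable w : seq bool -> R.
Hypotheses (w0 : forall t, 0 <= w t) (w1 : w [::] = 1)
  (wD : forall t, w t = w (false :: t) + w (true :: t)).

(* The weights cut [0, 1) into nested intervals: lo t is the left end of the interval of
   length w t, and pre n u is the string of length n whose interval contains u. *)
Fixpoint lo (t : seq bool) : R :=
  if t is b :: t' then lo t' + (if b then w (false :: t') else 0) else 0.

Fixpoint pre n (u : R) : seq bool :=
  if n is n'.+1 then (lo (pre n' u) + w (false :: pre n' u) <= u) :: pre n' u else [::].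

Lemma size_pre n u : size (pre n u) = n.
Proof. by elim: n => //= n ->. Qed.

Lemma lo_bounds t : 0 <= lo t /\ lo t + w t <= 1.
Proof.
elim: t => [|b t [h0 h1]] /=; first by rewrite add0r w1.
have := w0 (false :: t); have := w0 (true :: t); have := wD t.
by case: b; move=> e p1 p2; split; lra.
Qed.

Lemma pre_in n (u : R) : 0 <= u < 1 -> lo (pre n u) <= u < lo (pre n u) + w (pre n u).
Proof.
move=> u01; elim: n => [|n /andP[h0 h1]] /=; first by rewrite add0r w1.
have := wD (pre n u); case: (leP (lo (pre n u) + w (false :: pre n u)) u) => h e; apply/andP; split => //; lra.
Qed.

Lemma pre_eq t (u : R) : lo t <= u < lo t + w t -> pre (size t) u = t.
Proof.
elim: t => [//|b t IH] /= /andP[h0 h1].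
have := w0 (false :: t); have := w0 (true :: t); have := wD t => e p1 p2.
rewrite IH; last by apply/andP; split; case: b h0 h1 => h0 h1; lra.
congr (_ :: _); case: b h0 h1 => h0 h1; first exact: h0.
by apply/negbTE; rewrite -ltNge; lra.
Qed.

Lemma measurable_pre n t : measurable [set u | pre n u = t].
Proof.
elim: n t => [|n IH] t.
  case: t => [|b t]; first by rewrite (_ : [set _ | _] = setT) //; apply/seteqP.
  by rewrite (_ : [set _ | _] = set0) //; apply/seteqP; split.
case: t => [|b t]; first by rewrite (_ : [set _ | _] = set0) //; apply/seteqP; split.
have -> : [set u | pre n.+1 u = b :: t] = [set u | pre n u = t] `&`
    [set u | (lo t + w (false :: t) <= u) = b].
  apply/seteqP; split => u /=; first by move=> [e1 e2]; rewrite e2 in e1.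
  by move=> [-> ->].
apply: measurableI => //; case: b.
  rewrite (_ : [set _ | _] = `[lo t + w (false :: t), +oo[%classic) //.
  by apply/seteqP; split => u /=; rewrite in_itv/= andbT.
rewrite (_ : [set _ | _] = `]-oo, lo t + w (false :: t)[%classic) //.
apply/seteqP; split => u /=; rewrite in_itv/=; first by rewrite ltNge => ->.
by rewrite ltNge => /negbTE.
Qed.

Lemma unif_pre t : unif [set u | pre (size t) u = t] = (w t)%:E.
Proof.
have h01 : unif `[0, 1[%classic = 1%E by rewrite unif_itv// subr0.
rewrite (@probI1 _ _ _ unif _ _ (measurable_pre _ _) _ h01)//.
have [l0 l1] := lo_bounds t.
have -> : [set u | pre (size t) u = t] `&` `[0, 1[%classic = `[lo t, lo t + w t[%classic.
  apply/seteqP; split => u /=; rewrite !in_itv/=.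
    by move=> [e u01]; have := pre_in (size t) u01; rewrite e.
  move=> h; split; first exact: pre_eq.
  by move: h => /andP[h1 h2]; apply/andP; split; lra.
rewrite unif_itv//; first by rewrite addrAC subrr add0r.
by rewrite lerDl.
Qed.

End interval_splitting.

Section kolmogorov.
Context {R : realType} {J : countType}.
Variable lv : J -> nat.

(* erases the coordinates of level larger than n *)
Definition tr n (x : RJ J R) : RJ J R := fun j => if (lv j <= n)%N then x j else 0.

Lemma measurable_tr n : measurable_fun setT (tr n).
Proof.
apply: measurable_RJ => j; have [jn|jn] := boolP (lv j <= n)%N.
  rewrite (_ : (fun x => _) = fun x : RJ J R => x j); first exact: measurable_coord.
  by apply/funext => x; rewrite /tr jn.
rewrite (_ : (fun x => _) = fun _ : RJ J R => 0); first exact: measurable_cst.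
by apply/funext => x; rewrite /tr (negbTE jn).
Qed.

Lemma trK m n x : (m <= n)%N -> tr m (tr n x) = tr m x.
Proof.
move=> mn; apply/funext => j; rewrite /tr; case: ifP => // jm.
by rewrite (leq_trans jm mn).
Qed.

Variable L : nat -> probability (RJ J R) R.
(* L n is the law that the limit has at the levels up to n *)
Hypothesis LE : forall n A, measurable A -> L n.+1 (tr n @^-1` A) = L n A.

Lemma L_tr n k A : measurable A -> (n <= k)%N -> L k (tr n @^-1` A) = L n (tr n @^-1` A).
Proof.
move=> mA /subnK <-; elim: (k - n)%N => [//|i IH]; rewrite addSn -IH.
have -> : tr n @^-1` A = tr (i + n) @^-1` (tr n @^-1` A).
  by apply/seteqP; split => x /=; rewrite trK// leq_addl.
rewrite LE; last by rewrite -[X in measurable X]setTI; exact: measurable_tr.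
congr (L _ _); apply/seteqP; by split => x /=; rewrite trK// leq_addl.
Qed.

Lemma LE_tr n A : measurable A -> L n (tr n @^-1` A) = L n A.
Proof. by move=> mA; rewrite -(L_tr mA (leqnSn n)) LE. Qed.

Definition qv (i : nat) : R := if @unpickle rat i is Some q then ratr q else 0.

(* the k-th bit of a point codes one comparison of a coordinate with a rational *)
Definition bit (x : RJ J R) (k : nat) : bool :=
  if @unpickle (J * nat)%type k is Some (j, i) then qv i < x j else false.
Definition blv (k : nat) : nat :=
  if @unpickle (J * nat)%type k is Some (j, _) then lv j else 0%N.
Definition trb n (y : RJ nat R) : RJ nat R := fun k => if (blv k <= n)%N then y k else 0.
Definition bits (x : RJ J R) : RJ nat R := fun k => (bit x k)%:R.

(* the supremum of the rationals that the bits place below the coordinate j *)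
Definition decode (y : RJ nat R) : RJ J R := fun j =>
  fine (esups (fun i => if 0 < y (pickle (j, i)) then (qv i)%:E else -oo%E) 0%N).

Lemma measurable_bit k : measurable [set x | bit x k].
Proof.
rewrite /bit; case: unpickle => [[j i]|]; last first.
  by rewrite (_ : [set _ | _] = set0) //; apply/seteqP; split.
rewrite -[X in measurable X]setTI; apply: measurable_fun_ltr => //.
exact: measurable_coord.
Qed.

Lemma measurable_bits : measurable_fun setT bits.
Proof.
apply: measurable_RJ => k.
have -> : (fun x => bits x k) = \1_[set x | bit x k].
  by apply/funext => x; rewrite indicE /bits; congr (_%:R); case: (bit x k) / boolP => h;
    [rewrite mem_set|rewrite memNset//; apply/negP].
exact: measurable_indic (measurable_bit k).
Qed.

Lemma measurable_trb n : measurable_fun setT (trb n).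
Proof.
apply: measurable_RJ => k; have [kn|kn] := boolP (blv k <= n)%N.
  rewrite (_ : (fun y => _) = fun y : RJ nat R => y k); first exact: measurable_coord.
  by apply/funext => y; rewrite /trb kn.
rewrite (_ : (fun y => _) = fun _ : RJ nat R => 0); first exact: measurable_cst.
by apply/funext => y; rewrite /trb (negbTE kn).
Qed.

Lemma measurable_decode : measurable_fun setT decode.
Proof.
apply: measurable_RJ => j; apply: measurableT_comp => //.
apply: (measurable_fun_esups (f := fun i (y : RJ nat R) =>
  if 0 < y (pickle (j, i)) then (qv i)%:E else -oo%E)) => i.
apply: measurable_fun_ifT => //.
apply: measurable_fun_ltr; first exact: measurable_cst.
exact: measurable_coord.
Qed.

(** A real number is the supremum of the rationals below it. *)
Lemma decode_bits x : decode (bits x) = x.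
Proof.
apply/funext => j; rewrite /decode /esups/=.
set E := ereal_sup _; suff -> : E = (x j)%:E by [].
have lt01 (b : bool) : (0 < (b%:R : R)) = b by case: b; rewrite ?ltr01 ?ltxx.
apply/eqP; rewrite eq_le; apply/andP; split.
  apply: ub_ereal_sup => _ [i _ <-]; rewrite /bits /bit pickleK lt01.
  by case: ifP => h; rewrite ?leNye// lee_fin ltW.
rewrite leNgt; apply/negP => hE.
have [e [hEe ex]] : exists e : R, (E <= e%:E)%E /\ e < x j.
  case: E hE => [e| |] //; first by rewrite lte_fin; exists e.
  by move=> _; exists (x j - 1); rewrite leNye; split => //; lra.
have [q] := rat_in_itvoo ex; rewrite in_itv/= => /andP[eq qx].
have : ((ratr q)%:E <= E)%E.
  apply: ereal_sup_ubound; exists (pickle q) => //.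
  by rewrite /bits /bit pickleK lt01 /qv pickleK qx.
by move=> /le_trans /(_ hEe); rewrite lee_fin leNgt eq.
Qed.

Lemma tr_decode n y : tr n (decode (trb n y)) = tr n (decode y).
Proof.
apply/funext => j; rewrite /tr; case: ifP => // jn; rewrite /decode.
congr (fine (esups _ _)); apply/funext => i; by rewrite /trb /blv pickleK jn.
Qed.

Lemma bit_tr n x k : (blv k <= n)%N -> bit (tr n x) k = bit x k.
Proof. by rewrite /bit /blv; case: unpickle => [[j i]|]//; rewrite /tr => ->. Qed.

(* a level from which the first r bits can be read *)
Definition rlv r := (\max_(k < r) blv k)%N.

Lemma blv_rlv k r : (k < r)%N -> (blv k <= rlv r)%N.
Proof. by move=> kr; exact: (@leq_bigmax _ (fun k : 'I_r => blv k) (Ordinal kr)). Qed.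

Fixpoint prex r (x : RJ J R) : seq bool :=
  if r is r'.+1 then bit x r' :: prex r' x else [::].

Lemma size_prex r x : size (prex r x) = r.
Proof. by elim: r => //= r ->. Qed.

Lemma prex_tr r n x : (rlv r <= n)%N -> prex r (tr n x) = prex r x.
Proof.
elim: r => [//|r IH] h /=; rewrite bit_tr; last by apply: leq_trans h; exact: blv_rlv.
rewrite IH//; apply: leq_trans h; rewrite /rlv big_ord_recr/=; exact: leq_maxl.
Qed.

Lemma measurable_prex r t : measurable [set x | prex r x = t].
Proof.
elim: r t => [|r IH] t.
  case: t => [|b t]; first by rewrite (_ : [set _ | _] = setT) //; apply/seteqP.
  by rewrite (_ : [set _ | _] = set0) //; apply/seteqP; split.
case: t => [|b t]; first by rewrite (_ : [set _ | _] = set0) //; apply/seteqP; split.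
have -> : [set x | prex r.+1 x = b :: t] = [set x | bit x r = b] `&` [set x | prex r x = t].
  by apply/seteqP; split => x /= [-> ->].
apply: measurableI => //; case: b; first exact: measurable_bit.
rewrite (_ : [set _ | _] = ~` [set x | bit x r]); first by apply: measurableC; exact: measurable_bit.
by apply/seteqP; split => x /=; [move=> ->|move=> /negP /negbTE].
Qed.

Lemma L_prex r n t : (rlv r <= n)%N ->
  L n [set x | prex r x = t] = L (rlv r) [set x | prex r x = t].
Proof.
move=> rn; have e : [set x | prex r x = t] = tr (rlv r) @^-1` [set x | prex r x = t].
  by apply/seteqP; split => x /=; rewrite prex_tr.
by rewrite e L_tr//; exact: measurable_prex.
Qed.

(* the probability of a string of bits *)
Definition wt (t : seq bool) : R := fine (L (rlv (size t)) [set x | prex (size t) x = t]).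

Lemma wt_ge0 t : 0 <= wt t.
Proof. by rewrite fine_ge0. Qed.

Lemma wt_nil : wt [::] = 1.
Proof.
rewrite /wt (_ : [set _ | _] = setT); last by apply/seteqP.
by rewrite probability_setT.
Qed.

Lemma wt_add t : wt t = wt (false :: t) + wt (true :: t).
Proof.
rewrite /wt/=; set r := size t.
rewrite -(@L_prex r (rlv r.+1)); last by rewrite /rlv big_ord_recr leq_maxl.
rewrite -fineD ?fin_num_measure//; try exact: measurable_prex (r.+1) _.
rewrite -measureU.
- congr (fine (L _ _)); apply/seteqP; split => x /=.
    by move=> ->; case: (bit x r); [right|left].
  by move=> [[_ ->]|[_ ->]].
- exact: (@measurable_prex r.+1).
- exact: (@measurable_prex r.+1).
- by apply/seteqP; split => x //= [[-> _] [/eqP]].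
Qed.

Notation pre := (pre wt).

Lemma Ex_seq_bool {d} {T : measurableType d} (M : probability T R) r (g : T -> seq bool)
    (f : seq bool -> R) :
  (forall t, measurable [set x | g x = t]) -> (forall x, size (g x) = r) ->
  Ex M (fun x => f (g x)) = \sum_(t : r.-tuple bool) f t * fine (M [set x | g x = t]).
Proof.
move=> mg sg.
rewrite (eq_bigr (fun t : r.-tuple bool => Ex M (fun x => f t * \1_[set x | g x = t] x))); last first.
  by move=> t _; rewrite ExZ ?Ex_indic//; exact: bmf_indic.
rewrite -(@Ex_sum _ _ _ M _ _ _ (fun (t : r.-tuple bool) x => f t * \1_[set x | g x = t] x)); last first.
  by move=> t; apply: bmfZ; apply: bmf_indic.
apply: eq_Ex => x; have /eqP sx := sg x.
rewrite (bigD1 (Tuple sx))//= indicE mem_set// mulr1 big1 ?addr0// => t tx.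
rewrite indicE memNset ?mulr0//= => e; move/eqP: tx; apply.
by apply: val_inj; rewrite /= e.
Qed.

Lemma Ex_pre r (f : seq bool -> R) :
  Ex unif (fun u => f (pre r u)) = Ex (L (rlv r)) (fun x => f (prex r x)).
Proof.
rewrite (@Ex_seq_bool _ _ _ r)//; [|by move=> t; exact: measurable_pre|exact: size_pre].
rewrite (@Ex_seq_bool _ _ _ r)//; [|by move=> t; exact: measurable_prex|exact: size_prex].
apply: eq_bigr => t _; congr (_ * fine _).
have := unif_pre wt_ge0 wt_nil wt_add t; rewrite size_tuple => ->.
by rewrite /wt size_tuple fineK// fin_num_measure//; exact: measurable_prex.
Qed.

(* the bits of the strings whose intervals contain u *)
Definition ubits (u : R) : RJ nat R := fun k => (head false (pre k.+1 u))%:R.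

(* the k-th bit of a string that is read from its end *)
Definition kbit (t : seq bool) k : R := (nth false t (size t - k.+1))%:R.

Lemma ubits_pre r k u : (k < r)%N -> ubits u k = kbit (pre r u) k.
Proof.
move=> kr; rewrite /ubits /kbit size_pre; congr (_%:R); congr nat_of_bool.
elim: r kr => [//|r IH]; rewrite ltnS leq_eqVlt => /orP[/eqP->|kr].
  by rewrite subnn.
by rewrite subSS -subnSK// IH.
Qed.

Lemma bits_prex r k x : (k < r)%N -> bits x k = kbit (prex r x) k.
Proof.
move=> kr; rewrite /bits /kbit size_prex; congr (_%:R); congr nat_of_bool.
elim: r kr => [//|r IH]; rewrite ltnS leq_eqVlt => /orP[/eqP->|kr].
  by rewrite subnn.
by rewrite subSS -subnSK// IH.
Qed.

Lemma measurable_ubits : measurable_fun setT ubits.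
Proof.
apply: measurable_RJ => k.
have mD : measurable [set u | head false (pre k.+1 u)].
  have -> : [set u | head false (pre k.+1 u)] =
      \bigcup_i (if @unpickle (seq bool) i is Some t then
         (if head false t then [set u | pre k.+1 u = t] else set0) else set0).
    apply/seteqP; split => u.
      by move=> h; exists (pickle (pre k.+1 u)) => //; rewrite pickleK ifT.
    by move=> [i _]; case: unpickle => [t|]//; case: ifP => // h /= e; rewrite -e in h.
  apply: bigcupT_measurable => i; case: ifP => _; last exact: measurable0.
  exact: measurable_pre.
have -> : (fun u => ubits u k) = \1_[set u | head false (pre k.+1 u)].
  by apply/funext => u; rewrite indicE /ubits; congr (_%:R);
    case: (head _ _) / boolP => h; [rewrite mem_set|rewrite memNset//; apply/negP].
exact: measurable_indic.
Qed.

Lemma Ex_L_tr n k (f : RJ J R -> R) : bmf f -> (forall x, f (tr n x) = f x) -> (n <= k)%N ->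
  Ex (L k) f = Ex (L n) f.
Proof.
move=> bf ft nk.
have e i : Ex (L i) f = Ex (law (L i) (measurable_tr n)) f.
  by rewrite Ex_law//; apply: eq_Ex => x; rewrite ft.
by rewrite !e; apply: eq_Ex_measure => A mA; exact: L_tr.
Qed.

Lemma bits_tr n x : trb n (bits (tr n x)) = trb n (bits x).
Proof. by apply/funext => k; rewrite /trb; case: ifP => // h; rewrite /bits bit_tr. Qed.

Lemma Ex_trig n (l : lform R nat) (g : R -> R) :
  measurable_fun setT g -> (forall z, `|g z| <= 1) ->
  Ex unif (fun u => g (ev l (trb n (ubits u)))) =
  Ex (L n) (fun x => g (ev l (trb n (bits x)))).
Proof.
move=> mg g1; pose r := (\max_(p <- l) p.1.+1)%N.
have lr p : p \in l -> (p.1 < r)%N by move=> pl; exact: (@leq_bigmax_seq _ _ xpredT (fun p => p.1.+1)).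
pose f t := g (ev l (trb n (kbit t))).
have ext (y z : RJ nat R) : (forall k, (k < r)%N -> y k = z k) -> ev l (trb n y) = ev l (trb n z).
  move=> yz; rewrite /ev big_seq [RHS]big_seq; apply: eq_bigr => p pl.
  by rewrite /trb yz// lr.
have bF : bmf (fun x => g (ev l (trb n (bits x)))).
  split; last by exists 1.
  apply: (measurableT_comp mg); apply: (measurableT_comp (measurable_ev l)).
  exact: (measurableT_comp (measurable_trb n) measurable_bits).
have e1 : Ex unif (fun u => g (ev l (trb n (ubits u)))) = Ex unif (fun u => f (pre r u)).
  by apply: eq_Ex => u; congr (g _); apply: ext => k kr; exact: ubits_pre.
have e2 x : f (prex r x) = g (ev l (trb n (bits x))).
  by congr (g _); apply: ext => k kr; rewrite -bits_prex.
rewrite e1 Ex_pre; under eq_Ex do rewrite e2.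
rewrite -(@Ex_L_tr n (maxn n (rlv r)))//; [|by move=> x; rewrite bits_tr|exact: leq_maxl].
rewrite -(@Ex_L_tr (rlv r) (maxn n (rlv r)))//; last exact: leq_maxr.
by move=> x; rewrite -!e2 prex_tr.
Qed.

(** Finitely many bits at a time, a uniform random variable in [0, 1) is turned
    into a sequence of bits with the prescribed finite-dimensional laws; decoding
    them gives the limit measure. *)
Theorem kolmogorov_extension : exists M : probability (RJ J R) R,
  forall n A, measurable A -> M (tr n @^-1` A) = L n A.
Proof.
have mdu : measurable_fun setT (decode \o ubits).
  exact: measurableT_comp measurable_decode measurable_ubits.
exists (law unif mdu) => n A mA.
have mtu : measurable_fun setT (trb n \o ubits).
  exact: measurableT_comp (measurable_trb n) measurable_ubits.
have mtb : measurable_fun setT (trb n \o bits).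
  exact: measurableT_comp (measurable_trb n) measurable_bits.
have eqB : forall B, measurable B -> law unif mtu B = law (L n) mtb B.
  apply: char_unique => l.
  - rewrite !Ex_law; [|exact: bmf_cosev..]; apply: (@Ex_trig n l cos).
      by apply: continuous_measurable_fun; exact: continuous_cos.
    by move=> z; rewrite ler_norml cos_geN1 cos_le1.
  - rewrite !Ex_law; [|exact: bmf_sinev..]; apply: (@Ex_trig n l sin).
      by apply: continuous_measurable_fun; exact: continuous_sin.
    by move=> z; rewrite ler_norml sin_geN1 sin_le1.
have mB : measurable ((tr n \o decode) @^-1` A).
  rewrite -[X in measurable X]setTI.
  exact: (measurableT_comp (measurable_tr n) measurable_decode).
have e : unif ((trb n \o ubits) @^-1` ((tr n \o decode) @^-1` A)) =
  L n ((trb n \o bits) @^-1` ((tr n \o decode) @^-1` A)) := eqB _ mB.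
rewrite -[LHS]/(unif ((decode \o ubits) @^-1` (tr n @^-1` A))) -[RHS]LE_tr//.
transitivity (unif ((trb n \o ubits) @^-1` ((tr n \o decode) @^-1` A))).
  by congr (unif _); apply/seteqP; split => u /=; rewrite tr_decode.
rewrite e; congr (L n _); apply/seteqP; split => x /=; by rewrite tr_decode decode_bits.
Qed.

(** Every linear functional factors through a truncation. *)
Lemma tr_unique (M M' : probability (RJ J R) R) :
  (forall n A, measurable A -> M (tr n @^-1` A) = M' (tr n @^-1` A)) ->
  forall A, measurable A -> M A = M' A.
Proof.
move=> h; pose lvl (l : lform R J) := (\max_(p <- l) lv p.1)%N.
have hl (l : lform R J) x : ev l (tr (lvl l) x) = ev l x.
  rewrite /ev big_seq [RHS]big_seq; apply: eq_bigr => p pl.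
  by rewrite /tr ifT//; exact: (@leq_bigmax_seq _ _ xpredT (fun p => lv p.1)).
have key (f : RJ J R -> R) n : bmf f -> (forall x, f (tr n x) = f x) -> Ex M f = Ex M' f.
  move=> bf ft.
  have e (N : probability (RJ J R) R) : Ex N f = Ex (law N (measurable_tr n)) f.
    by rewrite Ex_law//; apply: eq_Ex => x; rewrite ft.
  by rewrite (e M) (e M'); apply: eq_Ex_measure => A mA; exact: h.
apply: char_unique => l; apply: (key _ (lvl l)).
- exact: bmf_cosev.
- by move=> x; rewrite hl.
- exact: bmf_sinev.
- by move=> x; rewrite hl.
Qed.

End kolmogorov.

(** * The dyadic tree of convolution roots *)

Section product_maps.
Context {R : realType} {d1 d2 d3 d4} {T1 : measurableType d1} {T2 : measurableType d2}
  {T3 : measurableType d3} {T4 : measurableType d4}.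

Lemma measurable_pairmap (f : T1 -> T3) (g : T2 -> T4) :
  measurable_fun setT f -> measurable_fun setT g ->
  measurable_fun setT (fun z : T1 * T2 => (f z.1, g z.2)).
Proof.
move=> mf mg; apply: measurable_fun_pair.
- exact: measurableT_comp mf measurable_fst.
- exact: measurableT_comp mg measurable_snd.
Qed.

Lemma prodp_map (P : probability T1 R) (Q : probability T2 R)
    (P' : probability T3 R) (Q' : probability T4 R) (f : T1 -> T3) (g : T2 -> T4) :
  measurable_fun setT f -> measurable_fun setT g ->
  (forall A, measurable A -> P (f @^-1` A) = P' A) ->
  (forall A, measurable A -> Q (g @^-1` A) = Q' A) ->
  forall C, measurable C ->
  prodp P Q ((fun z => (f z.1, g z.2)) @^-1` C) = prodp P' Q' C.
Proof.
move=> mf mg hf hg C mC; apply/esym.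
apply: (@prodp_eq _ _ _ _ _ P' Q' (law (prodp P Q) (measurable_pairmap mf mg))) => // A B mA mB.
rewrite lawE (_ : _ @^-1` _ = (f @^-1` A) `*` (g @^-1` B))//.
rewrite prodpE; first by rewrite hf// hg.
- by rewrite -[X in measurable X]setTI; exact: mf.
- by rewrite -[X in measurable X]setTI; exact: mg.
Qed.

End product_maps.

Section tree.
Context {R : realType}.

(* A point of the tree space assigns a real sequence to every binary word. *)
Notation J := (seq bool * int)%type.
Notation X := (RJ J R).

Definition leaf (x : RZ R) : X := fun p => if p.1 is [::] then x p.2 else 0.

(* the tree whose two subtrees are given; its root carries the sum of their roots *)
Definition node (y : X * X) : X := fun p =>
  match p.1 with
  | [::] => y.1 ([::], p.2) + y.2 ([::], p.2)
  | b :: w => (if b then y.2 else y.1) (w, p.2)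
  end.

Definition sub (w : seq bool) (y : X) : X := fun p => y (w ++ p.1, p.2).
Definition root_of (y : X) : RZ R := fun i => y ([::], i).
Definition tshift (y : X) : X := fun p => y (p.1, p.2 + 1).
Definition tunshift (y : X) : X := fun p => y (p.1, p.2 - 1).

Definition depth (p : J) : nat := size p.1.

Lemma measurable_leaf : measurable_fun setT leaf.
Proof.
apply: measurable_RJ => -[[|b w] i]; last exact: measurable_cst.
exact: (@measurable_coord R int).
Qed.

Lemma measurable_node : measurable_fun setT node.
Proof.
have m1 p : measurable_fun setT (fun y : X * X => y.1 p).
  exact: measurableT_comp (measurable_coord p) measurable_fst.
have m2 p : measurable_fun setT (fun y : X * X => y.2 p).
  exact: measurableT_comp (measurable_coord p) measurable_snd.
apply: measurable_RJ => -[[|[] w] i].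
- exact: measurable_funD (m1 _) (m2 _).
- exact: m2.
- exact: m1.
Qed.

Lemma measurable_sub w : measurable_fun setT (sub w).
Proof. by apply: measurable_RJ => p; exact: measurable_coord. Qed.

Lemma measurable_root_of : measurable_fun setT root_of.
Proof. by apply: (@measurable_RJ R int) => i; exact: measurable_coord. Qed.

Lemma measurable_tshift : measurable_fun setT tshift.
Proof. by apply: measurable_RJ => p; exact: measurable_coord. Qed.

Lemma measurable_tunshift : measurable_fun setT tunshift.
Proof. by apply: measurable_RJ => p; exact: measurable_coord. Qed.

Lemma tshiftK : cancel tshift tunshift.
Proof. by move=> y; apply/funext => -[w i]; rewrite /tunshift /tshift/= subrK. Qed.

Lemma tunshiftK : cancel tunshift tshift.
Proof. by move=> y; apply/funext => -[w i]; rewrite /tunshift /tshift/= addrK. Qed.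

Lemma sub_nil y : sub [::] y = y.
Proof. by apply/funext => -[w i]. Qed.

Lemma sub_cat w w' y : sub w' (sub w y) = sub (w ++ w') y.
Proof. by apply/funext => -[v i]; rewrite /sub/= catA. Qed.

Lemma sub_node b y : sub [:: b] (node y) = if b then y.2 else y.1.
Proof. by apply/funext => -[w i]; case: b. Qed.

Notation trd := (tr (R := R) depth).

Lemma trd_node n y : trd n.+1 (node y) = node (trd n y.1, trd n y.2).
Proof.
apply/funext => -[[|b w] i]; rewrite /tr /node/=; first by [].
by rewrite /depth/= ltnS; case: b.
Qed.

Lemma trd_leaf (x : RZ R * RZ R) : trd 0 (node (leaf x.1, leaf x.2)) = leaf (addZ x).
Proof. by apply/funext => -[[|b w] i]; rewrite /tr /node /leaf. Qed.

Lemma tshift_node y : tshift (node y) = node (tshift y.1, tshift y.2).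
Proof. by apply/funext => -[[|[] w] i]. Qed.

Variable Q : nat -> probability (RZ R) R.
Hypotheses
  (Q_root : forall n A, measurable A -> Q n A = convolution (Q n.+1) (Q n.+1) A)
  (Q_stat : forall n, measure_preserving (Q n) (@shiftZ R)).

(* the law of the tree of height n with root law Q j *)
Fixpoint tlaw n : nat -> probability X R :=
  if n is n'.+1
  then fun j => law (prodp (tlaw n' j.+1) (tlaw n' j.+1)) measurable_node
  else fun j => law (Q j) measurable_leaf.

(** Erasing the last generation merges pairs of leaves of law Q_(k+1) into one of
    law Q_k. *)
Lemma tlaw_tr n j A : measurable A -> tlaw n.+1 j (trd n @^-1` A) = tlaw n j A.
Proof.
elim: n j A => [|n IH] j A mA.
  rewrite -[LHS]/(prodp (law (Q j.+1) measurable_leaf) (law (Q j.+1) measurable_leaf)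
    (node @^-1` (trd 0 @^-1` A))).
  rewrite -(prodp_map (P := Q j.+1) (Q := Q j.+1) measurable_leaf measurable_leaf); last 3 first.
  - by [].
  - by [].
  - by apply: measurable_preimage; [exact: measurable_node|apply: measurable_preimage => //; exact: measurable_tr].
  rewrite -[RHS]/(Q j (leaf @^-1` A)) Q_root; last exact: measurable_preimage measurable_leaf mA.
  rewrite -[RHS]/(prodp (Q j.+1) (Q j.+1) (@addZ R @^-1` (leaf @^-1` A))).
  by congr (prodp _ _ _); apply/seteqP; split => x /=; rewrite trd_leaf.
rewrite -[LHS]/(prodp (tlaw n.+1 j.+1) (tlaw n.+1 j.+1) (node @^-1` (trd n.+1 @^-1` A))).
rewrite -[RHS]/(prodp (tlaw n j.+1) (tlaw n j.+1) (node @^-1` A)).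
rewrite -(prodp_map (@measurable_tr R _ depth n) (@measurable_tr R _ depth n) (IH j.+1) (IH j.+1)); last first.
  exact: measurable_preimage measurable_node mA.
by congr (prodp _ _ _); apply/seteqP; split => y /=; rewrite trd_node.
Qed.

Lemma tlaw_tshift n j A : measurable A -> tlaw n j (tshift @^-1` A) = tlaw n j A.
Proof.
elim: n j A => [|n IH] j A mA.
  rewrite -[LHS]/(Q j (leaf @^-1` (tshift @^-1` A))) -[RHS]/(Q j (leaf @^-1` A)).
  rewrite -[RHS](Q_stat j).2; last exact: measurable_preimage measurable_leaf mA.
  have e x : tshift (leaf x) = leaf (shiftZ x) by apply/funext => -[[|b w] i].
  have -> : leaf @^-1` (tshift @^-1` A) = @shiftZ R @^-1` (leaf @^-1` A).
    by apply/seteqP; split => x /=; rewrite e.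
  by [].
rewrite -[LHS]/(prodp (tlaw n j.+1) (tlaw n j.+1) (node @^-1` (tshift @^-1` A))).
rewrite -[RHS]/(prodp (tlaw n j.+1) (tlaw n j.+1) (node @^-1` A)).
rewrite -[RHS](prodp_map measurable_tshift measurable_tshift (IH j.+1) (IH j.+1)); last first.
  exact: measurable_preimage measurable_node mA.
by congr (prodp _ _ _); apply/seteqP; split => y /=; rewrite tshift_node.
Qed.

(** The limit m j of the laws of finite trees with root law Q j satisfies the same
    branching equation. *)
Theorem tree_measures : exists m : nat -> probability X R,
  [/\ forall j A, measurable A -> m j A = prodp (m j.+1) (m j.+1) (node @^-1` A),
      forall j A, measurable A -> m j (root_of @^-1` A) = Q j A &
      forall j A, measurable A -> m j (tshift @^-1` A) = m j A].
Proof.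
have /choice [m hm] : forall j, exists M : probability X R,
    forall n A, measurable A -> M (trd n @^-1` A) = tlaw n j A.
  by move=> j; apply: kolmogorov_extension => n A mA; exact: tlaw_tr.
exists m; split.
- move=> j A mA.
  rewrite -[RHS]/(law (prodp (m j.+1) (m j.+1)) measurable_node A).
  move: A mA; apply: (@tr_unique _ _ depth).
  suff key n A : measurable A -> m j (trd n.+1 @^-1` A) =
      prodp (m j.+1) (m j.+1) (node @^-1` (trd n.+1 @^-1` A)).
    move=> n A' mA'; have -> : trd n @^-1` A' = trd n.+1 @^-1` (trd n @^-1` A').
      by apply/seteqP; split => y /=; rewrite trK.
    by apply: key; apply: measurable_preimage => //; exact: measurable_tr.
  move=> mA'; rewrite hm//.
  rewrite -[LHS]/(prodp (tlaw n j.+1) (tlaw n j.+1) (node @^-1` A)).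
  rewrite -(prodp_map (@measurable_tr R _ depth n) (@measurable_tr R _ depth n) (hm j.+1 n) (hm j.+1 n)); last first.
    exact: measurable_preimage measurable_node mA'.
  by congr (prodp _ _ _); apply/seteqP; split => y /=; rewrite trd_node.
- move=> j A mA; have -> : root_of @^-1` A = trd 0 @^-1` (root_of @^-1` A) by [].
  by rewrite hm; [|exact: measurable_preimage measurable_root_of mA].
- move=> j A mA.
  rewrite -[LHS]/(law (m j) measurable_tshift A).
  move: A mA; apply: (@tr_unique _ _ depth) => n B mB.
  rewrite hm// -[LHS]/(m j (trd n @^-1` (tshift @^-1` B))) hm; last exact: measurable_preimage measurable_tshift mB.
  exact: tlaw_tshift.
Qed.

End tree.

(** * Ergodicity of the tree *)

Section tree_ergodicity.
Local Open Scope complex_scope.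
Context {R : realType}.
Notation J := (seq bool * int)%type.
Notation X := (RJ J R).
Implicit Types l : lform R J.

(* the functional on the subtree b in the decomposition of l o node *)
Definition child b l : lform R J :=
  flatten [seq match p.1.1 with
               | [::] => [:: p]
               | b' :: w => if b' == b then [:: ((w, p.1.2), p.2)] else [::]
               end | p <- l].

Definition tshift_form l : lform R J := [seq ((p.1.1, p.1.2 + 1), p.2) | p <- l].
Definition root_form l : lform R int := [seq (p.1.2, p.2) | p <- l].
Definition height l : nat := (\max_(p <- l) depth p.1)%N.

Lemma child_cons b p l : child b (p :: l) =
  (match p.1.1 with
   | [::] => [:: p]
   | b' :: w => if b' == b then [:: ((w, p.1.2), p.2)] else [::]
   end) ++ child b l.
Proof. by []. Qed.

Lemma height_cons p l : height (p :: l) = maxn (depth p.1) (height l).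
Proof. by rewrite /height big_cons. Qed.

Lemma height_cat l l' : height (l ++ l') = maxn (height l) (height l').
Proof. by rewrite /height big_cat. Qed.

Lemma child_cat b l l' : child b (l ++ l') = child b l ++ child b l'.
Proof. by rewrite /child map_cat flatten_cat. Qed.

Lemma childZ b t l : child b (lformZ t l) = lformZ t (child b l).
Proof.
elim: l => [//|[[[|b' w] i] a] l IH]; rewrite [lformZ t (_ :: _)]/= !child_cons IH/=.
  by [].
by case: (b' == b).
Qed.

Lemma child_tshift b l : child b (tshift_form l) = tshift_form (child b l).
Proof.
elim: l => [//|[[[|b' w] i] a] l IH]; rewrite [tshift_form (_ :: _)]/= !child_cons IH/=.
  by [].
by case: (b' == b).
Qed.

Lemma child_iter b n l : child b (iter n tshift_form l) = iter n tshift_form (child b l).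
Proof. by elim: n => [//|n IH]; rewrite !iterS child_tshift IH. Qed.

Lemma child_dform b l n k : child b (dform tshift_form l n k) = dform tshift_form (child b l) n k.
Proof. by rewrite /dform child_cat childZ !child_iter. Qed.

Lemma height_child b l : (height (child b l) <= (height l).-1)%N.
Proof.
elim: l => [|[[[|b' w] i] a] l IH]; first by rewrite /height !big_nil.
  by rewrite child_cons height_cat !height_cons/= /height big_nil !max0n.
rewrite child_cons height_cat height_cons/= -/(height l).
have h : (height (child b l) <= (maxn (depth (b' :: w, i)) (height l)).-1)%N.
  by apply: leq_trans IH _; rewrite -!subn1 leq_sub2r// leq_maxr.
rewrite geq_max h andbT; case: (b' == b); last by rewrite /height big_nil.
rewrite /height big_seq1/= /depth/=.
by apply: (@leq_trans (size w).+1.-1) => //; rewrite -!subn1 leq_sub2r// leq_maxl.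
Qed.

Lemma ev_node l (y : X * X) :
  ev l (node y) = ev (child false l) y.1 + ev (child true l) y.2.
Proof.
elim: l => [|[[w i] a] l IH]; first by rewrite !ev_nil addr0.
rewrite ev_cons IH !child_cons !ev_cat.
case: w => [|[] w] /=; rewrite ?(ev_cons, ev_nil)/= /node/=; ring.
Qed.

Lemma ev_tshift l (y : X) : ev l (tshift y) = ev (tshift_form l) y.
Proof. by rewrite /ev big_map. Qed.

Lemma ev_root l (y : X) : height l = 0%N -> ev l y = ev (root_form l) (root_of y).
Proof.
move=> h; rewrite /ev big_map big_seq [RHS]big_seq; apply: eq_bigr => -[[w i] a] pl /=.
suff -> : w = [::] by [].
apply/nilP; rewrite /nilp -leqn0 -h.
rewrite /height; exact: (@leq_bigmax_seq _ l xpredT (fun p : J * R => depth p.1) (w, i, a)).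
Qed.

Lemma root_dform l n k : root_form (dform tshift_form l n k) = dform (@shift_form R) (root_form l) n k.
Proof.
have it i : root_form (iter i tshift_form l) = iter i (@shift_form R) (root_form l).
  by elim: i => [//|i IH]; rewrite !iterS -IH /root_form /tshift_form /shift_form -!map_comp.
by rewrite /dform /root_form map_cat -!it /lformZ -!map_comp.
Qed.

Lemma height_dform l n k : height l = 0%N -> height (dform tshift_form l n k) = 0%N.
Proof.
have hm (f : J * R -> J * R) l' : (forall p, depth (f p).1 = depth p.1) -> height (map f l') = height l'.
  by move=> hf; rewrite /height big_map; apply: eq_bigr => p _; rewrite hf.
have it i : height (iter i tshift_form l) = height l.
  by elim: i => [//|i IH]; rewrite iterS hm.
by move=> h; rewrite /dform height_cat it hm// it h.
Qed.

Variables (Q : nat -> probability (RZ R) R) (m : nat -> probability X R).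
Hypotheses
  (Q_pos : forall n k, 0 < ch2 (Q n) k)
  (Q_mix : forall n k, wmix (Q n) (@shift_form R) k)
  (m_node : forall j A, measurable A -> m j A = prodp (m j.+1) (m j.+1) (node @^-1` A))
  (m_root : forall j A, measurable A -> m j (root_of @^-1` A) = Q j A)
  (m_tshift : forall j A, measurable A -> m j (tshift @^-1` A) = m j A).

Lemma Ex_node j (f : X -> R) : bmf f ->
  Ex (m j) f = Ex (prodp (m j.+1) (m j.+1)) (fun y => f (node y)).
Proof.
move=> bf; rewrite -(Ex_law _ (@measurable_node R) bf); apply: eq_Ex_measure => A mA.
exact: m_node.
Qed.

Lemma Ex_root j (f : RZ R -> R) : bmf f -> Ex (m j) (fun y => f (root_of y)) = Ex (Q j) f.
Proof.
move=> bf; rewrite -(Ex_law _ (@measurable_root_of R) bf); apply: eq_Ex_measure => A mA.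
exact: m_root.
Qed.

Lemma chf_node j l :
  chf (m j) l = chf (m j.+1) (child false l) * chf (m j.+1) (child true l).
Proof.
have [ec es] := Ex_trigD1 (m j.+1) (m j.+1)
  (measurable_ev (child false l)) (measurable_ev (child true l)).
rewrite {1}/chf /chc /chs !Ex_node; [|exact: bmf_sinev|exact: bmf_cosev].
under eq_Ex do rewrite ev_node.
under [X in _ +i* X]eq_Ex do rewrite ev_node.
by rewrite ec es [X in _ +i* X]addrC.
Qed.

Lemma chf_carried_root j l : height l = 0%N -> chf (m j) l = chf (Q j) (root_form l).
Proof.
move=> h; rewrite /chf /chc /chs -!Ex_root; [|exact: bmf_sinev|exact: bmf_cosev].
by congr (_ +i* _); apply: eq_Ex => y; rewrite ev_root.
Qed.

Lemma ch2_node j l :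
  ch2 (m j) l = ch2 (m j.+1) (child false l) * ch2 (m j.+1) (child true l).
Proof.
have := chf_node j l => -[e1 e2]; rewrite {1}/ch2 e1 e2.
by rewrite /ch2 /chc /chs /=; ring.
Qed.

Lemma ch2_carried_root j l : height l = 0%N -> ch2 (m j) l = ch2 (Q j) (root_form l).
Proof. by move=> h; have := chf_carried_root j h => -[e1 e2]; rewrite /ch2 e1 e2. Qed.

(** By induction on the height: the squared modulus at l is the product of those at
    the two children of l. *)
Lemma tree_ch2_gt0 j l : 0 < ch2 (m j) l.
Proof.
move: {2}(height l) (leqnn (height l)) => n; elim: n j l => [|n IH] j l hl.
  by rewrite ch2_carried_root//; apply/eqP; rewrite -leqn0.
have hc b : (height (child b l) <= n)%N.
  by apply: leq_trans (height_child b l) _; rewrite -subn1 leq_subLR.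
by rewrite ch2_node mulr_gt0 ?IH.
Qed.

(** Weak mixing passes to products: the defect of a product is
    c = c0 (1 + c1) + c1, where 1 + c1 is bounded. *)
Lemma tree_wmix j l : wmix (m j) tshift_form l.
Proof.
move: {2}(height l) (leqnn (height l)) => n; elim: n j l => [|n IH] j l hl.
  have h0 : height l = 0%N by apply/eqP; rewrite -leqn0.
  have := Q_mix j (root_form l); rewrite /wmix.
  rewrite (_ : (fun a b => defre (m j) tshift_form l a b ^+ 2 + _) = (fun a b =>
    defre (Q j) (@shift_form R) (root_form l) a b ^+ 2 +
    defim (Q j) (@shift_form R) (root_form l) a b ^+ 2))//.
  apply/funext => a; apply/funext => b.
  have := chf_carried_root j (height_dform a b h0); rewrite root_dform => -[e1 e2].
  by rewrite /defre /defim -ch2_carried_root// e1 e2.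
have hc b : (height (child b l) <= n)%N.
  by apply: leq_trans (height_child b l) _; rewrite -subn1 leq_subLR.
have h0 := IH j.+1 _ (hc false); have h1 := IH j.+1 _ (hc true).
set l0 := child false l in h0; set l1 := child true l in h1.
pose K := (ch2 (m j.+1) l1)^-1 ^+ 2.
have K0 : 0 <= K by rewrite sqr_ge0.
pose N l' a b := defre (m j.+1) tshift_form l' a b ^+ 2 + defim (m j.+1) tshift_form l' a b ^+ 2.
apply: (seq_squeeze (v := fun L => 2 * K * ces (N l0) L + 2 * ces (N l1) L)); last first.
  rewrite -[X in _ --> X](addr0 0) -[X in _ --> X + _](mulr0 (2 * K)) -[X in _ --> _ + X](mulr0 2).
  by apply: cvgD; apply: cvgM => //; exact: cvg_cst.
move=> L; rewrite subr0 ger0_norm; last by apply: ces_ge0 => a b; rewrite addr_ge0// sqr_ge0.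
rewrite -!cesZ -cesD; apply: le_ces => a b.
have := chf_node j (dform tshift_form l a b); rewrite !child_dform -/l0 -/l1 => -[e1 e2].
rewrite /N /defre /defim ch2_node -/l0 -/l1 e1 e2.
have p0 := tree_ch2_gt0 j.+1 l0; have p1 := tree_ch2_gt0 j.+1 l1.
have q1 : chc (m j.+1) (dform tshift_form l1 a b) ^+ 2 +
  chs (m j.+1) (dform tshift_form l1 a b) ^+ 2 <= 1 := ch2_le1 _ _.
move: (chc (m j.+1) (dform _ l0 a b)) (chs (m j.+1) (dform _ l0 a b)) => C0 S0.
move: (chc (m j.+1) (dform _ l1 a b)) (chs (m j.+1) (dform _ l1 a b)) q1 => C1 S1 q1.
rewrite /K; move: (ch2 (m j.+1) l0) (ch2 (m j.+1) l1) p0 p1 => M0 M1 p0 p1.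
have n0 : M0 != 0 by rewrite gt_eqF.
have n1 : M1 != 0 by rewrite gt_eqF.
pose x0 := C0 / M0; pose y0 := S0 / M0; pose x1 := C1 / M1; pose y1 := S1 / M1.
have -> : (C0 * C1 - S0 * S1) / (M0 * M1) - 1 = ((x0 - 1) * x1 - y0 * y1) + (x1 - 1).
  by rewrite /x0 /y0 /x1 /y1; field; rewrite n0 n1.
have -> : (C0 * S1 + S0 * C1) / (M0 * M1) = ((x0 - 1) * y1 + y0 * x1) + y1.
  by rewrite /x0 /y0 /x1 /y1; field; rewrite n0 n1.
rewrite -/x0 -/y0 -/x1 -/y1.
have k1 : x1 ^+ 2 + y1 ^+ 2 <= M1^-1 ^+ 2.
  rewrite /x1 /y1 !exprMn -mulrDl -[X in _ <= X]mul1r ler_wpM2r ?sqr_ge0//.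
apply: (@le_trans _ _ (2 * (((x0 - 1) ^+ 2 + y0 ^+ 2) * (x1 ^+ 2 + y1 ^+ 2)) +
  2 * ((x1 - 1) ^+ 2 + y1 ^+ 2))).
  rewrite -subr_ge0.
  rewrite (_ : _ - _ = ((x0 - 1) * x1 - y0 * y1 - (x1 - 1)) ^+ 2 +
    ((x0 - 1) * y1 + y0 * x1 - y1) ^+ 2); last by ring.
  by rewrite addr_ge0// sqr_ge0.
rewrite lerD2r -[X in _ <= X]mulrA ler_pM2l// mulrC ler_wpM2r// addr_ge0// sqr_ge0//.
Qed.

Lemma m_pres j : measure_preserving (m j) tshift.
Proof. by split; [exact: measurable_tshift|exact: m_tshift]. Qed.

Lemma ces_sqr (K : nat -> nat -> R) L : ces K L ^+ 2 <= ces (fun a b => K a b ^+ 2) L.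
Proof.
have : 0 <= ces (fun a b => (K a b - ces K L) ^+ 2) L.
  by apply: ces_ge0 => a b; exact: sqr_ge0.
have -> : ces (fun a b => (K a b - ces K L) ^+ 2) L =
  ces (fun a b => K a b ^+ 2 + (- (2 * ces K L) * K a b + ces K L ^+ 2)) L.
  by apply: eq_ces => a b; ring.
rewrite !cesD cesZ ces_cst; move: (ces K L) => k; rewrite !expr2; lra.
Qed.

Lemma iter_tshift_form n l (y : X) : ev (iter n tshift_form l) y = ev l (iter n tshift y).
Proof. by elim: n y => [//|n IH] y; rewrite iterS -ev_tshift IH -iterSr. Qed.

(** The sum of these second moments is the squared modulus times the Cesaro mean of
    the real defect, and weak mixing makes the latter tend to 0. *)
Lemma avg_trig_cvg j l :
  (fun L => Ex (m j) (fun y => (avg tshift (fun x => cos (ev l x)) L y - chc (m j) l) ^+ 2) +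
            Ex (m j) (fun y => (avg tshift (fun x => sin (ev l x)) L y - chs (m j) l) ^+ 2))
  @ \oo --> (0 : R).
Proof.
pose fc a (y : X) := cos (ev (iter a tshift_form l) y) - chc (m j) l.
pose fs a (y : X) := sin (ev (iter a tshift_form l) y) - chs (m j) l.
have bc a := @bmf_cosev R J (iter a tshift_form l).
have bs a := @bmf_sinev R J (iter a tshift_form l).
have bfc a : bmf (fc a) by apply: bmfB; [exact: bc|exact: bmf_cst].
have bfs a : bmf (fs a) by apply: bmfB; [exact: bs|exact: bmf_cst].
have Ec a : Ex (m j) (fun y => cos (ev (iter a tshift_form l) y)) = chc (m j) l.
  under eq_Ex do rewrite iter_tshift_form.
  by rewrite (Ex_iterS (m_pres j) (f := fun y => cos (ev l y)))//; exact: bmf_cosev.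
have Es a : Ex (m j) (fun y => sin (ev (iter a tshift_form l) y)) = chs (m j) l.
  under eq_Ex do rewrite iter_tshift_form.
  by rewrite (Ex_iterS (m_pres j) (f := fun y => sin (ev l y)))//; exact: bmf_sinev.
have e L : Ex (m j) (fun y => (avg tshift (fun x => cos (ev l x)) L y - chc (m j) l) ^+ 2) +
     Ex (m j) (fun y => (avg tshift (fun x => sin (ev l x)) L y - chs (m j) l) ^+ 2) =
   ch2 (m j) l * ces (defre (m j) tshift_form l) L.
  have av (g : X -> R) (c : R) y : avg tshift g L y - c =
      (\sum_(a < L.+1) (g (iter a tshift y) - c)) / L.+1%:R.
    rewrite sumrB sumr_const card_ord /avg /bsum mulrBl -[c *+ _]mulr_natr mulfK//.
  transitivity (ces (xcorr (m j) fc fc) L + ces (xcorr (m j) fs fs) L).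
    rewrite (ces_xcorrE _ _ bfc) (ces_xcorrE _ _ bfs).
    congr (_ + _); apply: eq_Ex => y; rewrite av; congr ((_ / _) ^+ 2);
      by apply: eq_bigr => a _; rewrite -iter_tshift_form.
  rewrite -cesD -cesZ; apply: eq_ces => a b.
  have bd := @bmf_cosev R J (dform tshift_form l a b).
  rewrite /xcorr -ExD; [|by apply: bmfM|by apply: bmfM].
  rewrite (_ : Ex _ _ = Ex (m j) (fun y => cos (ev (dform tshift_form l a b) y) -
     chc (m j) l * fc a y - chc (m j) l * fc b y - chs (m j) l * fs a y - chs (m j) l * fs b y -
     ch2 (m j) l)).
    have E0c a' : Ex (m j) (fc a') = 0.
      by rewrite /fc ExB; [rewrite Ec Ex_cst subrr|exact: bc|exact: bmf_cst].
    have E0s a' : Ex (m j) (fs a') = 0.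
      by rewrite /fs ExB; [rewrite Es Ex_cst subrr|exact: bs|exact: bmf_cst].
    have f1 := bfc a; have f2 := bfc b; have f3 := bfs a; have f4 := bfs b.
    rewrite !ExB; [|by bmt..]; rewrite !ExZ// !E0c !E0s Ex_cst !mulr0 !subr0.
    rewrite /defre -/(chc (m j) (dform tshift_form l a b)) mulrBr mulr1 mulrCA divff ?mulr1//.
    by rewrite gt_eqF// tree_ch2_gt0.
  apply: eq_Ex => y; rewrite ev_dform cosB /fc /fs /ch2; ring.
apply: (seq_squeeze (v := fun L => ch2 (m j) l * Num.sqrt (ces (fun a b =>
   defre (m j) tshift_form l a b ^+ 2 + defim (m j) tshift_form l a b ^+ 2) L))).
  move=> L; rewrite subr0 e normrM [`|ch2 _ _|]gtr0_norm ?tree_ch2_gt0//.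
  rewrite ler_pM2l ?tree_ch2_gt0// -sqrtr_sqr ler_wsqrtr//.
  apply: le_trans (ces_sqr _ _) _; apply: le_ces => a b; by rewrite lerDl sqr_ge0.
rewrite -[X in _ --> X](mulr0 (ch2 (m j) l)); apply: cvgM; first exact: cvg_cst.
rewrite -[X in _ --> X](@sqrtr0 R).
exact: (cvg_comp _ _ (tree_wmix j l) (@sqrt_continuous R 0)).
Qed.

(** The indicator of an invariant set is uncorrelated with every trigonometric
    function, hence with itself. *)
Theorem tree_ergodic j : ergodic (m j) tshift.
Proof.
move=> A mA invA; have bA := @bmf_indic R _ _ _ mA.
pose H (f : X -> R) := bmf f /\ Ex (m j) (fun x => \1_A x * f x) = Ex (m j) \1_A * Ex (m j) f.
have trig (f : X -> R) (c : R) (v : nat -> R) : bmf f -> Ex (m j) f = c ->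
    (forall L, Ex (m j) (fun y => (avg tshift f L y - c) ^+ 2) <= v L) -> v @ \oo --> (0 : R) -> H f.
  move=> bf Ef hv v0; split => //; rewrite Ef.
  have bAf : bmf (fun x => \1_A x * f x) by bmt.
  have invk k y : \1_A (iter k tshift y) = \1_A y :> R.
    rewrite !indicE; congr (_ %:R); congr nat_of_bool; elim: k y => [//|k IH] y.
    rewrite iterSr IH; apply/idP/idP; rewrite !inE; first by rewrite -{2}invA.
    by rewrite -{1}invA.
  have E1 L : Ex (m j) (fun x => \1_A x * avg tshift f L x) = Ex (m j) (fun x => \1_A x * f x).
    rewrite (_ : Ex _ _ = Ex (m j) (fun x => avg tshift (fun x => \1_A x * f x) L x)); last first.
      apply: eq_Ex => x; rewrite /avg /bsum mulrA; congr (_ / _); rewrite mulr_sumr.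
      by apply: eq_bigr => k _; rewrite invk.
    rewrite /avg /bsum ExZr; last first.
      by apply: bmf_sum => k; exact: (bmf_iterS (m_pres j) k bAf).
    rewrite Ex_sum; last by move=> k; exact: (bmf_iterS (m_pres j) k bAf).
    rewrite (eq_bigr (fun=> Ex (m j) (fun x => \1_A x * f x))); last first.
      by move=> k _; rewrite (Ex_iterS (m_pres j) k bAf).
    by rewrite sumr_const card_ord -[_ *+ _]mulr_natr mulfK// pnatr_eq0.
  have h L : (Ex (m j) (fun x => \1_A x * f x) - Ex (m j) \1_A * c) ^+ 2 <=
      Ex (m j) (fun x => \1_A x ^+ 2) * v L.
    have bav := bmf_avg (m_pres j) L bf.
    rewrite -(E1 L) -ExZr// -ExB; [|by bmt..].
    have bg : bmf (fun y => avg tshift f L y - c) by bmt.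
    rewrite (_ : Ex _ _ = Ex (m j) (fun x => \1_A x * (avg tshift f L x - c))); last first.
      by apply: eq_Ex => x; rewrite mulrBr.
    apply: le_trans (Ex_CS _ bA bg) _; rewrite ler_wpM2l//.
    by apply: Ex_ge0 => x; exact: sqr_ge0.
  apply/eqP; rewrite -subr_eq0 -sqrf_eq0 eq_le sqr_ge0 andbT.
  have vc : (fun L => Ex (m j) (fun x => \1_A x ^+ 2) * v L) @ \oo --> (0 : R).
    by rewrite -[X in _ --> X](mulr0 (Ex (m j) (fun x => \1_A x ^+ 2))); apply: cvgM => //; exact: cvg_cst.
  have /cvg_lim <- // := vc; apply: limr_ge; first exact: cvgP vc.
  exact: nearW.
have hH : fourier_closed H.
  split=> [l|l|f g [bf ef] [bg eg]|r f [bf ef]|f_ f C hf hC cf].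
  - apply: (trig _ (chc (m j) l) _ _ _ _ (avg_trig_cvg j l)) => //; first exact: bmf_cosev.
    by move=> L; rewrite lerDl; apply: Ex_ge0 => y; exact: sqr_ge0.
  - apply: (trig _ (chs (m j) l) _ _ _ _ (avg_trig_cvg j l)) => //; first exact: bmf_sinev.
    by move=> L; rewrite lerDr; apply: Ex_ge0 => y; exact: sqr_ge0.
  - split; first exact: bmfD.
    under eq_Ex do rewrite mulrDr.
    by rewrite !ExD ?ef ?eg ?mulrDr//; bmt.
  - split; first exact: bmfZ.
    under eq_Ex do rewrite mulrCA.
    by rewrite (ExZ _ r (bmfM bA bf)) (ExZ _ r bf) ef mulrCA.
  - have bf := bmf_lim (fun n => (hf n).1) hC cf; split => //.
    have c1 := Ex_cvg (P := m j) (fun n => (hf n).1) hC cf.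
    have c2 : (fun n => Ex (m j) (fun x => \1_A x * f_ n x)) @ \oo --> Ex (m j) (fun x => \1_A x * f x).
      apply: (@Ex_cvg _ _ _ (m j) (fun n x => \1_A x * f_ n x) _ C).
      + by move=> n; have [bn _] := hf n; bmt.
      + move=> n x; rewrite indicE; case: (_ \in _); rewrite ?mul1r// mul0r normr0.
        exact: le_trans (hC n x).
      + by move=> x; apply: cvgM; [exact: cvg_cst|exact: cf].
    have c3 : (fun n => Ex (m j) (fun x => \1_A x * f_ n x)) @ \oo --> Ex (m j) \1_A * Ex (m j) f.
      rewrite (_ : (fun n => _) = (fun n => Ex (m j) \1_A * Ex (m j) (f_ n))).
        by apply: cvgM => //; exact: cvg_cst.
      by apply/funext => n; exact: (hf n).2.
    exact: (cvg_unique _ c2 c3).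
have [_] := fourier_ind hH bA.
rewrite (_ : Ex _ (fun x => \1_A x * \1_A x) = Ex (m j) \1_A); last first.
  by apply: eq_Ex => x; rewrite indicE; case: (_ \in _); rewrite ?mulr1 ?mulr0.
rewrite Ex_indic// => /eqP; rewrite -subr_eq0 -{1}[fine _]mulr1 -mulrBr mulf_eq0 subr_eq0.
have fA : m j A \is a fin_num by exact: fin_num_measure.
move=> /orP[/eqP h|/eqP h]; [left|right]; first by rewrite -(fineK fA) h.
by rewrite -(fineK fA) -h.
Qed.

End tree_ergodicity.

(** * Conditional expectations along a map *)

Section integrable_tests.
Context {R : realType} {d} {T : measurableType d} (P : probability T R).
Implicit Types f h : T -> R.

Lemma integrable_bmfM f h : P.-integrable setT (EFin \o f) -> bmf h ->
  P.-integrable setT (EFin \o (fun x => f x * h x)).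
Proof.
move=> fi [mh [C hC]]; apply: (integrableMl measurableT fi mh).
exists C; split; first by rewrite num_real.
by move=> y Cy x _ /=; apply: le_trans (ltW Cy).
Qed.

Lemma Ex_dominated (f_ : nat -> T -> R) f (G : T -> R) :
  (forall n, measurable_fun setT (f_ n)) -> measurable_fun setT f ->
  P.-integrable setT (EFin \o G) -> (forall n x, `|f_ n x| <= G x) ->
  (forall x, f_ ^~ x @ \oo --> f x) -> (fun n => Ex P (f_ n)) @ \oo --> Ex P f.
Proof.
move=> mf_ mf iG hG cf.
have [] := @dominated_convergence _ _ _ P setT measurableT
  (fun n x => (f_ n x)%:E) (fun x => (f x)%:E) (EFin \o G).
- by move=> n; apply/measurable_EFinP.
- exact/measurable_EFinP.
- by apply: aeW => x _; apply: cvg_EFin; [exact: nearW | exact: cf].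
- exact: iG.
- by apply: aeW => x n _ /=; rewrite lee_fin.
move=> iF _ h; have e : (\int[P]_x (f x)%:E)%E = (Ex P f)%:E.
  by rewrite /Ex /Rintegral fineK//; exact: integrable_fin_num.
by move: h; rewrite e => /fine_cvgP[].
Qed.

(* f where |f| <= N, and 0 elsewhere *)
Definition clip (f : T -> R) (N : nat) : T -> R := fun x => f x * \1_[set y | `|f y| <= N%:R] x.

Lemma clipE f N x : clip f N x = if `|f x| <= N%:R then f x else 0.
Proof.
rewrite /clip indicE; case: ifPn => h; first by rewrite mem_set// mulr1.
by rewrite memNset ?mulr0//; apply/negP.
Qed.

Lemma bmf_clip f N : measurable_fun setT f -> bmf (clip f N).
Proof.
move=> mf; split.
  apply: measurable_funM => //; apply: measurable_indic.
  rewrite -[X in measurable X]setTI; apply: measurable_fun_ler => //.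
  exact: measurableT_comp.
by exists N%:R => x; rewrite clipE; case: ifP => //; rewrite normr0.
Qed.

Lemma clip_le f N x : `|clip f N x| <= `|f x|.
Proof. by rewrite clipE; case: ifP => //; rewrite normr0. Qed.

Lemma clip_cvg f x : clip f ^~ x @ \oo --> f x.
Proof.
apply: (seq_cvg_eventually (N := Num.bound `|f x|)) => n hn.
rewrite clipE ifT// ltW//; apply: lt_le_trans (archi_boundP (normr_ge0 _)) _.
by rewrite ler_nat.
Qed.

Lemma Ex_clip_cvg f h : P.-integrable setT (EFin \o f) -> bmf h ->
  (fun N => Ex P (fun x => clip f N x * h x)) @ \oo --> Ex P (fun x => f x * h x).
Proof.
move=> fi bh; have mf : measurable_fun setT f by apply/measurable_EFinP; exact: measurable_int fi.
have [mh [C hC]] := bh.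
apply: (@Ex_dominated _ _ (fun x => `|f x| * `|C|)).
- by move=> n; apply: measurable_funM => //; exact: (bmf_clip n mf).1.
- exact: measurable_funM.
- apply: (@integrable_bmfM (fun x => `|f x|) (fun=> `|C|)); last exact: bmf_cst.
  exact: (integrable_abse fi).
- move=> n x; rewrite normrM ler_pM ?clip_le//; apply: le_trans (hC x) _; exact: ler_norm.
- by move=> x; apply: cvgM; [exact: clip_cvg|exact: cvg_cst].
Qed.

(** Monotone convergence along the truncations. *)
Lemma sqr_integral_le f (e : R) : measurable_fun setT f ->
  (forall N, Ex P (fun x => clip f N x ^+ 2) <= e) -> (\int[P]_x (f x ^+ 2)%:E <= e%:E)%E.
Proof.
move=> mf he.
pose F N (x : T) := (clip f N x ^+ 2)%:E.
have mF N : measurable_fun setT (F N).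
  by apply/measurable_EFinP; apply: measurable_funX; exact: (bmf_clip N mf).1.
have lF x : limn (F ^~ x) = (f x ^+ 2)%:E.
  apply/cvg_lim => //; apply: cvg_EFin; first exact: nearW.
  by apply: cvgM; exact: clip_cvg.
have ndF x : setT x -> {homo F ^~ x : a b / (a <= b)%N >-> (a <= b)%E}.
  move=> _ a b ab; rewrite lee_fin !clipE; case: ifP => ha; last by rewrite expr0n sqr_ge0.
  by rewrite ifT// (le_trans ha)// ler_nat.
have F0 N x : setT x -> (0 <= F N x)%E by move=> _; rewrite lee_fin sqr_ge0.
have c := cvg_monotone_convergence (mu := P) measurableT mF F0 ndF.
have -> : (\int[P]_x (f x ^+ 2)%:E)%E = (limn (fun N => \int[P]_x F N x))%E.
  apply/esym/cvg_lim => //; move: c.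
  by rewrite (_ : (fun x => limn (F ^~ x)) = (fun x => (f x ^+ 2)%:E)) //; apply/funext.
apply: lime_le; first by apply: cvgP c.
apply: nearW => N; rewrite /F Ex_EFin ?lee_fin; first exact: he.
by apply: bmfX; exact: bmf_clip.
Qed.

Lemma Lnorm2_cvg0 (g : nat -> T -> R) :
  (forall e : R, 0 < e -> exists n0, forall n, (n0 <= n)%N -> (\int[P]_x (g n x ^+ 2)%:E <= e%:E)%E) ->
  Lnorm P 2%:E (EFin \o g n) @[n --> \oo] --> 0%E.
Proof.
move=> hg.
have L2 n : (Lnorm P 2%:E (EFin \o g n) `^ 2 = \int[P]_x (g n x ^+ 2)%:E)%E.
  rewrite poweR_Lnorm//; apply: eq_integral => x _ /=.
  by rewrite powR_mulrn// -normrX ger0_norm ?sqr_ge0.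
have key (e : R) : 0 < e -> exists n0, forall n, (n0 <= n)%N ->
    (Lnorm P 2%:E (EFin \o g n) <= e%:E)%E.
  move=> e0; have [|n0 h] := hg (e ^+ 2); first by rewrite exprn_gt0.
  exists n0 => n /h; rewrite -L2 => {}h.
  have le : (((Lnorm P 2%:E (EFin \o g n) `^ 2) `^ 2^-1) <= (e ^+ 2)%:E `^ 2^-1)%E.
    by apply: gt0_ler_poweR => //; rewrite in_itv/= ?leey ?poweR_ge0// lee_fin sqr_ge0.
  move: le; rewrite -poweRrM divff// poweRe1 ?Lnorm_ge0// poweR_EFin.
  by rewrite powR12_sqrt ?sqr_ge0// sqrtr_sqr gtr0_norm.
have fL n : (Lnorm P 2%:E (EFin \o g n) <= 1)%E -> Lnorm P 2%:E (EFin \o g n) \is a fin_num.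
  move=> h; rewrite ge0_fin_numE ?Lnorm_ge0//; apply: le_lt_trans h _; exact: ltry.
apply/fine_cvgP; split.
  have [n0 h] := key 1 ltr01; exists n0 => // n /= hn; exact: fL (h n hn).
apply/seq_cvgP => e e0; have [|n0 h] := key (Num.min e 1); first by rewrite lt_min e0 ltr01.
exists n0 => n hn; have := h n hn => hm.
have f1 : Lnorm P 2%:E (EFin \o g n) \is a fin_num.
  by apply: fL; apply: le_trans hm _; rewrite lee_fin ge_min lexx orbT.
rewrite subr0 ger0_norm ?fine_ge0 ?Lnorm_ge0//=.
have -> : e = fine e%:E by [].
rewrite fine_le//; apply: le_trans hm _; by rewrite lee_fin ge_min lexx.
Qed.

End integrable_tests.

Section along_a_map.
Context {R : realType} {d d'} {T : measurableType d} {T' : measurableType d'}.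
Variables (P : probability T R) (s : T -> T') (ms : measurable_fun setT s).

(** Radon-Nikodym for the image under s of the signed measure with density f. *)
Lemma cond_exp_exists (f : T -> R) : P.-integrable setT (EFin \o f) ->
  exists g : T' -> R, (law P ms).-integrable setT (EFin \o g) /\
    forall A, measurable A -> (\int[law P ms]_(x in A) (g x)%:E = \int[P]_(x in s @^-1` A) (f x)%:E)%E.
Proof.
move=> fi.
pose nu : {charge set T' -> \bar R} :=
  measure_function_pushforward__canonical__charge_Charge (induced_charge fi) ms.
have numu : nu `<< law P ms.
  apply/null_content_dominatesP => A mA A0.
  apply: null_set_integral => //; first by rewrite -[X in measurable X]setTI; exact: ms.
  by apply: measurable_funTS; exact: measurable_int fi.
pose G := Radon_Nikodym nu (law P ms).
have GE : EFin \o (fun x => fine (G x)) = G.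
  by apply/funext => x /=; rewrite fineK//; exact: Radon_Nikodym_fin_num.
exists (fun x => fine (G x)); rewrite GE; split; first exact: Radon_Nikodym_integrable.
move=> A mA; rewrite -[RHS]/(nu A) (Radon_Nikodym_integral numu mA).
by apply: eq_integral => x _; rewrite -[LHS]/((EFin \o (fun x => fine (G x))) x) GE.
Qed.

(** The defining identity extends from indicators to bounded functions. *)
Lemma cond_exp_test (f : T -> R) (g : T' -> R) : P.-integrable setT (EFin \o f) ->
  (law P ms).-integrable setT (EFin \o g) ->
  (forall A, measurable A -> (\int[law P ms]_(x in A) (g x)%:E = \int[P]_(x in s @^-1` A) (f x)%:E)%E) ->
  forall h, bmf h -> Ex (law P ms) (fun y => g y * h y) = Ex P (fun x => f x * h (s x)).
Proof.
move=> fi gi fg h bh.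
suff [] : bmf h /\ Ex (law P ms) (fun y => g y * h y) = Ex P (fun x => f x * h (s x)) by [].
move: h bh; apply: bmf_ind => [A mA|h k [bh eh] [bk ek]|r h [bh eh]|h_ h C hh hC ch].
- split; first exact: bmf_indic.
  have e : Rintegral (law P ms) setT (g \_ A) = Rintegral P setT (f \_ (s @^-1` A)).
    by rewrite -(Rintegral_mkcond _ A) -(Rintegral_mkcond _ (s @^-1` A)) /Rintegral (fg A mA).
  rewrite /Ex; transitivity (Rintegral (law P ms) setT (g \_ A)).
    apply: eq_Rintegral => x _; rewrite indicE /patch; case: (x \in A); by rewrite ?mulr1 ?mulr0.
  rewrite e; apply: eq_Rintegral => x _; rewrite indicE /patch.
  have -> : (x \in s @^-1` A) = (s x \in A) by apply/idP/idP; rewrite !inE.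
  by case: ifP => _; rewrite ?mulr1 ?mulr0.
- split; first exact: bmfD.
  have -> : Ex (law P ms) (fun y => g y * (h y + k y)) =
      Ex (law P ms) (fun y => g y * h y + g y * k y) by apply: eq_Ex => y; rewrite mulrDr.
  have -> : Ex P (fun y => f y * (h (s y) + k (s y))) =
      Ex P (fun y => f y * h (s y) + f y * k (s y)) by apply: eq_Ex => y; rewrite mulrDr.
  have i1 := integrable_bmfM gi bh; have i2 := integrable_bmfM gi bk.
  have i3 := integrable_bmfM fi (bmf_comp ms bh); have i4 := integrable_bmfM fi (bmf_comp ms bk).
  rewrite /Ex (RintegralD measurableT i1 i2) (RintegralD measurableT i3 i4).
  by rewrite -!/(Ex _ _) eh ek.
- split; first exact: bmfZ.
  have -> : Ex (law P ms) (fun y => g y * (r * h y)) =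
      Ex (law P ms) (fun y => r * (g y * h y)) by apply: eq_Ex => y; rewrite mulrCA.
  have -> : Ex P (fun y => f y * (r * h (s y))) =
      Ex P (fun y => r * (f y * h (s y))) by apply: eq_Ex => y; rewrite mulrCA.
  have i1 := integrable_bmfM gi bh; have i3 := integrable_bmfM fi (bmf_comp ms bh).
  by rewrite /Ex (RintegralZl r measurableT i1) (RintegralZl r measurableT i3) -!/(Ex _ _) eh.
- have bh := bmf_lim (fun n => (hh n).1) hC ch; split => //.
  have mf : measurable_fun setT f by apply/measurable_EFinP; exact: measurable_int fi.
  have mg : measurable_fun setT g by apply/measurable_EFinP; exact: measurable_int gi.
  have c1 : (fun n => Ex (law P ms) (fun y => g y * h_ n y)) @ \oo --> Ex (law P ms) (fun y => g y * h y).
    apply: (@Ex_dominated _ _ _ _ _ _ (fun x => `|g x| * `|C|)).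
    + by move=> n; apply: measurable_funM => //; exact: (hh n).1.1.
    + by apply: measurable_funM => //; exact: bh.1.
    + apply: (@integrable_bmfM _ _ _ _ (fun x => `|g x|) (fun=> `|C|)); last exact: bmf_cst.
      exact: (integrable_abse gi).
    + move=> n x; rewrite normrM ler_pM//; apply: le_trans (hC n x) _; exact: ler_norm.
    + by move=> x; apply: cvgM; [exact: cvg_cst|exact: ch].
  have c2 : (fun n => Ex P (fun y => f y * h_ n (s y))) @ \oo --> Ex P (fun y => f y * h (s y)).
    apply: (@Ex_dominated _ _ _ _ _ _ (fun x => `|f x| * `|C|)).
    + by move=> n; apply: measurable_funM => //; exact: (bmf_comp ms (hh n).1).1.
    + by apply: measurable_funM => //; exact: (bmf_comp ms bh).1.
    + apply: (@integrable_bmfM _ _ _ _ (fun x => `|f x|) (fun=> `|C|)); last exact: bmf_cst.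
      exact: (integrable_abse fi).
    + move=> n x; rewrite normrM ler_pM//; apply: le_trans (hC n (s x)) _; exact: ler_norm.
    + by move=> x; apply: cvgM; [exact: cvg_cst|exact: ch].
  rewrite (_ : (fun n => _) = (fun n => Ex P (fun y => f y * h_ n (s y)))) in c1.
    exact: (cvg_unique _ c1 c2).
  by apply/funext => n; exact: (hh n).2.
Qed.

(** Testing a conditional expectation against its own truncations bounds its
    second moment by the norm of the functional that it represents. *)
Lemma cond_exp_sqr (f : T -> R) (g : T' -> R) (e : R) : 0 <= e ->
  P.-integrable setT (EFin \o f) -> (law P ms).-integrable setT (EFin \o g) ->
  (forall A, measurable A -> (\int[law P ms]_(x in A) (g x)%:E = \int[P]_(x in s @^-1` A) (f x)%:E)%E) ->
  (forall h, bmf h -> Ex P (fun x => f x * h (s x)) ^+ 2 <= e * Ex (law P ms) (fun y => h y ^+ 2)) ->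
  (\int[P]_x (g (s x) ^+ 2)%:E <= e%:E)%E.
Proof.
move=> e0 fi gi fg hf.
have mg : measurable_fun setT g by apply/measurable_EFinP; exact: measurable_int gi.
have bg N := bmf_clip N mg.
apply: sqr_integral_le => [|N]; first exact: (measurableT_comp mg ms).
rewrite -[X in X <= _](Ex_law P ms (g := fun y => clip g N y ^+ 2)); last exact: bmfX.
have := hf _ (bg N); rewrite -(cond_exp_test fi gi fg (bg N)).
rewrite (_ : Ex _ (fun y => g y * clip g N y) = Ex (law P ms) (fun y => clip g N y ^+ 2)); last first.
  by apply: eq_Ex => y; rewrite clipE; case: ifP => _; rewrite ?expr2 ?mulr0.
have : 0 <= Ex (law P ms) (fun y => clip g N y ^+ 2) by apply: Ex_ge0 => y; exact: sqr_ge0.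
move: (Ex _ _) => v; rewrite le_eqVlt => /predU1P[<-//|v0].
by rewrite expr2 ler_pM2r.
Qed.

End along_a_map.

(** * Deep subtrees are asymptotically independent of everything *)

Section decorrelation.
Context {R : realType}.
Notation J := (seq bool * int)%type.
Notation X := (RJ J R).
Implicit Types l : lform R J.

Lemma sqrD_le (x y : R) : (x + y) ^+ 2 <= 2 * x ^+ 2 + 2 * y ^+ 2.
Proof. by have := sqr_ge0 (x - y); rewrite !expr2; lra. Qed.

Lemma sub_cons_node b w (y : X * X) : sub (b :: w) (node y) = sub w (if b then y.2 else y.1).
Proof. by rewrite -sub_node sub_cat. Qed.

(* the functional that remains on the subtree at w *)
Definition descend (w : seq bool) l : lform R J := foldl (fun k b => child b k) l w.

Lemma height_descend w l : (height (descend w l) <= height l - size w)%N.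
Proof.
elim: w l => [|b w IH] l; first by rewrite subn0.
apply: leq_trans (IH _) _; rewrite /= subnS -subn1 subnAC leq_sub2r//.
by rewrite subn1 height_child.
Qed.

Lemma child_height0 b l : height l = 0%N -> child b l = l.
Proof.
elim: l => [//|[[[|c w] i] a] l IH]; rewrite height_cons.
  by rewrite child_cons /= max0n => /IH ->.
by move=> /eqP; rewrite -leqn0 geq_max.
Qed.

(** Below its height a functional only involves the root, and the decomposition over
    the two subtrees then repeats it unchanged. *)
Lemma descend_stable (eta : nat -> bool) l n : (height l <= n)%N ->
  descend (mkseq eta n) l = descend (mkseq eta (height l)) l.
Proof.
move=> /subnK <-; elim: (n - height l)%N => [//|k IH].
have ms N : mkseq eta N.+1 = rcons (mkseq eta N) (eta N).
  by rewrite /mkseq -[in LHS]addn1 iotaD map_cat cats1.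
rewrite addSn ms /descend foldl_rcons -/(descend _ _) child_height0; first exact: IH.
apply/eqP; rewrite -leqn0; apply: leq_trans (height_descend _ _) _.
by rewrite size_mkseq leqn0 subn_eq0 leq_addl.
Qed.

Variable m : nat -> probability X R.
Hypotheses
  (m_pos : forall j l, 0 < ch2 (m j) l)
  (m_node : forall j A, measurable A -> m j A = prodp (m j.+1) (m j.+1) (node @^-1` A)).

Lemma m_sub j w A : measurable A -> m j (sub w @^-1` A) = m (size w + j)%N A.
Proof.
elim: w j A => [|b w IH] j A mA.
  by congr (m _ _); apply/seteqP; split => y /=; rewrite sub_nil.
have mS : measurable (sub w @^-1` A).
  by rewrite -[X in measurable X]setTI; exact: (measurable_sub w).
have mS' : measurable (sub (b :: w) @^-1` A).
  by rewrite -[X in measurable X]setTI; exact: (measurable_sub (b :: w)).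
rewrite m_node// addSnnS -IH//.
have -> : node @^-1` (sub (b :: w) @^-1` A) =
    (if b then setT else sub w @^-1` A) `*` (if b then sub w @^-1` A else setT).
  apply/seteqP; split => y /=; rewrite sub_cons_node; case: b {mS'} => //=; by [case|].
rewrite prodpE; [|by case: b {mS'}|by case: b {mS'}].
have mT : m j.+1 setT = 1%E := probability_setT (m j.+1).
case: b {mS'}; first by rewrite mT mul1e.
by rewrite mT mule1.
Qed.

Lemma Ex_sub j w (h : X -> R) : bmf h ->
  Ex (m j) (fun y => h (sub w y)) = Ex (m (size w + j)%N) h.
Proof.
move=> bh; rewrite -(Ex_law _ (measurable_sub w) bh); apply: eq_Ex_measure => A mA.
exact: m_sub.
Qed.

(** Cauchy-Schwarz: the variances of cos l and sin l add up to one minus the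
    squared modulus of the characteristic function at l. *)
Lemma trig_decorrelation_base k l (h : X -> R) : bmf h ->
  (Ex (m k) (fun y => cos (ev l y) * h y) - chc (m k) l * Ex (m k) h) ^+ 2 +
  (Ex (m k) (fun y => sin (ev l y) * h y) - chs (m k) l * Ex (m k) h) ^+ 2 <=
  (1 - ch2 (m k) l) * Ex (m k) (fun y => h y ^+ 2).
Proof.
move=> bh; have bc := @bmf_cosev R J l; have bs := @bmf_sinev R J l.
pose u (y : X) := cos (ev l y) - chc (m k) l; pose v (y : X) := sin (ev l y) - chs (m k) l.
have bu : bmf u by rewrite /u; bmt.
have bv : bmf v by rewrite /v; bmt.
have eX : Ex (m k) (fun y => cos (ev l y) * h y) - chc (m k) l * Ex (m k) h =
    Ex (m k) (fun y => u y * h y).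
  rewrite -(ExZ _ _ bh) -ExB; [|by bmt..]; by apply: eq_Ex => y; rewrite /u mulrBl.
have eY : Ex (m k) (fun y => sin (ev l y) * h y) - chs (m k) l * Ex (m k) h =
    Ex (m k) (fun y => v y * h y).
  rewrite -(ExZ _ _ bh) -ExB; [|by bmt..]; by apply: eq_Ex => y; rewrite /v mulrBl.
rewrite eX eY; set a := Ex _ _; set b := Ex _ (fun y => v y * h y).
have euv : Ex (m k) (fun y => u y ^+ 2) + Ex (m k) (fun y => v y ^+ 2) = 1 - ch2 (m k) l.
  rewrite -ExD; [|by bmt..].
  rewrite (_ : Ex _ _ = Ex (m k) (fun y => (1 + ch2 (m k) l) - (2 * chc (m k) l) * cos (ev l y) -
      (2 * chs (m k) l) * sin (ev l y))).
    rewrite !ExB; [|by bmt..]; rewrite (ExZ _ (2 * chc (m k) l) bc) (ExZ _ (2 * chs (m k) l) bs) Ex_cst.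
    rewrite -/(chc (m k) l) -/(chs (m k) l) /ch2; move: (chc _ _) (chs _ _) => c s; ring.
  apply: eq_Ex => y; have := cos2Dsin2 (ev l y); rewrite /u /v /ch2.
  move: (chc _ _) (chs _ _) (cos _) (sin _) => c s C S e.
  transitivity ((C ^+ 2 + S ^+ 2) + (c ^+ 2 + s ^+ 2) - 2 * c * C - 2 * s * S); first by ring.
  by rewrite e.
by rewrite -euv mulrDl; apply: lerD; exact: Ex_CS.
Qed.

(** Conditioning on the subtree at w multiplies the centred trigonometric function
    at w by the characteristic functions of the branches left aside, of modulus
    at most one. *)
Lemma trig_decorrelation j w l (h : X -> R) : bmf h ->
  (Ex (m j) (fun y => cos (ev l y) * h (sub w y)) -
     chc (m j) l * Ex (m (size w + j)%N) h) ^+ 2 +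
  (Ex (m j) (fun y => sin (ev l y) * h (sub w y)) -
     chs (m j) l * Ex (m (size w + j)%N) h) ^+ 2 <=
  (1 - ch2 (m (size w + j)%N) (descend w l)) * Ex (m (size w + j)%N) (fun y => h y ^+ 2).
Proof.
move=> bh; elim: w j l => [|b w IH] j l.
  have -> : Ex (m j) (fun y => cos (ev l y) * h (sub [::] y)) = Ex (m j) (fun y => cos (ev l y) * h y).
    by apply: eq_Ex => y; rewrite sub_nil.
  have -> : Ex (m j) (fun y => sin (ev l y) * h (sub [::] y)) = Ex (m j) (fun y => sin (ev l y) * h y).
    by apply: eq_Ex => y; rewrite sub_nil.
  exact: trig_decorrelation_base.
have {IH} := IH j.+1 (child b l); rewrite -addSnnS => IH.
apply: le_trans IH; rewrite -[(size w).+1]/(size (b :: w)).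
move: (Ex (m (size (b :: w) + j)%N) h) => e.
have bhs := bmf_comp (measurable_sub w) bh.
have eN (t : R -> R) : bmf (fun y : X => t (ev l y)) ->
    Ex (m j) (fun y => t (ev l y) * h (sub (b :: w) y)) =
    Ex (prodp (m j.+1) (m j.+1)) (fun z => t (ev (child b l) z.1 + ev (child (~~ b) l) z.2) *
      h (sub w z.1)).
  move=> bt; have bth := bmfM bt (bmf_comp (measurable_sub (b :: w)) bh).
  rewrite (Ex_node m_node j bth).
  have bn := bmf_comp (@measurable_node R) bth.
  case: b bn {bth} => bn; first rewrite (Ex_prod_swap _ _ bn).
    by apply: eq_Ex => z; rewrite ev_node sub_cons_node addrC.
  by apply: eq_Ex => z; rewrite ev_node sub_cons_node.
rewrite (eN cos (bmf_cosev l)) (eN sin (bmf_sinev l)) {eN}.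
have [-> ->] := Ex_trigD (m j.+1) (m j.+1) (measurable_ev (child b l))
  (measurable_ev (child (~~ b) l)) bhs.
rewrite -/(chc (m j.+1) (child (~~ b) l)) -/(chs (m j.+1) (child (~~ b) l)).
have [-> ->] : chc (m j) l = chc (m j.+1) (child b l) * chc (m j.+1) (child (~~ b) l) -
     chs (m j.+1) (child b l) * chs (m j.+1) (child (~~ b) l) /\
   chs (m j) l = chs (m j.+1) (child b l) * chc (m j.+1) (child (~~ b) l) +
     chc (m j.+1) (child b l) * chs (m j.+1) (child (~~ b) l).
  have := chf_node m_node j l => -[e1 e2]; rewrite {}e1 {}e2; split; case: (b) => /=; ring.
set A := Ex (m j.+1) (fun y => cos _ * _); set B := Ex (m j.+1) (fun y => sin _ * _).
have := ch2_le1 (m j.+1) (child (~~ b) l); rewrite /ch2.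
move: (chc (m j.+1) (child b l)) (chs (m j.+1) (child b l)) => C S.
move: (chc (m j.+1) (child (~~ b) l)) (chs (m j.+1) (child (~~ b) l)) => C1 S1 le1.
rewrite [X in X <= _](_ : _ = ((A - C * e) ^+ 2 + (B - S * e) ^+ 2) * (C1 ^+ 2 + S1 ^+ 2)); last by ring.
by rewrite ler_piMr// addr_ge0// sqr_ge0.
Qed.

(** A functional carried by the root is the sum of two independent copies of itself,
    so its characteristic function is squared at each generation. *)
Lemma ch2_root_cvg l : height l = 0%N -> (fun n => ch2 (m n) l) @ \oo --> (1 : R).
Proof.
move=> h; have sq n : ch2 (m n) l = ch2 (m n.+1) l ^+ 2.
  by rewrite (ch2_node m_node) !child_height0.
have inc n : ch2 (m 0%N) l <= ch2 (m n) l.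
  elim: n => [//|n IH]; apply: le_trans IH _.
  by rewrite sq expr2 ler_piMr ?ch2_ge0 ?ch2_le1.
have p0 := m_pos 0%N l; set c := ch2 (m 0%N) l in inc p0 *.
have c1 : 0 < 1 + c by move: p0; lra.
have geo n : 1 - ch2 (m n) l <= (1 + c)^-1 ^+ n.
  elim: n => [|n IH]; first by rewrite expr0; have := ch2_ge0 (m 0%N) l; lra.
  rewrite exprS -ler_pdivrMl ?invr_gt0// invrK; apply: le_trans IH.
  rewrite (sq n); have := inc n.+1; have := ch2_le1 (m n.+1) l; move: (ch2 (m n.+1) l) => t t1 ct.
  by rewrite (_ : 1 - t ^+ 2 = (1 + t) * (1 - t)); [rewrite ler_wpM2r//; lra|ring].
apply: (seq_squeeze (v := fun n => 1 * (1 + c)^-1 ^+ n)).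
  move=> n; rewrite mul1r distrC ger0_norm ?geo// subr_ge0; exact: ch2_le1.
by apply: seq_cvg_geo; rewrite invr_ge0 ltW//= invf_lt1// ltrDl.
Qed.

Variable eta : nat -> bool.
Notation pre n := (mkseq eta n).

(* The covariances of f with the functions of the subtree at depth n on the branch eta
   are small compared with their second norms. *)
Definition decorrelates (f : X -> R) : Prop := forall e : R, 0 < e ->
  exists n0, forall n, (n0 <= n)%N -> forall h, bmf h ->
  (Ex (m 0%N) (fun y => f y * h (sub (pre n) y)) - Ex (m 0%N) f * Ex (m n) h) ^+ 2 <=
  e * Ex (m n) (fun y => h y ^+ 2).

Let sz n : (size (pre n) + 0)%N = n. Proof. by rewrite addn0 size_mkseq. Qed.

(** Trigonometric functions decorrelate because the remaining functional is eventually
    constant along eta; for a bounded limit the error is controlled by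
    Cauchy-Schwarz. *)
Lemma decorrelates_bmf (f : X -> R) : bmf f -> decorrelates f.
Proof.
move=> bf; suff [] : bmf f /\ decorrelates f by [].
move: f bf; apply: fourier_ind.
have trig l (e : R) : 0 < e -> exists n0, forall n, (n0 <= n)%N -> forall h, bmf h ->
    (Ex (m 0%N) (fun y => cos (ev l y) * h (sub (pre n) y)) - chc (m 0%N) l * Ex (m n) h) ^+ 2 +
    (Ex (m 0%N) (fun y => sin (ev l y) * h (sub (pre n) y)) - chs (m 0%N) l * Ex (m n) h) ^+ 2 <=
    e * Ex (m n) (fun y => h y ^+ 2).
  move=> e0; pose k := descend (pre (height l)) l.
  have hk : height k = 0%N.
    by apply/eqP; rewrite -leqn0 (leq_trans (height_descend _ _))// size_mkseq subnn.
  have /seq_cvgP/(_ _ e0) [n1 h1] := ch2_root_cvg hk.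
  exists (maxn n1 (height l)) => n; rewrite geq_max => /andP[/h1 hn hl] h bh.
  have := trig_decorrelation 0 (pre n) l bh; rewrite sz descend_stable// -/k => t.
  apply: le_trans t _; rewrite ler_wpM2r//; first by apply: Ex_ge0 => y; exact: sqr_ge0.
  by move: hn; rewrite distrC; apply: le_trans; exact: ler_norm.
have E20 n (h : X -> R) : 0 <= Ex (m n) (fun y => h y ^+ 2).
  by apply: Ex_ge0 => y; exact: sqr_ge0.
have bsub n (h : X -> R) : bmf h -> bmf (fun y => h (sub (pre n) y)).
  exact: bmf_comp (measurable_sub _).
split=> [l|l|f g [bf df] [bg dg]|r f [bf df]|f_ f C hf hC cf].
- split; first exact: bmf_cosev.
  move=> e /(trig l)[n0 h0]; exists n0 => n /h0 {}h0 h /h0; apply: le_trans.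
  by rewrite lerDl sqr_ge0.
- split; first exact: bmf_sinev.
  move=> e /(trig l)[n0 h0]; exists n0 => n /h0 {}h0 h /h0; apply: le_trans.
  by rewrite lerDr sqr_ge0.
- split; first exact: bmfD.
  move=> e e0; have e4 : 0 < e / 4 by rewrite divr_gt0.
  have [n1 h1] := df _ e4; have [n2 h2] := dg _ e4.
  exists (maxn n1 n2) => n; rewrite geq_max => /andP[/h1 {}h1 /h2 {}h2] h bh.
  have bhs := bsub n _ bh; have := h1 h bh; have := h2 h bh.
  have -> : Ex (m 0%N) (fun y => (f y + g y) * h (sub (pre n) y)) =
      Ex (m 0%N) (fun y => f y * h (sub (pre n) y)) + Ex (m 0%N) (fun y => g y * h (sub (pre n) y)).
    by rewrite -ExD; [apply: eq_Ex => y; rewrite mulrDl|exact: bmfM..].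
  rewrite (ExD _ bf bg) => i1 i2.
  rewrite mulrDl opprD addrACA; apply: le_trans (sqrD_le _ _) _; move: i1 i2.
  have key (x y v : R) : x <= e / 4 * v -> y <= e / 4 * v -> 2 * y + 2 * x <= e * v by lra.
  exact: key.
- split; first exact: bmfZ.
  move=> e e0; have r0 : 0 < r ^+ 2 + 1 by rewrite ltr_wpDl// sqr_ge0.
  have [n0 h0] := df _ (divr_gt0 e0 r0).
  exists n0 => n /h0 {}h0 h bh; have := h0 h bh; have bhs := bsub n _ bh.
  have -> : Ex (m 0%N) (fun y => r * f y * h (sub (pre n) y)) = r * Ex (m 0%N) (fun y => f y * h (sub (pre n) y)).
    by rewrite -ExZ; [apply: eq_Ex => y; rewrite mulrA|exact: bmfM].
  rewrite (ExZ _ r bf) -mulrA -mulrBr exprMn => i1.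
  apply: le_trans (ler_wpM2l (sqr_ge0 r) i1) _; rewrite mulrA ler_wpM2r//.
  by rewrite mulrCA ler_piMr ?(ltW e0)// ler_pdivrMr// mul1r lerDl.
- have bf := bmf_lim (fun n => (hf n).1) hC cf; split => // e e0.
  have c0 : (fun k => Ex (m 0%N) (fun y => (f_ k y - f y) ^+ 2)) @ \oo --> (0 : R).
    rewrite -[X in _ --> X](Ex_cst (m 0%N)).
    apply: (@Ex_cvg _ _ _ (m 0%N) (fun k y => (f_ k y - f y) ^+ 2) (fun=> 0) ((2 * C) ^+ 2)).
    + by move=> k; have [bk _] := hf k; bmt.
    + move=> k y; have fC : `|f y| <= C.
        have := cvg_norm (cf y); move=> /(_ _) h; have /cvg_lim <- // := h.
        by apply: limr_le; [apply: cvgP h | exact: nearW].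
      rewrite normrX; have := ler_normB (f_ k y) (f y); have := hC k y; have := normr_ge0 (f_ k y - f y).
      move: `|_ - _| `|f_ k y| `|f y| fC => p q r; move=> *; rewrite lerXn2r// ?nnegrE//; lra.
    + move=> y; rewrite -[X in _ --> X](mulr0 (0 : R)).
      have h0 : (fun k => f_ k y - f y) @ \oo --> (0 : R).
        rewrite -(subrr (f y)); apply: cvgB; [exact: cf|exact: cvg_cst].
      by apply: cvgM.
  have e10 : 0 < e / 10 by rewrite divr_gt0.
  have /seq_cvgP/(_ _ e10) [k hk] := c0; have := hk k (leqnn k).
  have [bk dk] := hf k; have [n0 h0] := dk _ e10.
  rewrite subr0 ger0_norm; last by apply: Ex_ge0 => y; exact: sqr_ge0.
  set D := Ex _ _ => De; exists n0 => n /h0 {}h0 h bh; have := h0 h bh; have bhs := bsub n _ bh.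
  have bd : bmf (fun y => f_ k y - f y) by bmt.
  have -> : Ex (m 0%N) (fun y => f_ k y * h (sub (pre n) y)) =
      Ex (m 0%N) (fun y => f y * h (sub (pre n) y)) + Ex (m 0%N) (fun y => (f_ k y - f y) * h (sub (pre n) y)).
    by rewrite -ExD; [apply: eq_Ex => y; ring|exact: bmfM..].
  have -> : Ex (m 0%N) (f_ k) = Ex (m 0%N) f + Ex (m 0%N) (fun y => (f_ k y - f y)).
    by rewrite -ExD; [apply: eq_Ex => y; ring|..].
  have t1 := Ex_CS (m 0%N) bd bhs; have t2 := Ex_CS (m 0%N) bd (bmf_cst 1).
  have t3 := Ex_CS (m n) (bmf_cst 1) bh.
  rewrite -/D in t1 t2.
  rewrite (Ex_sub 0 (pre n) (bmfX 2 bh)) sz in t1.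
  have u2 : Ex (m 0%N) (fun y => f_ k y - f y) ^+ 2 <= D.
    move: t2; under [X in X ^+ 2 <= _]eq_Ex do rewrite mulr1.
    by under [X in _ <= _ * X]eq_Ex do rewrite expr1n; rewrite Ex_cst mulr1.
  have u3 : Ex (m n) h ^+ 2 <= Ex (m n) (fun y => h y ^+ 2).
    move: t3; under [X in X ^+ 2 <= _]eq_Ex do rewrite mul1r.
    by under [X in _ <= X * _]eq_Ex do rewrite expr1n; rewrite Ex_cst mul1r.
  have H0 := E20 n h; have D0 : 0 <= D := E20 0%N _.
  move: (Ex _ _) t1 u2 u3 H0 => a'.
  move: (Ex _ _) (Ex _ _) (Ex _ _) (Ex _ _) (Ex _ _) => b a s b' H t1 u2 u3 H0 i1.
  have v1 : a' ^+ 2 <= e / 10 * H by apply: le_trans t1 _; rewrite ler_wpM2r.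
  have v2 : (b' * s) ^+ 2 <= e / 10 * H.
    by rewrite exprMn; apply: ler_pM; rewrite ?sqr_ge0//; exact: le_trans De.
  have -> : a - b * s = (a + a' - (b + b') * s) + (- a' + b' * s) by ring.
  apply: le_trans (sqrD_le _ _) _; have := sqrD_le (- a') (b' * s); rewrite sqrrN => v3.
  have key (p q r t : R) : p <= e / 10 * H -> q <= e / 10 * H -> r <= e / 10 * H ->
      t <= 2 * q + 2 * r -> 2 * p + 2 * t <= e * H by lra.
  exact: (key _ _ _ _ i1 v1 v2 v3).
Qed.

(** The truncations of f at N and M differ by a function of second moment at most
    E[f^2; |f| > N], which passes to the limit in M. *)
Lemma decorrelates_L2 (f : X -> R) : (m 0%N).-integrable setT (EFin \o f) ->
  (m 0%N).-integrable setT (EFin \o (fun y => f y ^+ 2)) -> Ex (m 0%N) f = 0 ->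
  forall e : R, 0 < e -> exists n0, forall n, (n0 <= n)%N -> forall h, bmf h ->
  Ex (m 0%N) (fun y => f y * h (sub (pre n) y)) ^+ 2 <= e * Ex (m n) (fun y => h y ^+ 2).
Proof.
move=> fi f2i Ef e e0; pose v N := Ex (m 0%N) (fun y => clip f N y ^+ 2).
have mf : measurable_fun setT f by apply/measurable_EFinP; exact: measurable_int fi.
have bclip N := bmf_clip N mf.
have e10 : 0 < e / 10 by rewrite divr_gt0.
have sqr_clip N y : clip f N y ^+ 2 <= f y ^+ 2.
  by rewrite clipE; case: ifP => //; rewrite expr0n sqr_ge0.
have vle N : v N <= Ex (m 0%N) (fun y => f y ^+ 2).
  apply: le_Rintegral => //; exact: bmf_integrable (bmfX 2 (bclip N)).
have vc : v @ \oo --> Ex (m 0%N) (fun y => f y ^+ 2).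
  apply: (Ex_dominated (G := fun y => f y ^+ 2)) => //.
  - by move=> N; exact: (bmfX 2 (bclip N)).1.
  - exact: measurable_funX.
  - by move=> N y; rewrite ger0_norm ?sqr_ge0.
  - by move=> y; apply: cvgM; exact: clip_cvg.
have Ec : (fun N => Ex (m 0%N) (clip f N)) @ \oo --> (0 : R).
  have := Ex_clip_cvg fi (bmf_cst 1); rewrite (_ : Ex _ _ = 0); last first.
    by rewrite -Ef; apply: eq_Ex => y; rewrite mulr1.
  rewrite (_ : (fun N => _) = (fun N => Ex (m 0%N) (clip f N)))//.
  by apply/funext => N; apply: eq_Ex => y; rewrite mulr1.
have Ec2 : (fun N => Ex (m 0%N) (clip f N) ^+ 2) @ \oo --> (0 : R).
  by rewrite -[X in _ --> X](mulr0 (0 : R)); apply: cvgM.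
have /seq_cvgP/(_ _ e10) [N1 hN1] := vc; have /seq_cvgP/(_ _ e10) [N2 hN2] := Ec2.
pose N := maxn N1 N2.
have {hN1} dv M : v M - v N <= e / 10.
  have := hN1 N (leq_maxl _ _); rewrite distrC => /(le_trans (ler_norm _)).
  by have := vle M; lra.
have {hN2} hE : Ex (m 0%N) (clip f N) ^+ 2 <= e / 10.
  by have := hN2 N (leq_maxr _ _); rewrite subr0; apply: le_trans; exact: ler_norm.
have [n0 h0] := decorrelates_bmf (bclip N) e10.
exists n0 => n /h0 {}h0 h bh; have {h0} i1 := h0 h bh.
have bhs := bmf_comp (measurable_sub (pre n)) bh.
have c := Ex_clip_cvg fi bhs.
have c2 : (fun M => Ex (m 0%N) (fun y => clip f M y * h (sub (pre n) y)) ^+ 2) @ \oo -->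
    Ex (m 0%N) (fun y => f y * h (sub (pre n) y)) ^+ 2 by apply: cvgM.
have /cvg_lim <- // := c2; apply: limr_le; first exact: cvgP c2.
exists N => // M /= NM.
have bM := bclip M; have bN := bclip N.
have bd : bmf (fun y => clip f M y - clip f N y) := bmfB bM bN.
have -> : Ex (m 0%N) (fun y => clip f M y * h (sub (pre n) y)) =
    Ex (m 0%N) (fun y => clip f N y * h (sub (pre n) y)) +
    Ex (m 0%N) (fun y => (clip f M y - clip f N y) * h (sub (pre n) y)).
  by rewrite -ExD; [apply: eq_Ex => y; ring|exact: bmfM..].
have t1 := Ex_CS (m 0%N) bd bhs; rewrite (Ex_sub 0 (pre n) (bmfX 2 bh)) sz in t1.
have ed : Ex (m 0%N) (fun y => (clip f M y - clip f N y) ^+ 2) = v M - v N.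
  rewrite /v -ExB; [|by bmt..]; apply: eq_Ex => y; rewrite !clipE.
  case: (leP `|f y| N%:R) => hN; last by rewrite subr0 expr0n subr0.
  by rewrite ifT ?subrr ?expr0n// (le_trans hN)// ler_nat.
rewrite {}ed in t1.
have u3 : Ex (m n) h ^+ 2 <= Ex (m n) (fun y => h y ^+ 2).
  have := Ex_CS (m n) (bmf_cst 1) bh; under [X in X ^+ 2 <= _]eq_Ex do rewrite mul1r.
  by under [X in _ <= X * _]eq_Ex do rewrite expr1n; rewrite Ex_cst mul1r.
have H0 : 0 <= Ex (m n) (fun y => h y ^+ 2) by apply: Ex_ge0 => y; exact: sqr_ge0.
move: (dv M) hE => {}dv hE.
set a := Ex _ (fun y => clip f N y * _) in i1 *; set b := Ex _ (clip f N) in i1 hE.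
set d := Ex _ (fun y => (_ - _) * _) in t1 *; set s := Ex _ h in i1 u3.
move: (Ex _ _) i1 t1 u3 H0 => H i1 t1 u3 H0.
have v1 : d ^+ 2 <= e / 10 * H by apply: le_trans t1 _; rewrite ler_wpM2r.
have v2 : (b * s) ^+ 2 <= e / 10 * H.
  by rewrite exprMn; apply: ler_pM; rewrite ?sqr_ge0.
have -> : a + d = (a - b * s) + (b * s + d) by ring.
apply: le_trans (sqrD_le _ _) _; have v3 := sqrD_le (b * s) d.
have key (p q r t : R) : p <= e / 10 * H -> q <= e / 10 * H -> r <= e / 10 * H ->
  t <= 2 * q + 2 * r -> 2 * p + 2 * t <= e * H by lra.
exact: (key _ _ _ _ i1 v2 v1 v3).
Qed.

End decorrelation.

(** * The factor of a map, completed by the null sets *)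

Section null_sets.
Context {R : realType} {d} {T : measurableType d} (P : probability T R).

Lemma ae_full (S : set T) : measurable S -> P (~` S) = 0%E -> {ae P, forall x, S x}.
Proof. by move=> mS S0; exists (~` S); split => //; exact: measurableC. Qed.

Lemma ae_measure_eq (A B : set T) : measurable A -> measurable B ->
  {ae P, forall x, A x <-> B x} -> P A = P B.
Proof.
move=> mA mB AB.
have null (C D : set T) : measurable C -> measurable D -> {ae P, forall x, C x <-> D x} ->
    P (C `\` D) = 0%E.
  move=> mC mD CD; apply: measure_negligible; first exact: measurableD.
  by apply: negligibleS CD => x [Cx Dx] /= CD; exact: Dx (CD.1 Cx).
have BA : {ae P, forall x, B x <-> A x} by apply: filterS AB => x [].
have e1 := measureDI P mA mB; have e2 := measureDI P mB mA.
rewrite [X in (X + _)%E](null _ _ mA mB AB) add0e in e1.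
rewrite [X in (X + _)%E](null _ _ mB mA BA) add0e setIC in e2.
exact: etrans e1 (esym e2).
Qed.

Lemma ae_integral_eq (A B : set T) (f : T -> \bar R) : measurable A -> measurable B ->
  measurable_fun setT f -> {ae P, forall x, A x <-> B x} ->
  (\int[P]_(x in A) f x = \int[P]_(x in B) f x)%E.
Proof.
move=> mA mB mf AB; rewrite integral_mkcond [RHS]integral_mkcond.
apply: ae_eq_integral => //.
- by apply/(measurable_restrictT _ mA); exact: measurable_funTS.
- by apply/(measurable_restrictT _ mB); exact: measurable_funTS.
apply: filterS AB => x AB _; rewrite /patch.
by have -> : (x \in A) = (x \in B) by apply/idP/idP; rewrite !inE => /AB.
Qed.

End null_sets.

Lemma ae_preimage {R : realType} {d d'} {T : measurableType d} {T' : measurableType d'}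
    (P : probability T R) (Q : probability T' R) (f : T -> T') (S : T' -> Prop) :
  measurable_fun setT f -> (forall A, measurable A -> P (f @^-1` A) = Q A) ->
  {ae Q, forall y, S y} -> {ae P, forall x, S (f x)}.
Proof.
move=> mf PQ [N [mN N0 NS]]; exists (f @^-1` N); split.
- by rewrite -[X in measurable X]setTI; exact: mf.
- by rewrite PQ.
- by move=> x /= nS; exact: NS.
Qed.

Section map_factor.
Context {R : realType} {d d'} {X : measurableType d} {Y : measurableType d'}.
Variables (mu : probability X R) (s : X -> Y) (ms : measurable_fun setT s).

(** With the null sets included, the factors of two sibling subtrees generate the
    factor of their parent exactly. *)
Definition map_factor : set (set X) := [set A | measurable A /\
  exists2 A' : set Y, measurable A' & {ae mu, forall x, A x <-> A' (s x)}].

Lemma map_factor_measurable : map_factor `<=` measurable.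
Proof. by move=> A []. Qed.

Lemma map_factor_preimage A' : measurable A' -> map_factor (s @^-1` A').
Proof.
move=> mA; split; first exact: measurable_preimage.
by exists A' => //; apply: aeW => x.
Qed.

Lemma map_factor_null A : measurable A -> mu A = 0%E -> map_factor A.
Proof.
move=> mA A0; split => //; exists set0 => //.
by exists A; split => // x /= h; apply: contrapT => nA; apply: h; split.
Qed.

Lemma map_factor_sigma : sigma_algebra setT map_factor.
Proof.
split.
- by apply: map_factor_null; [exact: measurable0|exact: measure0].
- move=> A [mA [A' mA' AA']]; split; first exact: measurableD.
  exists (~` A'); first exact: measurableC.
  by apply: filterS AA' => x AA'; split => [[_ nA] /AA'|nA']// ; split => // /AA'.
- move=> A hA; split; first by apply: bigcup_measurable => n _; exact: (hA n).1.
  have /choice[A' hA'] : forall n, exists B : set Y, measurable B /\ {ae mu, forall x, A n x <-> B (s x)}.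
    by move=> n; have [_ [B mB hB]] := hA n; exists B.
  exists (\bigcup_n A' n); first by apply: bigcup_measurable => n _; exact: (hA' n).1.
  have : {ae mu, forall x, forall n, A n x <-> A' n (s x)}.
    by apply: ae_foralln => n; exact: (hA' n).2.
  by apply: filterS => x h; split => -[n _ /h hn]; exists n.
Qed.

(** The sets of the factor differ from preimages under s by null sets, which do not
    change integrals. *)
Lemma map_factor_cond_exp (f : X -> R) (g : Y -> R) :
  mu.-integrable setT (EFin \o f) -> (law mu ms).-integrable setT (EFin \o g) ->
  (forall A, measurable A -> (\int[law mu ms]_(x in A) (g x)%:E = \int[mu]_(x in s @^-1` A) (f x)%:E)%E) ->
  is_cond_exp mu map_factor f (fun x => g (s x)).
Proof.
move=> fi gi fg.
have mg : measurable_fun setT (EFin \o g) := measurable_int _ gi.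
have gsi : mu.-integrable setT (EFin \o (fun x => g (s x))).
  apply/integrableP; split; first exact: (measurableT_comp mg ms).
  move/integrableP : gi => [_]; apply: le_lt_trans.
  rewrite -[X in (_ <= X)%E]/(\int[pushforward mu s]_x `|(EFin \o g) x|)%E.
  rewrite ge0_integral_pushforward//.
  exact: measurableT_comp.
split => //.
- move=> _ [B mB <-]; rewrite setTI -[X in map_factor X]/(s @^-1` (g @^-1` B)).
  apply: map_factor_preimage; rewrite -[X in measurable X]setTI.
  by have /measurable_EFinP := mg; exact.
- move=> A [mA [A' mA' AA']]; have mS := measurable_preimage ms mA'.
  have mf : measurable_fun setT (EFin \o f) := measurable_int _ fi.
  rewrite (ae_integral_eq mA mS (measurable_int _ gsi) AA') (ae_integral_eq mA mS mf AA').
  rewrite -(fg _ mA') -[RHS]/(\int[pushforward mu s]_(y in A') (EFin \o g) y)%E.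
  rewrite integral_pushforward//.
  exact: integrableS gsi.
Qed.

End map_factor.

(** * Ergodic infinite divisibility of the tree *)

Section tree_divisibility.
Context {R : realType}.
Notation J := (seq bool * int)%type.
Notation X := (RJ J R).

Variable m : nat -> probability X R.
Hypotheses
  (m_pos : forall j l, 0 < ch2 (m j) l)
  (m_node : forall j A, measurable A -> m j A = prodp (m j.+1) (m j.+1) (node @^-1` A))
  (m_tshift : forall j A, measurable A -> m j (tshift @^-1` A) = m j A).

Definition subtree_factor (w : seq bool) : set (set X) := map_factor (m 0%N) (@sub R w).

Lemma m_tunshift j A : measurable A -> m j (tunshift @^-1` A) = m j A.
Proof.
move=> mA; rewrite -m_tshift; last exact: measurable_preimage measurable_tunshift mA.
by congr (m j _); apply/seteqP; split => x /=; rewrite tshiftK.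
Qed.

Lemma m0_sub w A : measurable A -> m 0%N (sub w @^-1` A) = m (size w) A.
Proof. by move=> mA; rewrite (m_sub m_node)// addn0. Qed.

Lemma subtree_factor_invariant w : invariant_factor tshift (subtree_factor w).
Proof.
split; [exact: map_factor_sigma|exact: map_factor_measurable|].
have stable (t : X -> X) A : measurable_fun setT t ->
    (forall B, measurable B -> m 0%N (t @^-1` B) = m 0%N B) ->
    (forall y, sub w (t y) = t (sub w y)) ->
    subtree_factor w A -> subtree_factor w (t @^-1` A).
  move=> mt pt st [mA [A' mA' AA']]; split; first exact: measurable_preimage mt mA.
  exists (t @^-1` A'); first exact: measurable_preimage mt mA'.
  have := ae_preimage mt pt AA'; apply: filterS => x.
  by rewrite -[(t @^-1` A') _]/(A' (t (sub w x))) -st.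
apply/seteqP; split => [_ [A hA <-]|A hA].
  by rewrite setTI; apply: stable => //; [exact: measurable_tshift|exact: m_tshift].
exists (tunshift @^-1` A).
  by apply: stable => //; [exact: measurable_tunshift|exact: m_tunshift].
by rewrite setTI; apply/seteqP; split => x /=; rewrite tshiftK.
Qed.

Lemma subtree_factor_nil : subtree_factor [::] = measurable.
Proof.
apply/seteqP; split => [|A mA]; first exact: map_factor_measurable.
have -> : A = sub [::] @^-1` A by apply/seteqP; split => x /=; rewrite sub_nil.
apply: map_factor_preimage => //; exact: measurable_sub.
Qed.

Lemma sub_rcons w b (y : X) : sub (rcons w b) y = sub [:: b] (sub w y).
Proof. by rewrite sub_cat cats1. Qed.

Lemma m_children j A B : measurable A -> measurable B ->
  m j (sub [:: false] @^-1` A `&` sub [:: true] @^-1` B) = (m j.+1 A * m j.+1 B)%E.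
Proof.
move=> mA mB; have mS b (C : set X) : measurable C -> measurable (sub [:: b] @^-1` C).
  by move=> mC; exact: measurable_preimage (measurable_sub _) mC.
rewrite m_node; last by apply: measurableI; exact: mS.
rewrite -prodpE//; congr (prodp _ _ _); apply/seteqP; split => y /=; by rewrite !sub_node.
Qed.

Lemma subtree_factor_independent w :
  independent_algebras (m 0%N) (subtree_factor (rcons w false)) (subtree_factor (rcons w true)).
Proof.
move=> A B [mA [A' mA' AA']] [mB [B' mB' BB']].
have mS b (C : set X) : measurable C -> measurable (sub (rcons w b) @^-1` C).
  by move=> mC; exact: measurable_preimage (measurable_sub _) mC.
rewrite (ae_measure_eq mA (mS false _ mA') AA') (ae_measure_eq mB (mS true _ mB') BB').
rewrite (@ae_measure_eq _ _ _ _ (A `&` B) (sub (rcons w false) @^-1` A' `&` sub (rcons w true) @^-1` B')); last 3 first.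
- exact: measurableI.
- by apply: measurableI; exact: mS.
- apply: filterS2 AA' BB' => x h k; split => -[]; first by move=> /h a /k b; split.
  by move=> /h a /k b; split.
rewrite !m0_sub// !size_rcons -m_children// -(m0_sub w); last first.
  by apply: measurableI; apply: measurable_preimage (measurable_sub _) _.
by congr (m 0%N _); apply/seteqP; split => x /=; rewrite !sub_rcons.
Qed.

(** A subtree is almost surely rebuilt from its two children by node; the sets on
    which this fails are null, hence belong to every factor. *)
Lemma subtree_factor_generated w : subtree_factor w =
  <<s subtree_factor (rcons w false) `|` subtree_factor (rcons w true) >>.
Proof.
set F := _ `|` _; apply/seteqP; split; last first.
  apply: smallest_sub; first exact: map_factor_sigma.
  have sb b : subtree_factor (rcons w b) `<=` subtree_factor w.
    move=> A [mA [A' mA' AA']]; split => //.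
    exists (sub [:: b] @^-1` A'); first exact: measurable_preimage (measurable_sub _) mA'.
    by apply: filterS AA' => x; rewrite /= -sub_rcons.
  by move=> A [|]; exact: sb.
have sF b A : subtree_factor (rcons w b) A -> <<s F >> A.
  move=> hA; apply: sub_sigma_algebra; case: b hA => hA; [by right|by left].
move=> A [mA [A' mA' AA']].
pose c (x : X) : X * X := (sub (rcons w false) x, sub (rcons w true) x).
pose D := c @^-1` (node @^-1` A').
have mN := measurable_preimage (@measurable_node R) mA'.
have FD : <<s F >> D.
  pose X' := g_sigma_algebraType F.
  have mb b : measurable_fun setT (sub (rcons w b) : X' -> X).
    move=> _ B mB; rewrite setTI; apply: sF; apply: map_factor_preimage => //; exact: measurable_sub.
  have mc : measurable_fun setT (c : X' -> X * X) by apply: measurable_fun_pair; exact: mb.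
  by have := mc measurableT _ mN; rewrite setTI.
have mD : measurable D.
  apply: (measurable_preimage _ mN); apply: measurable_fun_pair; exact: measurable_sub.
pose c1 (y : X) : X * X := (sub [:: false] y, sub [:: true] y).
have AD : {ae m 0%N, forall x, A x <-> D x}.
  pose S := [set y : X | A' y <-> A' (node (c1 y))].
  have mS : measurable S.
    have m1 : measurable (c1 @^-1` (node @^-1` A')).
      by apply: (measurable_preimage _ mN); apply: measurable_fun_pair; exact: measurable_sub.
    have -> : S = (A' `&` c1 @^-1` (node @^-1` A')) `|` (~` A' `&` ~` (c1 @^-1` (node @^-1` A'))).
      apply/seteqP; split => y.
        move=> [h1 h2]; have [a|a] := pselect (A' y); [left; split => //; exact: h1|right].
        by split => // /h2.
      by move=> [[a b]|[a b]]; split.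
    apply: measurableU; apply: measurableI => //; exact: measurableC.
  have S0 : m (size w) (~` S) = 0%E.
    rewrite m_node; last exact: measurableC.
    rewrite (_ : _ @^-1` _ = set0); first exact: measure0.
    apply/seteqP; split => // y; apply.
    have e : c1 (node y) = y by rewrite /c1 !sub_node; case: y.
    by rewrite /S /= e.
  have := ae_preimage (measurable_sub w) (@m0_sub w) (ae_full mS S0).
  apply: filterS2 AA' => x h1 h2.
  have e : D x = A' (node (c1 (sub w x))) by rewrite /D /c /= !sub_rcons.
  by rewrite e; split => [/h1/h2//|/h2/h1].
have null (B C : set X) : measurable B -> measurable C -> {ae m 0%N, forall x, B x <-> C x} ->
    <<s F >> (B `\` C).
  move=> mB mC BC; apply: (sF false); apply: map_factor_null; first exact: measurableD.
  apply: measure_negligible; first exact: measurableD.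
  by apply: negligibleS BC => x [Bx Cx] /= h; exact: Cx (h.1 Bx).
have DA : {ae m 0%N, forall x, D x <-> A x} by apply: filterS AD => x [].
pose X' := g_sigma_algebraType F.
have n1 : measurable (A `\` D : set X') := null _ _ mA mD AD.
have n2 : measurable (D `\` A : set X') := null _ _ mD mA DA.
have -> : A = (D `\` (D `\` A)) `|` (A `\` D).
  apply/seteqP; split => x.
    move=> Ax; have [Dx|Dx] := pselect (D x); [left|right] => //; by split => // -[].
  by move=> [[Dx h]|[]//]; apply: contrapT => nA; apply: h.
exact: (@measurableU _ X' _ _ (measurableD (FD : measurable (D : set X')) n2) n1).
Qed.

Theorem tree_divisible : ergodic (m 0%N) tshift ->
  ergodically_infinitely_divisible (m 0%N) tshift.
Proof.
move=> erg; split => //.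
  split; first by split; [exact: measurable_tshift|exact: m_tshift].
  by exists tunshift; split; [exact: tshiftK|exact: tunshiftK|exact: measurable_tunshift].
exists subtree_factor; split.
- exact: subtree_factor_invariant.
- exact: subtree_factor_nil.
- by move=> w; split; [exact: subtree_factor_independent|exact: subtree_factor_generated].
move=> f eta f2 Ef.
have f2i := Lfun2_integrable_sqr f2.
have mT : m 0%N setT \is a fin_num by rewrite fin_num_measure.
have fi : (m 0%N).-integrable setT (EFin \o f).
  by apply/Lfun1_integrable; exact: (Lfun_subset12 mT) f2.
have Ef0 : Ex (m 0%N) f = 0.
  by move: Ef; rewrite unlock /Ex /Rintegral => ->.
have ms n := @measurable_sub R (mkseq eta n).
have /choice[g hg] : forall n, exists g : X -> R,
    (law (m 0%N) (ms n)).-integrable setT (EFin \o g) /\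
    forall A, measurable A -> (\int[law (m 0%N) (ms n)]_(x in A) (g x)%:E =
      \int[m 0%N]_(x in sub (mkseq eta n) @^-1` A) (f x)%:E)%E.
  by move=> n; exact: cond_exp_exists.
exists (fun n x => g n (sub (mkseq eta n) x)).
  by move=> n; apply: map_factor_cond_exp (hg n).1 (hg n).2.
apply: Lnorm2_cvg0 => e e0.
have [n0 h0] := decorrelates_L2 m_pos m_node eta fi f2i Ef0 e0.
exists n0 => n /h0 {}h0; apply: (cond_exp_sqr (ltW e0) fi (hg n).1 (hg n).2) => h bh.
rewrite (@eq_Ex_measure _ _ _ (law (m 0%N) (ms n)) (m n)); first exact: h0.
by move=> A mA; rewrite lawE m0_sub// size_mkseq.
Qed.

End tree_divisibility.

(** * Countable real product spaces are standard Borel *)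

(** A copy of the function space, to carry the pseudometric below. *)
Definition polish_product (J : countType) (R : realType) : Type := J -> R.

Section product_balls.
Context {J : countType} {R : realType}.
Notation U := (polish_product J R).

Definition weight (j : J) : R := (pickle j).+1%:R^-1.

Lemma weight_gt0 j : 0 < weight j.
Proof. by rewrite invr_gt0. Qed.

(** Two points are within e if their coordinates of weight more than e are: finitely
    many coordinates, since the weights tend to 0. *)
Definition product_ball (x : U) (e : R) : set U :=
  [set y | 0 < e /\ forall j, e < weight j -> `|x j - y j| < e].

Lemma product_ball_center x (e : R) : 0 < e -> product_ball x e x.
Proof. by move=> e0; split => // j _; rewrite subrr normr0. Qed.

Lemma product_ball_sym x y (e : R) : product_ball x e y -> product_ball y e x.
Proof. by move=> [e0 h]; split => // j /h; rewrite distrC. Qed.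

Lemma product_ball_triangle x y z e1 e2 :
  product_ball x e1 y -> product_ball y e2 z -> product_ball x (e1 + e2) z.
Proof.
move=> [e10 h1] [e20 h2]; split; first by rewrite addr_gt0.
move=> j ej; apply: le_lt_trans (ler_distD (y j) _ _) _; apply: ltrD.
- by apply: h1; apply: lt_trans ej; rewrite ltrDl.
- by apply: h2; apply: lt_trans ej; rewrite ltrDr.
Qed.

HB.instance Definition _ := gen_eqMixin U.
HB.instance Definition _ := gen_choiceMixin U.
HB.instance Definition _ := isPointed.Build U (fun=> 0).
HB.instance Definition _ := hasNbhs.Build U (nbhs_ (entourage_ product_ball)).
HB.instance Definition _ := @Nbhs_isPseudoMetric.Build R U
  (entourage_ product_ball) erefl product_ball
  product_ball_center product_ball_sym product_ball_triangle erefl.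

Implicit Types x y : U.

Lemma nbhs_coord x j (d : R) : 0 < d -> nbhs x [set y : U | `|x j - y j| < d].
Proof.
move=> d0; apply/nbhs_ballP; have w0 := weight_gt0 j.
exists (Num.min d (weight j / 2)) => /=; first by rewrite lt_min d0 divr_gt0.
move=> y [_ /(_ j)]; rewrite gt_min [weight j / 2 < _]ltr_pdivrMr// ltr_pMr// ltr1n orbT.
by move=> /(_ isT); rewrite lt_min => /andP[].
Qed.

(* the finitely many coordinates that a ball of radius e constrains *)
Definition support (e : R) : seq J := pmap unpickle (iota 0 (Num.bound e^-1)).

Lemma mem_support (e : R) j : 0 < e -> e < weight j -> j \in support e.
Proof.
move=> e0 ej; rewrite mem_pmap; apply/mapP; exists (pickle j); last by rewrite pickleK.
rewrite mem_iota add0n /=.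
have : (pickle j).+1%:R < e^-1 by rewrite -[X in X < _]invrK ltf_pV2 ?posrE ?invr_gt0.
move=> /lt_trans/(_ (archi_boundP _)); rewrite ltr_nat => h; apply: ltnW; apply: h.
by rewrite invr_ge0 ltW.
Qed.

Lemma filter_ball (F : set_system U) (l : U) (e : R) : Filter F -> 0 < e ->
  (forall j, F [set y : U | `|l j - y j| < e]) -> F (ball l e).
Proof.
move=> FF e0 h.
have : forall s : seq J, F [set y : U | forall j, j \in s -> `|l j - y j| < e].
  elim=> [|i s IH]; first by apply: filterS filterT => y _ j.
  apply: filterS2 (h i) IH => y yi ys j; rewrite inE => /predU1P[->//|]; exact: ys.
move=> /(_ (support e)); apply: filterS => y hy; split => // j ej.
by apply: hy; exact: mem_support.
Qed.

Lemma product_complete (F : set_system U) : ProperFilter F -> cauchy F -> cvg F.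
Proof.
move=> FF /cauchyP Fc.
have hc j : cvg ((fun y : U => y j) @ F).
  apply: cauchy_cvg; apply/cauchyP => e e0.
  pose r := Num.min e (weight j / 2); have w0 := weight_gt0 j.
  have r0 : 0 < r by rewrite lt_min e0 divr_gt0.
  have [x Fx] := Fc r r0; exists (x j).
  suff : F [set y : U | `|x j - y j| < e] by [].
  apply: filterS Fx => y yx.
  have [_ /(_ j)] : product_ball x r y := yx.
  rewrite /r gt_min [weight j / 2 < _]ltr_pdivrMr// ltr_pMr// ltr1n orbT.
  by move=> /(_ isT); rewrite lt_min => /andP[].
pose l : U := fun j => lim ((fun y : U => y j) @ F).
apply/cvg_ex; exists l; apply/cvg_ballP => e e0; apply: filter_ball => // j.
have /cvg_ballP/(_ _ e0) := hc j; exact.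
Qed.

HB.instance Definition _ := Uniform_isComplete.Build U product_complete.

Lemma product_hausdorff : hausdorff_space U.
Proof.
move=> p q pq; apply/funext => j; apply/eqP; rewrite -subr_eq0 -normr_eq0.
apply: contrapT => /negP ne.
have d0 : 0 < `|p j - q j| / 2 by rewrite divr_gt0// lt_neqAle eq_sym ne normr_ge0.
have [y [/= py qy]] := pq _ _ (nbhs_coord p j d0) (nbhs_coord q j d0).
have := ler_distD (y j) (p j) (q j); rewrite [`|y j - _|]distrC leNgt => /negP; apply.
by rewrite [X in _ < X]splitr ltrD.
Qed.

Definition rational_box (s : seq (J * (rat * rat))) : set U :=
  [set x | forall p, p \in s -> ratr p.2.1 < x p.1 < ratr p.2.2].

Lemma rational_box_nil : rational_box [::] = setT.
Proof. by apply/seteqP; split. Qed.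

Lemma rational_box_cons p s : rational_box (p :: s) =
  [set x | ratr p.2.1 < x p.1 < ratr p.2.2] `&` rational_box s.
Proof.
apply/seteqP; split => x.
  by move=> h; split; [apply: h; rewrite mem_head|move=> q qs; apply: h; rewrite inE qs orbT].
by move=> [h1 h2] q; rewrite inE => /predU1P[->//|]; exact: h2.
Qed.

Lemma open_rational_box s : open (rational_box s).
Proof.
elim: s => [|p s IH]; first by rewrite rational_box_nil; exact: openT.
rewrite rational_box_cons; apply: openI => //; rewrite openE => x /= /andP[h1 h2].
have d1 : 0 < x p.1 - ratr p.2.1 by rewrite subr_gt0.
have d2 : 0 < ratr p.2.2 - x p.1 by rewrite subr_gt0.
apply: filterS2 (nbhs_coord x p.1 d1) (nbhs_coord x p.1 d2) => y /=.
by rewrite !ltr_norml => /andP[_ k1] /andP[k2 _]; apply/andP; split; lra.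
Qed.

Lemma rational_box_basis x (A : set U) : nbhs x A ->
  exists s, rational_box s x /\ rational_box s `<=` A.
Proof.
move=> /nbhs_ballP[e /= e0 eA].
have /choice[a ha] : forall j : J, exists a : rat, x j - e < ratr a < x j.
  move=> j; have [a] := @rat_in_itvoo R (x j - e) (x j) (ltac:(by rewrite ltrBlDr ltrDl)).
  by rewrite in_itv/= => h; exists a.
have /choice[b hb] : forall j : J, exists b : rat, x j < ratr b < x j + e.
  move=> j; have [b] := @rat_in_itvoo R (x j) (x j + e) (ltac:(by rewrite ltrDl)).
  by rewrite in_itv/= => h; exists b.
exists [seq (j, (a j, b j)) | j <- support e]; split.
  move=> _ /mapP[j _ ->] /=.
  by have /andP[_ ->] := ha j; have /andP[-> _] := hb j.
move=> y hy; apply: eA; split => // j ej.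
have /= := hy (j, (a j, b j)) (map_f _ (mem_support e0 ej)).
have /andP[h1 h2] := ha j; have /andP[h3 h4] := hb j => /andP[h5 h6].
by rewrite ltr_norml; apply/andP; split; lra.
Qed.

Lemma product_second_countable : @second_countable U.
Proof.
exists (range rational_box); first exact: sub_countable (card_image_le _ _) (countableP _).
split => [_ [s _ <-]|x A /rational_box_basis[s [xs sA]]]; first exact: open_rational_box.
by exists (rational_box s) => //; split => //; exists s.
Qed.

Lemma measurable_rational_box s : measurable (rational_box s : set (RJ J R)).
Proof.
elim: s => [|p s IH]; first by rewrite rational_box_nil; exact: measurableT.
rewrite rational_box_cons; apply: measurableI => //.
have -> : [set x : U | ratr p.2.1 < x p.1 < ratr p.2.2] =
    (fun x : RJ J R => x p.1) @^-1` `]ratr p.2.1, ratr p.2.2[%classic.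
  by apply/seteqP; split => x /=; rewrite in_itv.
by rewrite -[X in measurable X]setTI; apply: measurable_coord => //; exact: measurable_itv.
Qed.

(** The coordinates are continuous, and an open set is the union of the countably many
    rational boxes that it contains. *)
Lemma product_borel : (measurable : set (set (RJ J R))) = <<s [set V : set U | open V] >>.
Proof.
apply/seteqP; split.
  apply: smallest_sub; first exact: smallest_sigma_algebra.
  pose U' := g_sigma_algebraType [set V : set U | open V].
  have mc j : measurable_fun setT (fun x : U' => x j : R).
    apply: (measurability _ (RGenOInfty.measurableE R)) => //.
    move=> _ [_ [a ->] <-]; rewrite setTI; apply: sub_sigma_algebra => /=.
    rewrite openE => x /=; rewrite in_itv/= andbT => ax.
    have d0 : 0 < x j - a by rewrite subr_gt0.
    apply: filterS (nbhs_coord x j d0) => y /=; rewrite in_itv/= andbT ltr_norml => /andP[_]; lra.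
  by move=> _ [j _ [B mB <-]]; exact: (mc j measurableT B mB).
apply: smallest_sub; first exact: sigma_algebra_measurable.
move=> V oV.
pose B n : set (RJ J R) := if unpickle n is Some s then
  if pselect (rational_box s `<=` V) then rational_box s else set0 else set0.
have -> : V = \bigcup_n B n.
  apply/seteqP; split => x.
    move=> Vx; have /rational_box_basis[s [xs sV]] : nbhs (x : U) V by exact: open_nbhs_nbhs.
    by exists (pickle s) => //; rewrite /B pickleK; case: pselect.
  by rewrite /B => -[n _]; case: unpickle => // s; case: pselect => // sV; exact: sV.
apply: (bigcupT_measurable B) => n; rewrite /B; case: unpickle => [s|]; last exact: measurable0.
by case: ifP => _; [exact: measurable_rational_box|exact: measurable0].
Qed.

Theorem standard_borel_product : standard_borel R (RJ J R).
Proof.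
exists U; split; [exact: product_hausdorff|exact: product_second_countable|].
exists id; first by exists id.
rewrite product_borel; apply/seteqP; split => [A hA|_ [A hA <-]]; last by rewrite setTI.
by exists A => //; rewrite setTI.
Qed.

End product_balls.

(** * The process at the root as a factor *)

Theorem mainTheorem7 (R : realType) (P : probability (RZ R) R)
    (P_stat : measure_preserving P (@shiftZ R))
    (P_id : infinitely_divisible P)
    (P_erg : ergodic P (@shiftZ R)) :
  exists (d : measure_display) (X : measurableType d)
         (mu : probability X R) (T : X -> X),
    standard_borel R X /\
    ergodically_infinitely_divisible mu T /\
    is_factor_of P (@shiftZ R) mu T.
Proof.
have [Q [Q0 Q_root Q_stat Q_pos]] := root_sequence P_stat P_id.
have Q_erg : ergodic (Q 0%N) (@shiftZ R).
  by move=> A mA invA; rewrite !Q0//; exact: P_erg.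
have Q_mix n k := roots_wmix Q_root Q_stat Q_pos Q_erg k n.
have [m [m_node m_root m_tshift]] := tree_measures Q_root Q_stat.
have m_pos := tree_ch2_gt0 Q_pos m_node m_root.
exists _, (RJ (seq bool * int) R), (m 0%N), (@tshift R).
split; first exact: standard_borel_product.
split; first exact: tree_divisible m_pos m_node m_tshift (tree_ergodic Q_pos Q_mix m_node m_root m_tshift 0).
exists (@root_of R); split; first exact: measurable_root_of.
- by move=> A mA; rewrite m_root// Q0.
- by apply: aeW.
Qed.
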